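(* Let $(\mathcal{X},d)$ be a complete separable metric space. Consider the symmetric cost function $c(x,y)=(d(x,y))^{q}$, where $0<q<1$. Let $\mathcal{B}_{w}(x):=\{y\in\mathcal{X}: d(x,y)\le w\}$. Let $\mu$ be a $\sigma$-finite measure over $\mathcal{X}$ and let $\Psi>0$ satisfy: (i) $0<\mu(\mathcal{B}_{w}(x))<\infty$ for any $x\in\mathcal{X}$, $w>0$; (ii) for any $x,y\in\mathcal{X}$ and $w>0$, \[ \frac{\mu(\mathcal{B}_{w}(x)\backslash\mathcal{B}_{w}(y))}{\mu(\mathcal{B}_{w}(x))}\le\frac{\Psi\, d(x,y)}{w}; \] (iii) \[ \limsup_{w\to\infty}\ \sup_{x,y\in\mathcal{X}:\,d(x,y)\le w}\frac{\mu(\mathcal{B}_{w}(x))}{\mu(\mathcal{B}_{w}(y))}<\infty. \] Then \[ r_{c}^{*}(\mathcal{P}(\mathcal{X}))<7.56\cdot\frac{(2.47\,\Psi)^{q}}{1-q}. \]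
   Context: Polish spaces carry their Borel $\sigma$-algebras. A symmetric cost function over a Polish space $\mathcal{X}$ is a function $c:\mathcal{X}^2\to[0,\infty)$ that is measurable with respect to the product $\sigma$-algebra, symmetric, not identically zero, and satisfies $c(x,x)=0$ for all $x$. $\mathcal{P}(\mathcal{X})$ is the set of all probability distributions over $\mathcal{X}$. A coupling of a collection $\{P_\alpha\}_{\alpha\in\mathcal{A}}$ of probability distributions over $\mathcal{X}$ ($\mathcal{A}$ an arbitrary index set) is a family of random variables $X_\alpha:[0,1]\to\mathcal{X}$, all defined on the standard probability space ($[0,1]$, Lebesgue measurable sets, Lebesgue measure), with $X_\alpha\sim P_\alpha$ for every $\alpha$. For $P,Q\in\mathcal{P}(\mathcal{X})$, $C_c^*(P,Q):=\inf\mathbf{E}[c(X,Y)]$ over couplings $(X,Y)$ of $(P,Q)$. The pairwise coupling ratio of a coupling is $r_c(\{X_\alpha\}_{\alpha}):=\inf\{r\ge1:\mathbf{E}[c(X_\alpha,X_\beta)]\le r\,C_c^*(P_\alpha,P_\beta)\ \forall\alpha,\beta\in\mathcal{A}\}$ ($\infty$ if no such $r$ exists), and $r_c^*(\{P_\alpha\}_{\alpha}):=\inf r_c(\{X_\alpha\}_\alpha)$ over all couplings of $\{P_\alpha\}_\alpha$. A set of probability distributions, such as $\mathcal{P}(\mathcal{X})$, is regarded as a collection indexed by itself. *)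

(* Defs.v *)
From HB Require Import structures.
From mathcomp Require Import all_boot all_order all_algebra.
From mathcomp Require Import all_classical all_reals all_analysis.

Set Implicit Arguments.
Unset Strict Implicit.
Unset Printing Implicit Defensive.

Import Order.TTheory GRing.Theory Num.Theory.
Import numFieldNormedType.Exports.

Local Open Scope classical_set_scope.
Local Open Scope ring_scope.

#[short(type="completeMetricType")]
HB.structure Definition CompleteMetric (R : numDomainType) :=
  { T of Complete T & Metric R T }.

Definition separable (T : topologicalType) : Prop :=
  exists2 D : set T, countable D & dense D.

Definition borel (T : ptopologicalType) : measurableType (@open T).-sigma :=
  g_sigma_algebraType (@open T).

(* The library's [closed_ball] is the closure of the open ball, which can be
   strictly smaller than this set. *)
Definition mcball (R : numDomainType) (T : metricType R) (x : T) (w : R) :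
    set T :=
  [set y | mdist x y <= w].

(* The real line with the sigma-algebra of Lebesgue measurable sets (the domain
   of [completed_lebesgue_measure]). *)
Definition lebesgue_line (R : realType) : measurableType _ :=
  caratheodory_type ((wlength (idfun : R -> R))^*)%mu.

(* The standard probability space is the trace of [lebesgue_line] on this set:
   random variables are functions measurable on it, and their values outside
   play no role. *)
Definition I01 (R : realType) : set (lebesgue_line R) :=
  [set x : R | x \in `[0, 1]].
Arguments I01 R : clear implicits.

Section coupling.
Context (R : realType) (d : measure_display) (T : measurableType d).

Definition symmetric_cost (c : T -> T -> R) : Prop :=
  [/\ measurable_fun [set: T * T] (fun z => c z.1 z.2),
      forall x y, 0 <= c x y,
      forall x y, c x y = c y x,
      forall x, c x x = 0
    & exists x y, c x y != 0].

Local Notation lambda := (@completed_lebesgue_measure R).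

Definition has_law (X : lebesgue_line R -> T) (P : probability T R) : Prop :=
  measurable_fun (I01 R) X /\
  forall A : set T, measurable A -> lambda (I01 R `&` X @^-1` A) = P A.

Definition is_coupling (A : Type) (P : A -> probability T R)
    (X : A -> lebesgue_line R -> T) : Prop :=
  forall a, has_law (X a) (P a).

Local Open Scope ereal_scope.

Definition expected_cost (c : T -> T -> R) (X Y : lebesgue_line R -> T) :
    \bar R :=
  \int[lambda]_(w in I01 R) (c (X w) (Y w))%:E.

Definition optimal_cost (c : T -> T -> R) (P Q : probability T R) : \bar R :=
  ereal_inf [set e | exists X Y : lebesgue_line R -> T,
    [/\ has_law X P, has_law Y Q & e = expected_cost c X Y]].

Definition coupling_ratio (c : T -> T -> R) (A : Type)
    (P : A -> probability T R) (X : A -> lebesgue_line R -> T) : \bar R :=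
  ereal_inf [set r%:E | r in [set r : R | (1 <= r)%R /\
    forall a b, expected_cost c (X a) (X b) <= r%:E * optimal_cost c (P a) (P b)]].

Definition optimal_ratio (c : T -> T -> R) (A : Type)
    (P : A -> probability T R) : \bar R :=
  ereal_inf [set coupling_ratio c P X | X in [set X | is_coupling P X]].

End coupling.

(* Main.v *)
(* Fix scales w_j in geometric progression, of ratio theta with theta^q = e^(5/3), and encode
   a point x at scale w by the cell, of diameter about w / 1000, of a point drawn from mu on
   B_w(x). By (ii), the laws of the codes of x and y are within 2 Psi d(x,y) / w in l^1.
   A distribution P thus induces a law on the sequences of codes from coarse to fine scales.
   All these sequences are drawn together, symbol by symbol: the next symbol is sampled from
   its conditional law by a race between independent uniform variables attached to the scale
   and common to all P, so that two symbols of conditional laws p and p' differ with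
   probability at most |p - p'|_1. The codes converge to a point of law P, and when the coarsest
   scale tends to infinity this point becomes eventually constant along a subsequence.
   For P and Q with an arbitrary coupling (X', Y'), a first disagreement at scale w has
   probability at most a sum of two terms 2 E min(1, A d(X',Y') / w), A = Psi theta / (theta - 1),
   and then the two points are within 2 (1 + 1/1000) theta w. Averaging over N interlaced
   progressions makes the sum of w^q min(1, A d / w) over the scales close to
   N times the integral of w^(q-1) min(1, A d / w), which is (A d)^q / (q (1 - q)), divided by
   5 / (3 q). *)

From HB Require Import structures.
Require Import Defs.
From mathcomp Require Import all_boot all_order all_algebra.
From mathcomp Require Import all_classical all_reals all_analysis.
From mathcomp Require Import measurable_realfun ring lra.

Set Implicit Arguments.
Unset Strict Implicit.
Unset Printing Implicit Defensive.

Import Order.TTheory GRing.Theory Num.Theory.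
Import numFieldNormedType.Exports.

Local Open Scope classical_set_scope.
Local Open Scope ring_scope.

(** There is no coarsest scale to begin with: a chain has to start at some level [n], and the points
    reached from different starting levels must agree with high probability. A chain started higher
    has a longer history, which changes its conditional laws. Two effects bound the change: for
    large [n] the codes above level [n] hardly depend on the point, and after [t] more symbols the
    point is known up to a multiple of [w_n / theta^t], so the older codes add almost no
    information. The common randomness is indexed by the level of a step, not by its rank in the
    chain, to make such chains comparable. The exponent 5/3 is a compromise. A disagreement at one
    scale is paid at the next coarser one, which gives [2 * (1 + u) / ln u] with [u = theta^q];
    alone, this would favour [u] near 3.6. A larger [theta] lowers [theta / (theta - 1)], whose
    worst value is approached as [q] tends to 1. At [u = e^(5/3)] the first quantity is about 7.553
    and twice the second is below 2.466, whence 7.56 and 2.47; the gaps absorb the cell size and the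
    finite number of progressions. *)

Lemma le_of_eq d (T : porderType d) (x y : T) : x = y -> (x <= y)%O.
Proof. by move=> ->. Qed.

Lemma measurable_pre d (Om : measurableType d) d' (T : measurableType d') (f : Om ->
  T) (A : set T) :
  measurable_fun setT f -> measurable A -> measurable (f @^-1` A).
Proof. by move=> mf mA; rewrite -[X in measurable X]setTI; exact: mf. Qed.

(** * Properties required of the common randomness *)

Section random_input.
Context (R : realType) d (Om : measurableType d) (P : probability Om R).

(** Taking [A] or [B] to be the whole space shows that [s1] and [s2] both preserve [P]: one random
    input is turned into two independent inputs of the same law. *)
Definition independent_halves (s1 s2 : Om -> Om) : Prop := forall A B, measurable A ->
  measurable B ->
  P (s1 @^-1` A `&` s2 @^-1` B) = (P A * P B)%E.

(* The list [js] encodes the event that [co j.1 x] belongs to [j.2] for all [j] in [js]. *)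
Definition independent_copies (co : nat -> Om -> Om) : Prop := forall (js : seq (nat * set Om)) l
  (G : set Om),
  (forall j, j \in map fst js -> j != l) -> (forall j, List.In j js -> measurable j.2) ->
    measurable G ->
  measurable [set x | forall j, List.In j js -> j.2 (co j.1 x)] /\
  P ([set x | forall j, List.In j js -> j.2 (co j.1 x)] `&` co l @^-1` G) =
  (P [set x | forall j, List.In j js -> j.2 (co j.1 x)] * P G)%E.

Definition prob_vec (p : nat -> R) := (forall n, 0 <= p n) /\ (\sum_(0 <= n <oo) (p n)%:E = 1)%E.

Definition samples (sm : (nat -> R) -> Om -> nat) : Prop :=
  forall p n, prob_vec p -> P [set x | sm p x = n] = (p n)%:E.

(** A coupling designed for two given laws achieves half of this sum; the factor 2 is conceded
    because a single map [sm] has to serve all laws at once. *)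
Definition couples (sm : (nat -> R) -> Om -> nat) : Prop := forall p q, prob_vec p -> prob_vec q ->
  measurable [set x | sm p x <> sm q x] /\
  (P [set x | sm p x <> sm q x] <= \sum_(0 <= n <oo) `|p n - q n|%:E)%E.

End random_input.

(** * Two independent uniform variables from one *)

Section push.
Context d d' (T1 : measurableType d) (T2 : measurableType d') (R : realType).
Definition push (m : {measure set T1 -> \bar R}) (f : T1 -> T2)
  (mf : measurable_fun setT f) : {measure set T2 -> \bar R} :=
  measure_function_pushforward__canonical__measure_function_Measure m mf.
Lemma pushE (m : {measure set T1 -> \bar R}) f mf A : @push m f mf A = m (f @^-1` A).
Proof. by []. Qed.
End push.

Section unit_prob.
Context (R : realType).
Local Notation Om := (measurableTypeR R).

(** The sample space is the whole line, with its mass on [[0, 1[]. The half-open interval is cut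
    exactly in two by the maps [y / 2] and [(1 + y) / 2]. *)
Definition unif01 : set Om -> \bar R := mrestr lebesgue_measure (measurable_itv `[0:R, 1[).
HB.instance Definition _ := Measure.on unif01.
Let unif01_setT : unif01 setT = 1%E.
Proof. by rewrite /unif01 /mrestr setTI lebesgue_measure_itv/= lte_fin ltr01 oppr0 adde0. Qed.
HB.instance Definition _ := Measure_isProbability.Build _ _ _ unif01 unif01_setT.

Lemma itv_coE (a b : R) : `[a, b[%classic = [set y : R | a <= y /\ y < b].
Proof. by apply/seteqP; split => y /=; rewrite in_itv/= => /andP. Qed.

Lemma itv_ocE (a b : R) : `]a, b]%classic = [set y : R | a < y /\ y <= b].
Proof. by apply/seteqP; split => y /=; rewrite in_itv/= => /andP. Qed.

Lemma itv_NycE (b : R) : `]-oo, b]%classic = [set y : R | y <= b].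
Proof. by apply/seteqP; split => y /=; rewrite in_itv/=. Qed.

(** Uniqueness of Lebesgue measure: [a] times the image of the measure under the affine map gives
    each half-open interval its length. *)
Lemma lebesgue_affine (a b : R) (A : set Om) : 0 < a -> measurable A ->
  (lebesgue_measure ((fun x => a * x + b)%R @^-1` A) = (a^-1)%:E * lebesgue_measure A)%E.
Proof.
move=> a0 mA.
have mf : measurable_fun setT (fun x : Om => (a * x + b : Om)).
  by apply: measurable_funD => //; exact: measurable_funM.
pose nu : {measure set Om -> \bar R} := mscale (NngNum (ltW a0)) (push (@lebesgue_measure R) mf).
have nuE : lebesgue_measure A = nu A.
  apply: lebesgue_measure_unique => // _ /ocitvP [->|[[x y]/= xy ->]].
    by rewrite !measure0.
  rewrite /nu /= /mscale /= pushE.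
  have -> : (fun x0 : Om => a * x0 + b) @^-1` `]x, y]%classic = `](x - b) / a, (y - b) / a]%classic.
    rewrite !itv_ocE; apply/seteqP; split => z; change (Real.sort R) in (type of z) => /=;
      rewrite ltr_pdivrMr// ler_pdivlMr// [a * z]mulrC => -[h1 h2]; split; lra.
  rewrite -[X in (_ * X)%E]/(lebesgue_measure _) !lebesgue_measure_itv/= !lte_fin xy; have ->
    : (x - b) / a < (y - b) / a by rewrite ltr_pM2r ?invr_gt0// ltrD2r.
    by rewrite -!EFinB -EFinM; congr EFin; field; rewrite gt_eqF.
  exact: mf.
rewrite nuE /nu /mscale /= /pushforward muleA -EFinM mulVf ?gt_eqF// mul1e//.
Qed.

(** Self-similarity: the first binary digit is a fair coin and, given it, the rest of the expansion
    is again uniform. *)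
Lemma unif01_dup (A : set Om) : measurable A ->
  unif01 A = ((2^-1)%:E * (unif01 [set y : Om | A (y / 2)%R] + unif01 [set y : Om | A
    ((1 + y) / 2)%R]))%E.
Proof.
move=> mA; rewrite /unif01 /mrestr.
pose A0 := A `&` `[0, 2^-1[%classic; pose A1 := A `&` `[2^-1, 1[%classic.
have mA0 : measurable A0 by exact: measurableI.
have mA1 : measurable A1 by exact: measurableI.
have mul2 y : (2^-1 * y = y / 2 :> R)%R by rewrite mulrC.
have -> : [set y : Om | A (y / 2)%R] `&` `[0, 1[%classic = (fun x => 2^-1 * x + 0) @^-1` A0.
  rewrite /A0 !itv_coE.
  apply/seteqP; split => y; change (Real.sort R) in (type of y) => /=; rewrite addr0 mul2 =>
    -[hA [h1 h2]]; do 2 split => //; lra.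
have mul2' y : (2^-1 * y + 2^-1 = (1 + y) / 2 :> R)%R by lra.
have -> : [set y : Om | A ((1 + y) / 2)%R] `&` `[0, 1[%classic = (fun x => 2^-1 * x + 2^-1)
  @^-1` A1.
  rewrite /A1 !itv_coE.
  apply/seteqP; split => y; change (Real.sort R) in (type of y) => /=; rewrite mul2' =>
    -[hA [h1 h2]]; do 2 split => //; lra.
have i2 : 0 < 2^-1 :> R by rewrite invr_gt0.
rewrite !lebesgue_affine// invrK -ge0_muleDr// muleA -EFinM mulVf// mul1e.
rewrite -measureU//; last first.
  rewrite /A0 /A1 !itv_coE; apply/seteqP; split => // y [[_ [_ h]] [_ [h' _]]].
  by move: h; rewrite ltNge h'.
congr lebesgue_measure; rewrite -setIUr; congr setI; rewrite !itv_coE.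
apply/seteqP; split => y; change (Real.sort R) in (type of y) => /=; last first.
  by move=> [|] [h1 h2]; split; lra.
by case: (ltP y 2^-1) => h [h1 h2]; [left|right]; split; lra.
Qed.

(* Base-2 digits are dealt alternately to the two coordinates. *)
Definition digit (x : Om) : R := if x < 2^-1 then 0 else 1.
Definition tail (x : Om) : Om := 2 * x - digit x.
Fixpoint split_approx n (x : Om) : Om * Om :=
  if n is n'.+1 then
    let y := split_approx n' (tail (tail x)) in
    ((digit x + y.1) / 2, (digit (tail x) + y.2) / 2)
  else (0, 0).

Lemma measurable_digit : measurable_fun setT digit.
Proof.
apply: measurable_fun_ifT => //; exact: measurable_fun_ltr.
Qed.

Lemma measurable_tail : measurable_fun setT tail.
Proof.
apply: measurable_funB; last exact: measurable_digit.
exact: measurable_funM.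
Qed.

Lemma measurable_split_approx n :
  measurable_fun setT (fun x => (split_approx n x).1) /\
  measurable_fun setT (fun x => (split_approx n x).2).
Proof.
elim: n => [|n [IH1 IH2]]; first by split; exact: measurable_cst.
have mtt : measurable_fun setT (tail \o tail).
  by apply: measurableT_comp; exact: measurable_tail.
split => /=; apply: measurable_funM => //; apply: measurable_funD.
- exact: measurable_digit.
- by move: (measurableT_comp IH1 mtt).
- by move: (measurableT_comp measurable_digit measurable_tail).
- by move: (measurableT_comp IH2 mtt).
Qed.

Lemma digit_lo (y : R) : 0 <= y < 1 -> digit (y / 2) = 0 /\ tail (y / 2) = y.
Proof.
move=> /andP[y0 y1]; rewrite /tail /digit ltr_pdivrMr// mulVf// y1; split => //; lra.
Qed.

Lemma digit_hi (y : R) : 0 <= y < 1 -> digit ((1 + y) / 2) = 1 /\ tail ((1 + y) / 2) = y.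
Proof.
move=> /andP[y0 y1]; rewrite /tail /digit ltr_pdivrMr// mulVf//.
have -> : (1 + y < 1) = false by apply/negbTE; rewrite -leNgt; lra.
split => //; lra.
Qed.

(** Distribution function of a uniform number truncated to [n] binary digits. The two arguments
    correspond to a leading digit 0 or 1. *)
Fixpoint cdf_approx n (a : R) : R :=
  if n is n'.+1 then (cdf_approx n' (2 * a) + cdf_approx n' (2 * a - 1)) / 2
  else (0 <= a)%R%:R.

Lemma unif01_eq (A B : set Om) : (forall y : R, 0 <= y < 1 -> A y <-> B y) -> unif01 A = unif01 B.
Proof.
move=> h; rewrite /unif01 /mrestr; congr lebesgue_measure.
apply/seteqP; split => y [Ay yi]; split => //; move: (yi); rewrite /= in_itv/= => /h yy.
  by apply yy.
by apply yy.
Qed.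

(** One level of [split_approx] consumes two digits, one for each coordinate, hence two uses of
    [unif01_dup] per induction step. *)
Lemma unif01_split_approx n a b :
  unif01 [set x | (split_approx n x).1 <= a /\ (split_approx n x).2 <= b] =
  (cdf_approx n a * cdf_approx n b)%:E.
Proof.
have mS k c e : measurable [set x : Om | (split_approx k x).1 <= c /\ (split_approx k x).2 <= e].
  have [m1 m2] := measurable_split_approx k.
  have -> : [set x : Om | (split_approx k x).1 <= c /\ (split_approx k x).2 <= e] =
     (fun x => (split_approx k x).1) @^-1` `]-oo, c] `&` (fun x => (split_approx k x).2) @^-1`
       `]-oo, e].
    by rewrite !itv_NycE.
  apply: measurableI; rewrite -[X in measurable X]setTI.
    exact: m1.
  exact: m2.
elim: n a b => [|n IH] a b /=.
  case: (leP 0 a) => ha; case: (leP 0 b) => hb; rewrite ?(mul1r,mul0r,mulr0)/=.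
  - rewrite (_ : [set _ | _] = setT) ?probability_setT//; exact/seteqP.
  - by rewrite (_ : [set _ | _] = set0) ?measure0//; apply/seteqP; split => // x [].
  - by rewrite (_ : [set _ | _] = set0) ?measure0//; apply/seteqP; split => // x [].
  - by rewrite (_ : [set _ | _] = set0) ?measure0//; apply/seteqP; split => // x [].
rewrite unif01_dup; last exact: (mS n.+1 a b).
(* The event when the first digit is known to be [j] and the second is still to be read. *)
pose E j c e := [set x : Om | (j + (split_approx n (tail x)).1) / 2 <= c /\
  (digit x + (split_approx n (tail x)).2) / 2 <= e] : set Om.
have mE j c e : measurable (E j c e).
  have [m1 m2] := measurable_split_approx n.
  have -> : E j c e =
     (fun x => (j + (split_approx n (tail x)).1) / 2 : Om) @^-1` `]-oo, c] `&` (fun x =>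
       (digit x + (split_approx n (tail x)).2) / 2 : Om) @^-1` `]-oo, e].
    by rewrite !itv_NycE.
  apply: measurableI; rewrite -[X in measurable X]setTI.
    have : measurable_fun setT (fun x => (j + (split_approx n (tail x)).1) / 2 : Om).
      apply: measurable_funM => //; apply: measurable_funD => //.
      by move: (measurableT_comp m1 measurable_tail).
    by apply.
  have : measurable_fun setT (fun x => (digit x + (split_approx n (tail x)).2) / 2 : Om).
    apply: measurable_funM => //; apply: measurable_funD => //; first exact: measurable_digit.
    by move: (measurableT_comp m2 measurable_tail).
  by apply.
rewrite (@unif01_eq _ (E 0 a b)); last first.
  by move=> y /digit_lo[d t] /=; rewrite d t.
rewrite (@unif01_eq [set y : Om | _ ] (E 1 a b)); last first.
  by move=> y /digit_hi[d t] /=; rewrite d t.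
have EE j : unif01 (E j a b) = ((cdf_approx n (2 * a - j) * ((cdf_approx n (2 * b) + cdf_approx n
  (2 * b - 1)) / 2))%R)%:E.
  rewrite unif01_dup//.
  rewrite (@unif01_eq _ [set x | (split_approx n x).1 <= 2 * a - j /\ (split_approx n x).2 <= 2 *
    b]); last first.
    move=> y /digit_lo[d t]; rewrite /E /= d t !ler_pdivrMr// add0r.
    split => -[h1 h2]; split; lra.
  rewrite (@unif01_eq [set y : Om | E _ _ _ _] [set x | (split_approx n x).1 <= 2 * a - j /\
    (split_approx n x).2 <= 2 * b - 1]); last first.
    move=> y /digit_hi[d t]; rewrite /E /= d t !ler_pdivrMr//.
    split => -[h1 h2]; split; lra.
  by rewrite !IH -EFinD -EFinM; congr EFin; field.
by rewrite !EE -EFinD -EFinM subr0; congr EFin; field.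
Qed.


(** The distribution function of [unif01], which also serves as a uniform variable with values in
    [[0, 1]] everywhere on the line. *)
Definition clamp01 (a : R) : R := Num.max 0 (Num.min a 1).

Lemma cdf_approx_lt0 n a : a < 0 -> cdf_approx n a = 0.
Proof.
elim: n a => [|n IH] a a0 /=; first by rewrite leNgt a0.
by rewrite !IH ?addr0 ?mul0r//; lra.
Qed.

Lemma cdf_approx_ge1 n a : 1 <= a -> cdf_approx n a = 1.
Proof.
elim: n a => [|n IH] a a0 /=; first by rewrite (le_trans _ a0).
by rewrite !IH; lra.
Qed.

(** For [a] in [[0, 1[], one of [2 * a] and [2 * a - 1] lies outside [[0, 1[], where the
    approximation is exact; the error is therefore halved at each digit. *)
Lemma cdf_approx_err n a : `|cdf_approx n a - clamp01 a| <= 2^-1 ^+ n.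
Proof.
have c0 b : b < 0 -> clamp01 b = 0.
  by move=> b0; rewrite /clamp01 min_l ?max_l//; lra.
have c1 b : 1 <= b -> clamp01 b = 1.
  by move=> b0; rewrite /clamp01 min_r ?max_r//; lra.
have ci b : 0 <= b < 1 -> clamp01 b = b.
  by move=> /andP[b0 b1]; rewrite /clamp01 min_l ?max_r//; lra.
elim: n a => [|n IH] a /=.
  rewrite expr0; case: (ltP a 0) => a0; first by rewrite c0//= subrr normr0.
  by case: (ltP a 1) => a1; [rewrite ci ?a0// |rewrite c1//]; rewrite /= ler_norml; lra.
case: (ltP a 0) => a0.
  by rewrite c0// !cdf_approx_lt0 ?addr0 ?mul0r ?subrr ?normr0 ?exprn_ge0//; lra.
case: (leP 1 a) => a1.
  rewrite c1// !cdf_approx_ge1; try lra.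
  have -> : (1 + 1) / 2 - 1 = 0 :> R by lra.
  by rewrite normr0 exprn_ge0.
rewrite ci ?a0// exprS.
case: (ltP a 2^-1) => ah.
  have := IH (2 * a); rewrite (@cdf_approx_lt0 _ (2 * a - 1)); last lra.
  rewrite ci; last lra.
  by rewrite !ler_norml; lra.
have := IH (2 * a - 1); rewrite (@cdf_approx_ge1 _ (2 * a)); last lra.
rewrite ci; last lra.
by rewrite !ler_norml; lra.
Qed.

Lemma cvg_cdf_approx a : cdf_approx n a @[n --> \oo] --> clamp01 a.
Proof.
apply/cvgrPdist_le => e e0.
have /cvgrPdist_le/(_ _ e0) : (2^-1 ^+ n : R) @[n --> \oo] --> 0.
  by apply: cvg_expr; rewrite ger0_norm ?invr_ge0// invf_lt1// ltr1n.
apply: filterS => n; rewrite sub0r normrN ger0_norm ?exprn_ge0// => h.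
by rewrite distrC (le_trans (cdf_approx_err n a)).
Qed.

Lemma unif01_cdf a : unif01 `]-oo, a] = (clamp01 a)%:E.
Proof.
rewrite /clamp01; case: (ltP a 0) => a0.
  rewrite (min_l (ltW (lt_trans a0 ltr01))) max_l ?(ltW a0)//.
  rewrite /unif01 /mrestr (_ : _ `&` _ = set0) ?measure0//.
  rewrite itv_NycE itv_coE; apply/seteqP; split => // y [/= ya [y0 _]].
  by move: (le_lt_trans (le_trans y0 ya) a0); rewrite ltxx.
case: (ltP a 1) => a1.
  rewrite max_r//.
  rewrite /unif01 /mrestr (_ : _ `&` _ = `[0, a]%classic).
    by rewrite lebesgue_measure_itv/= lte_fin; case: ltP => h; rewrite ?oppr0 ?adde0//;
      congr EFin; lra.
  rewrite itv_NycE itv_coE; apply/seteqP; split => y /=; rewrite in_itv/=.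
    by move=> [h1 [h2 h3]]; apply/andP.
  by move=> /andP[h1 h2]; split => //; split => //; rewrite (le_lt_trans h2).
rewrite max_r//.
rewrite /unif01 /mrestr (_ : _ `&` _ = `[0, 1[%classic).
  by rewrite lebesgue_measure_itv/= lte_fin ltr01 oppr0 adde0.
rewrite itv_NycE itv_coE; apply/seteqP; split => y /=; first by case.
move=> [h1 h2]; split => //.
by rewrite (le_trans (ltW h2)).
Qed.

Lemma measure_eq_cdf (m1 m2 : {measure set Om -> \bar R}) : (m1 setT < +oo)%E ->
  m1 setT = m2 setT -> (forall a, m1 `]-oo, a]%classic = m2 `]-oo, a]%classic) ->
  forall A, measurable A -> m1 A = m2 A.
Proof.
move=> fin1 mT mc A mA.
have le1 (B : set Om) : measurable B -> (m1 B < +oo)%E.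
  by move=> mB; apply: le_lt_trans fin1; apply: le_measure; rewrite ?inE.
have le2 (B : set Om) : measurable B -> (m2 B < +oo)%E.
  by move=> mB; rewrite mT in fin1; apply: le_lt_trans fin1; apply: le_measure; rewrite ?inE.
apply: (@measure_unique _ R Om (@RGenOInfty.G R) (fun n => `](- n%:R), +oo[%classic) _ _ _ _ m1
  m2) => //.
- exact: RGenOInfty.measurableE.
- move=> _ _ [x ->] [y ->]; exists (Num.max x y).
  by apply/seteqP; split => z /=; rewrite !in_itv/= !andbT gt_max => /andP.
- by move=> n; exists (- n%:R).
- apply/seteqP; split => // x _; exists (Num.truncn `|x|).+1 => //=; rewrite in_itv/= andbT.
  by rewrite ltrNl (le_lt_trans _ (truncnS_gt _))// -normrN ler_norm.
- move=> _ [x ->].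
  have E (m : {measure set Om -> \bar R}) : (m setT < +oo)%E -> m `]x,
    +oo[%classic = (m setT - m `]-oo, x]%classic)%E.
    move=> mf; rewrite -setCitvl -setTD measureD ?setTI//.
  by rewrite !E// -?mT// mT mc.
- move=> k; exact: le1.
Qed.

Lemma split_approx_nd n x :
  (split_approx n x).1 <= (split_approx n.+1 x).1 /\ (split_approx n x).2 <=
    (split_approx n.+1 x).2.
Proof.
have d0 y : 0 <= digit y by rewrite /digit; case: ifP.
elim: n x => [|n IH] x.
  by split => /=; rewrite mulr_ge0 ?addr_ge0//.
have [h1 h2] := IH (tail (tail x)).
have S k : split_approx k.+1 x = ((digit x + (split_approx k (tail (tail x))).1) / 2,
   (digit (tail x) + (split_approx k (tail (tail x))).2) / 2) by [].
by rewrite (S n) (S n.+1); split; rewrite ler_pM2r// lerD2l.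
Qed.

Lemma split_approx_bnd n x :
  (0 <= (split_approx n x).1 <= 1) /\ (0 <= (split_approx n x).2 <= 1).
Proof.
have d0 y : 0 <= digit y <= 1 by rewrite /digit; case: ifP; lra.
elim: n x => [|n IH] x /=; first by rewrite lexx ler01.
have [h1 h2] := IH (tail (tail x)).
by have := d0 x; have := d0 (tail x); lra.
Qed.

Definition split1 (x : Om) : Om := limn (fun n => (split_approx n x).1 : R).
Definition split2 (x : Om) : Om := limn (fun n => (split_approx n x).2 : R).

Lemma cvg_split x :
  ((split_approx n x).1 : R) @[n --> \oo] --> (split1 x : R) /\
  ((split_approx n x).2 : R) @[n --> \oo] --> (split2 x : R).
Proof.
split; apply: nondecreasing_is_cvgn.
- by apply/nondecreasing_seqP => n; have [] := split_approx_nd n x.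
- by exists 1 => _ [n _ <-]; have [/andP[]] := split_approx_bnd n x.
- by apply/nondecreasing_seqP => n; have [] := split_approx_nd n x.
- by exists 1 => _ [n _ <-]; have [_ /andP[]] := split_approx_bnd n x.
Qed.

Lemma measurable_split1 : measurable_fun setT split1.
Proof.
apply: (@measurable_fun_cvg _ Om R setT (fun n x => (split_approx n x).1)).
  by move=> n; have [] := measurable_split_approx n.
by move=> x _; have [] := cvg_split x.
Qed.

Lemma measurable_split2 : measurable_fun setT split2.
Proof.
apply: (@measurable_fun_cvg _ Om R setT (fun n x => (split_approx n x).2)).
  by move=> n; have [] := measurable_split_approx n.
by move=> x _; have [] := cvg_split x.
Qed.

(** The approximations increase with [n], so the event is the decreasing intersection of the events
    of [unif01_split_approx], and continuity from above applies. *)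
Lemma split_cdf a b : unif01 (split1 @^-1` `]-oo, a] `&` split2 @^-1` `]-oo, b]) =
  (clamp01 a * clamp01 b)%:E.
Proof.
pose F n := [set x : Om | (split_approx n x).1 <= a /\ (split_approx n x).2 <= b].
have mF k : measurable (F k : set Om).
  have [m1 m2] := measurable_split_approx k.
  have -> : (F k : set Om) =
     (fun x => (split_approx k x).1) @^-1` `]-oo, a] `&` (fun x => (split_approx k x).2) @^-1`
       `]-oo, b].
    by rewrite !itv_NycE.
  apply: measurableI; rewrite -[X in measurable X]setTI.
    exact: m1.
  exact: m2.
have -> : split1 @^-1` `]-oo, a] `&` split2 @^-1` `]-oo, b] = \bigcap_n F n.
  rewrite !itv_NycE; apply/seteqP; split => x /=; have [c1 c2] := cvg_split x.
    move=> [h1 h2] n _; split.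
      apply: le_trans h1; apply: nondecreasing_cvgn_le c1 n.
      by apply/nondecreasing_seqP => m; have [] := split_approx_nd m x.
    apply: le_trans h2; apply: nondecreasing_cvgn_le c2 n.
    by apply/nondecreasing_seqP => m; have [] := split_approx_nd m x.
  move=> h; split.
    have -> : split1 x = limn (fun n => (split_approx n x).1 : R) by [].
    by apply: limr_le; [exact: cvgP c1|apply: nearW => n; have [] := h n I].
  have -> : split2 x = limn (fun n => (split_approx n x).2 : R) by [].
  by apply: limr_le; [exact: cvgP c2|apply: nearW => n; have [] := h n I].
have c1 : unif01 (F n) @[n --> \oo] --> unif01 (\bigcap_n F n).
  apply: nonincreasing_cvg_mu => //.
  - by rewrite (le_lt_trans (probability_le1 _ _)) ?ltry.
  - exact: bigcapT_measurable.
  - apply/nonincreasing_seqP => n; apply/subsetPset => x [].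
    have [d1 d2] := split_approx_nd n x => h1 h2; split.
      exact: le_trans h1.
    exact: le_trans h2.
have c2 : unif01 (F n) @[n --> \oo] --> (clamp01 a * clamp01 b)%:E.
  rewrite (_ : (fun n => unif01 (F n)) = (fun n => (cdf_approx n a * cdf_approx n b)%:E)).
    by apply: cvg_EFin; [apply: nearW|apply: cvgM; exact: cvg_cdf_approx].
  by apply/funext => n; exact: unif01_split_approx.
by apply: cvg_unique c1 c2.
Qed.

(** The product formula for half-lines is extended one coordinate at a time: with a half-line fixed
    for the second variable the first set becomes arbitrary, then with that set fixed the second one
    does. *)
Lemma split_law : independent_halves unif01 split1 split2.
Proof.
move=> A B mA mB.
have pre (f : Om -> Om) C : measurable_fun setT f -> measurable C -> measurable (f @^-1` C).
  by move=> mf mC; rewrite -[X in measurable X]setTI; exact: mf.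
have p1 C mC := pre _ C measurable_split1 mC.
have p2 C mC := pre _ C measurable_split2 mC.
have cl1 : clamp01 1 = 1 by rewrite /clamp01 min_l// max_r.
have c0 b : 0 <= clamp01 b by rewrite /clamp01 le_max lexx.
have mrT b : unif01 (split2 @^-1` `]-oo, b]) = (clamp01 b)%:E.
  rewrite -(mul1r (clamp01 b)) -{1}cl1 -split_cdf; congr unif01.
  apply/seteqP; split => x /=; last by case.
  move=> h; split => //; rewrite in_itv/=.
  have [c _] := cvg_split x.
  have -> : split1 x = limn (fun n => (split_approx n x).1 : R) by [].
  by apply: limr_le; [exact: cvgP c|apply: nearW => n; have [/andP[]] := split_approx_bnd n x].
have step1 b C : measurable C ->
    unif01 (split1 @^-1` C `&` split2 @^-1` `]-oo, b]) = (unif01 C * (clamp01 b)%:E)%E.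
  move=> mC.
  have mb : measurable (split2 @^-1` `]-oo, b]) by exact: p2.
  pose m1 := push (mrestr unif01 mb) measurable_split1.
  pose m2 : {measure set Om -> \bar R} := mscale (NngNum (c0 b)) unif01.
  have m1T : m1 setT = (clamp01 b)%:E.
    by rewrite -[LHS]/(unif01 (setT `&` _)) setTI mrT.
  have E : m1 C = m2 C.
    apply: measure_eq_cdf => //.
    - by rewrite m1T ltry.
    - by rewrite m1T /m2 /= /mscale/= probability_setT mule1.
    - move=> a; rewrite /m2 /= /mscale /= unif01_cdf -EFinM mulrC -split_cdf.
      by rewrite -[LHS]/(unif01 (_ `&` _)).
  by transitivity (m1 C) => //; rewrite E [RHS]muleC.
have mA1 : measurable (split1 @^-1` A) by exact: p1.
pose m1 := push (mrestr unif01 mA1) measurable_split2.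
have fA : unif01 A \is a fin_num by exact: fin_num_measure.
have A0 : 0 <= fine (unif01 A) by apply: fine_ge0.
pose m2 : {measure set Om -> \bar R} := mscale (NngNum A0) unif01.
have m1T : m1 setT = unif01 A.
  rewrite -[LHS]/(unif01 (setT `&` _)) setTI.
  have := step1 1 A mA; rewrite cl1 mule1 => <-; congr unif01.
  apply/seteqP; split => x /=; last by case.
  move=> h; split => //; rewrite in_itv/=.
  have [_ c] := cvg_split x.
  have -> : split2 x = limn (fun n => (split_approx n x).2 : R) by [].
  by apply: limr_le; [exact: cvgP c|apply: nearW => n; have [_ /andP[]] := split_approx_bnd n x].
have E : m1 B = m2 B.
  apply: measure_eq_cdf => //.
  - by rewrite m1T -ge0_fin_numE.
  - by rewrite m1T /m2 /= /mscale/= fineK// probability_setT mule1.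
  - move=> b; rewrite /m2 /= /mscale /= fineK// unif01_cdf -step1//.
    by rewrite -[LHS]/(unif01 (_ `&` _)) setIC.
transitivity (m1 B); first by rewrite -[RHS]/(unif01 (_ `&` _)) setIC.
by rewrite E /m2 /= /mscale/= fineK.
Qed.

End unit_prob.

(** * Distribution function and moments of the uniform variable *)

Section unif.
Context (R : realType).
Local Notation Om := (measurableTypeR R).
Local Notation P := (@unif01 R).
Lemma measurable_clamp01 : measurable_fun setT (@clamp01 R : Om -> R).
Proof.
by apply: measurable_maxr => //; apply: measurable_minr.
Qed.

Lemma clamp01_bnd (x : R) : 0 <= clamp01 x <= 1.
Proof. by rewrite /clamp01 le_max lexx /= ge_max ler01 ge_min lexx orbT. Qed.

Lemma clamp01_id (x : R) : 0 <= x < 1 -> clamp01 x = x.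
Proof. by move=> /andP[x0 x1]; rewrite /clamp01 (min_l (ltW x1)) max_r. Qed.

Lemma unif01_clamp_cdf (t : R) : 0 <= t <= 1 -> P [set x : Om | clamp01 x < t] = t%:E.
Proof.
move=> /andP[t0 t1]; rewrite /unif01 /mrestr (_ : _ `&` _ = `[0, t[%classic).
  by rewrite lebesgue_measure_itv/= lte_fin; case: ltP => h; rewrite ?oppr0 ?adde0//;
    congr EFin; lra.
rewrite !itv_coE; apply/seteqP; split => y /=.
  by move=> [h [y0 y1]]; rewrite clamp01_id ?y0// in h.
move=> [y0 yt]; have y1 := lt_le_trans yt t1; split => //.
by rewrite clamp01_id ?y0.
Qed.

Lemma derivable_powR_itv (b : R) : 0 < b -> derivable_oo_LRcontinuous (fun x : R => x `^ b) 0 1.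
Proof.
move=> b0; split.
- move=> x; rewrite in_itv/= => /andP[x0 _]; apply: derivable_powR.
  by rewrite in_itv/= x0.
- by rewrite powR0 ?gt_eqF//; exact: powR_cvg0.
- apply: cvg_at_left_filter.
  have h : derivable (fun x : R => x `^ b) 1 1 by apply: derivable_powR; rewrite in_itv/= ltr01.
  exact: (differentiable_continuous (iffLR (derivable1_diffP _ _) h)).
Qed.

Lemma ge0_integral_mrestr d (T : measurableType d) (m : {measure set T -> \bar R}) (D : set T)
  (mD : measurable D)
  (f : T -> \bar R) : measurable_fun setT f -> (forall x, 0 <= f x)%E ->
  (\int[mrestr m mD]_x f x = \int[m]_(x in D) f x)%E.
Proof.
move=> mf f0; rewrite -(setUv D) ge0_integral_setU//; last 3 first.
- exact: measurableC.
- by rewrite setUv.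
- by apply/disj_setPS => x [].
rewrite [X in (_ + X)%E](_ : _ = 0%E) ?adde0.
  apply: eq_measure_integral => A mA AD.
  by rewrite /= /mrestr setIidl.
rewrite -(integral_measure_zero (~` D) f); apply: eq_measure_integral => A mA AD.
by rewrite /= /mrestr /mzero (_ : A `&` D = set0) ?measure0//; apply/seteqP; split => // x [/AD].
Qed.

(** The moment that remains at the end of [race_int], by the fundamental theorem of calculus. *)
Lemma unif01_clamp_int (b : R) : 0 <= b -> (\int[P]_x (clamp01 x `^ b)%:E = ((1 + b)^-1)%:E)%E.
Proof.
move=> b0; have b1 : 0 < 1 + b by lra.
transitivity (\int[lebesgue_measure]_(x in `[0%R, 1%R]) (x `^ b)%:E)%E.
  rewrite ge0_integral_mrestr//.
    rewrite -(integral_itv_bndo_bndc (a := BLeft 0%R)).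
      by apply: eq_integral => x; rewrite inE/= in_itv/= => hx; rewrite clamp01_id.
    by apply/measurable_EFinP; apply: measurable_funTS; exact: measurable_powR.
  - apply/measurable_EFinP.
    by move: (measurableT_comp (measurable_powR b) measurable_clamp01).
  - by move=> x; rewrite lee_fin powR_ge0.
rewrite (@continuous_FTC2 _ _ (fun x => (1 + b)^-1 * x `^ (1 + b)))//.
- by rewrite powR1 powR0 ?gt_eqF// mulr0 mulr1 sube0.
- have [->|bn0] := eqVneq b 0.
    apply: continuous_subspaceT => x; under eq_fun do rewrite powRr0; exact: cvg_cst.
  by apply/derivable_oo_LRcontinuous_within/derivable_powR_itv; rewrite lt_neqAle eq_sym bn0.
- have [h1 h2 h3] := derivable_powR_itv b1; split.
  + by move=> x hx; apply: derivableM => //; exact: h1.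
  + by apply: cvgM => //; exact: cvg_cst.
  + by apply: cvgM => //; exact: cvg_cst.
- move=> x; rewrite in_itv/= => /andP[x0 _].
  have dx : derivable (fun x : R => x `^ (1 + b)) x 1 by apply: derivable_powR; rewrite in_itv/= x0.
  rewrite derive1E deriveZ//= -derive1E powR_derive1 ?in_itv/= ?x0//.
  rewrite /GRing.scale/= mulrA mulVf ?gt_eqF// mul1r; congr (_ `^ _); ring.
Qed.
End unif.

(** * Coupled chains of symbols *)

Section tsum.
Context (R : realType).
Local Open Scope ereal_scope.

(** Sum over the words of length [t], as nested series with the last symbol innermost, since words
    grow on the right. *)
Fixpoint tsum (t : nat) (F : seq nat -> \bar R) : \bar R :=
  if t is t'.+1 then tsum t' (fun s => \sum_(0 <= n <oo) F (rcons s n)) else F [::].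

Lemma tsum_ge0 t F : (forall s, size s = t -> 0 <= F s) -> 0 <= tsum t F.
Proof.
elim: t F => [|t IH] F F0 /=; first exact: F0.
apply: IH => s st; apply: nneseries_ge0 => n _ _; apply: F0.
by rewrite size_rcons st.
Qed.

Lemma le_tsum t F G : (forall s, size s = t -> 0 <= F s) -> (forall s, size s = t -> F s <= G s) ->
  tsum t F <= tsum t G.
Proof.
elim: t F G => [|t IH] F G F0 FG /=; first exact: FG.
apply: IH => s st.
  by apply: nneseries_ge0 => n _ _; apply: F0; rewrite size_rcons st.
apply: lee_nneseries => n *; [apply: F0|apply: FG]; by rewrite size_rcons st.
Qed.

Lemma eq_tsum t F G : (forall s, size s = t -> F s = G s) -> tsum t F = tsum t G.
Proof.
elim: t F G => [|t IH] F G FG /=; first exact: FG.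
by apply: IH => s st; apply: eq_eseriesr => n _; apply: FG; rewrite size_rcons st.
Qed.

Lemma tsumD t F G : (forall s, 0 <= F s) -> (forall s, 0 <= G s) -> tsum t (fun s => F s + G s) =
  tsum t F + tsum t G.
Proof.
elim: t F G => [|t IH] F G F0 G0 //=.
rewrite -IH; [|by move=> s; apply: nneseries_ge0..].
by apply: eq_tsum => s _; rewrite nneseriesD.
Qed.

Lemma tsumZl t F (c : R) : (0 <= c)%R -> (forall s, 0 <= F s) -> tsum t (fun s => c%:E * F s) =
  c%:E * tsum t F.
Proof.
move=> c0; elim: t F => [|t IH] F F0 //=.
rewrite -IH; last by move=> s; apply: nneseries_ge0.
by apply: eq_tsum => s _; rewrite nneseriesZl.
Qed.

Lemma measurable_tsum d (T : measurableType d) t (F : seq nat -> T -> \bar R) :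
  (forall s, measurable_fun setT (F s)) -> (forall s x, 0 <= F s x) ->
  measurable_fun setT (fun x => tsum t (F^~ x)).
Proof.
elim: t F => [|t IH] F mF F0 /=; first exact: mF.
apply: (IH (fun s x => \sum_(0 <= n <oo) F (rcons s n) x)).
  by move=> s; apply: ge0_emeasurable_sum => // n x _ _; exact: F0.
by move=> s x; apply: nneseries_ge0.
Qed.

Lemma integral_tsum d (T : measurableType d) (m : {measure set T -> \bar R}) t (F : seq nat -> T ->
  \bar R) :
  (forall s, measurable_fun setT (F s)) -> (forall s x, 0 <= F s x) ->
  \int[m]_x tsum t (F^~ x) = tsum t (fun s => \int[m]_x F s x).
Proof.
elim: t F => [|t IH] F mF F0 //=.
rewrite (IH (fun s x => \sum_(0 <= n <oo) F (rcons s n) x)).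
- by apply: eq_tsum => s _; rewrite integral_nneseries.
- by move=> s; apply: ge0_emeasurable_sum => // n x _ _; exact: F0.
- by move=> s x; apply: nneseries_ge0.
Qed.

(** Law of total probability over the words that a growing chain can have formed by time [t]. *)
Lemma tsum_measure d (T : measurableType d) (m : {measure set T -> \bar R}) t (Z : nat ->
  T -> seq nat)
    (a : nat -> T -> nat) (A : set T) :
  (forall x, Z 0%N x = [::]) -> (forall t x, Z t.+1 x = rcons (Z t x) (a t x)) ->
  (forall t s, measurable [set x | Z t x = s]) -> measurable A ->
  m A = tsum t (fun s => m (A `&` [set x | Z t x = s])).
Proof.
move=> Z0 ZS mZ mA; elim: t => [|t IH] /=.
  by rewrite (_ : _ `&` _ = A)//; apply/seteqP; split => x //= [].
rewrite IH; apply: eq_tsum => s st.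
rewrite (_ : A `&` _ = \bigcup_n (A `&` [set x | Z t.+1 x = rcons s n])).
  rewrite measure_semi_bigcup//.
  - by move=> n; exact: measurableI.
  - by move=> i j _ _ [x [[_ /= ->] [_ /= /rcons_inj[]]]].
  - by apply: bigcupT_measurable => n; exact: measurableI.
apply/seteqP; split => x /=.
  by move=> [Ax zs]; exists (a t x) => //; split => //=; rewrite ZS zs.
by move=> [n _ [Ax /=]]; rewrite ZS => /rcons_inj[-> _].
Qed.

End tsum.

Section countable_meas.
Context d (T : measurableType d) (I : countType) (Z : T -> I) (mZ : forall s,
  measurable [set x | Z x = s]).

(** Words form a countable type, so any event about chains is measurable once each single word gives
    a measurable event. *)
Lemma measurable_countable_pred (B : set I) : measurable [set x | B (Z x)].
Proof.
rewrite (_ : [set x | _] = \bigcup_n [set x | exists s, pickle s = n /\ B s /\ Z x = s]);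
  last first.
  apply/seteqP; split => x /=; first by move=> h; exists (pickle (Z x)) => //; exists (Z x).
  by move=> [n _ [s [_ [Bs ->]]]].
apply: bigcupT_measurable => n; case E : (unpickle n : option I) => [s|]; last first.
  rewrite (_ : [set x | _] = set0)//; apply/seteqP; split => // x [s [sn _]].
  by move: E; rewrite -sn pickleK.
have [Bs|Bs] := pselect (B s).
  rewrite (_ : [set x | _] = [set x | pickle s = n /\ Z x = s]).
    have [sn|sn] := pselect (pickle s = n).
      by rewrite (_ : [set x | _] = [set x | Z x = s])//; apply/seteqP; split => x //= [].
    by rewrite (_ : [set x | _] = set0)//; apply/seteqP; split => // x [].
  apply/seteqP; split => x /=.
    by move=> [s' [sn [_ Zs]]]; move: E; rewrite -sn pickleK => -[ss]; rewrite -ss.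
  by move=> [sn Zs]; exists s.
rewrite (_ : [set x | _] = set0)//; apply/seteqP; split => // x [s' [sn [Bs' _]]].
by move: E; rewrite -sn pickleK => -[ss]; rewrite ss in Bs'.
Qed.
End countable_meas.

Section chain.
Context (R : realType) dO (Om : measurableType dO) (P : probability Om R).
Context (co : nat -> Om -> Om).
Context (co_indep : independent_copies P co).
Context (mco : forall l, measurable_fun setT (co l)).

Context (sm : (nat -> R) -> Om -> nat).
Context (msm : forall p n, measurable [set x | sm p x = n]).
Context (sm_law : samples P sm) (sm_dist : couples P sm).

(** For [W s = 0] this is the zero vector and not a probability vector; a chain of law [W] meets
    such words with probability 0. *)
Definition cond (W : seq nat -> R) s n : R := W (rcons s n) / W s.
(* The randomness of step [t] is the copy [l t]: chains of different laws share it. *)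
Fixpoint chain (l : nat -> nat) (W : seq nat -> R) t (x : Om) : seq nat :=
  if t is t'.+1 then rcons (chain l W t' x) (sm (cond W (chain l W t' x)) (co (l t') x)) else [::].

(** Consistent masses of cylinders, that is, the law of an infinite sequence of symbols. *)
Definition tree_law (W : seq nat -> R) := [/\ forall s, 0 <= W s, W [::] = 1 &
  forall s, (\sum_(0 <= n <oo) (W (rcons s n))%:E = (W s)%:E)%E].

Lemma size_chain l W t x : size (chain l W t x) = t.
Proof. by elim: t => //= t IH; rewrite size_rcons IH. Qed.

Lemma tree_law_sub W s n : tree_law W -> W (rcons s n) <= W s.
Proof.
move=> [W0 _ WS]; rewrite -lee_fin -[in leRHS]WS.
rewrite (@nneseriesD1 _ _ n)//; last by move=> k _; rewrite lee_fin.
by rewrite leeDl// nneseries_ge0// => m _ _; rewrite lee_fin.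
Qed.

Lemma cond_prob W s : tree_law W -> 0 < W s -> prob_vec (cond W s).
Proof.
move=> [W0 _ WS] Ws; split => [n|]; first by rewrite divr_ge0.
under eq_eseriesr do rewrite /cond mulrC EFinM.
rewrite nneseriesZl; last by move=> n _; rewrite lee_fin.
by rewrite WS -EFinM mulVf ?gt_eqF.
Qed.

Lemma chain_rcons l W s n : [set x | chain l W (size s).+1 x = rcons s n] =
  [set x | chain l W (size s) x = s] `&` co (l (size s)) @^-1` [set y | sm (cond W s) y = n].
Proof.
apply/seteqP; split => x /=; first by move=> /rcons_inj[-> <-].
by move=> [-> ->].
Qed.

(** Puts the history of a chain in the form read by [independent_copies], and records that only the
    copies of the steps before [size s] occur in it. *)
Lemma chain_events l W s : exists js : seq (nat * set Om),
  [/\ forall j, List.In j js -> measurable j.2,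
      forall j, j \in map fst js -> exists2 k, (k < size s)%N & j = l k &
      [set x | chain l W (size s) x = s] = [set x | forall j, List.In j js -> j.2 (co j.1 x)]].
Proof.
elim/last_ind: s => [|s n [js [h1 h2 h3]]].
  by exists [::]; split => //; apply/seteqP; split => // x _ j [].
exists ((l (size s), [set y | sm (cond W s) y = n]) :: js); split.
- by move=> j /= [<-|]; [exact: msm|exact: h1].
- move=> j; rewrite /= in_cons size_rcons => /orP[/eqP->|/h2[k ks ->]]; first by exists (size s).
  by exists k => //; exact: ltnW.
- rewrite size_rcons chain_rcons h3; apply/seteqP; split => x /=.
    by move=> [h4 h5] j [<-//|]; exact: h4.
  by move=> h; split; [move=> j hj; apply: h; right|apply: (h _ (or_introl erefl))].
Qed.

Lemma measurable_co l G : measurable G -> measurable (co l @^-1` G).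
Proof. by move=> mG; rewrite -[X in measurable X]setTI; exact: mco. Qed.

Lemma measurable_chain l W t s : measurable [set x | chain l W t x = s].
Proof.
have [st|st] := eqVneq (size s) t; last first.
  by rewrite (_ : [set x | _] = set0)//; apply/seteqP; split => // x /= xs; move: st;
    rewrite -xs size_chain eqxx.
rewrite -st; elim/last_ind: s {t st} => [|s n IH].
  by rewrite (_ : [set x | _] = setT)//; apply/seteqP; split.
rewrite size_rcons chain_rcons; apply: measurableI => //; exact: measurable_co.
Qed.

Lemma measurable_chain2 l W t l' W' t' (B : seq nat -> seq nat -> Prop) :
  measurable [set x | B (chain l W t x) (chain l' W' t' x)].
Proof.
apply: (@measurable_countable_pred _ _ _ (fun x => (chain l W t x, chain l' W' t' x)) _ (fun p =>
  B p.1 p.2)) => -[s s'].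
rewrite (_ : [set x | _] = [set x | chain l W t x = s] `&` [set x | chain l' W' t' x = s']).
  by apply: measurableI; exact: measurable_chain.
by apply/seteqP; split => x /= [-> ->].
Qed.

(** The copy used for the next symbol is independent of the history, so the masses multiply:
    [W s * cond W s n = W (rcons s n)]. When [W s = 0] both sides vanish. *)
Lemma chain_law l W s : injective l -> tree_law W ->
  P [set x | chain l W (size s) x = s] = (W s)%:E.
Proof.
move=> lI tW; have [W0 W1 WS] := tW.
elim/last_ind: s => [|s n IH].
  by rewrite W1 (_ : [set x | _] = setT) ?probability_setT//; apply/seteqP; split.
rewrite size_rcons chain_rcons.
have [js [h1 h2 h3]] := chain_events l W s.
have mG := msm (cond W s) n.
have [] := @co_indep js (l (size s)) _ _ h1 mG.
  move=> j /h2[k ks ->]; apply/eqP => /lI ke; by rewrite ke ltnn in ks.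
rewrite -h3 IH => _ ->.
have [Ws|Ws] := eqVneq (W s) 0.
  rewrite Ws mul0e; congr EFin; apply/esym/le_anti; rewrite W0 andbT -Ws; exact: tree_law_sub.
rewrite sm_law; last by apply: cond_prob => //; rewrite lt_neqAle eq_sym Ws W0.
by rewrite -EFinM /cond mulrCA divff// mulr1.
Qed.

Section two.
Context (l l' : nat -> nat) (W W' : seq nat -> R).
Context (lI : injective l) (lI' : injective l') (tW : tree_law W) (tW' : tree_law W').

(** The two histories may have different lengths, as for chains started at different levels. Only
    the next symbols are compared, so the second chain enters through its last symbol. *)
Definition split_at s s' : set Om :=
  [set x | [/\ chain l W (size s) x = s, chain l' W' (size s') x = s' &
    chain l W (size s).+1 x <> rcons s (last 0%N (chain l' W' (size s').+1 x))]].

Context (s s' : seq nat) (ll : l (size s) = l' (size s'))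
  (fresh : forall k, (k < size s)%N -> l k != l (size s))
  (fresh' : forall k, (k < size s')%N -> l' k != l' (size s')).

Let E := [set x | chain l W (size s) x = s] `&` [set x | chain l' W' (size s') x = s'].

(** By [ll], [fresh] and [fresh'], both next symbols are sampled from the same copy, and this copy
    is independent of both histories; [sm_dist] then applies to the two conditional laws. *)
Lemma split_at_prob : (0 < W s) -> 0 < W' s' ->
  (P (split_at s s') <= P E * \sum_(0 <= n <oo) `|cond W s n - cond W' s' n|%:E)%E.
Proof.
move=> Ws Ws'.
have [js [h1 h2 h3]] := chain_events l W s.
have [js' [h1' h2' h3']] := chain_events l' W' s'.
have [mD dD] := sm_dist (cond_prob tW Ws) (cond_prob tW' Ws').
have EE : E = [set x | forall j, List.In j (js ++ js') -> j.2 (co j.1 x)].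
  rewrite /E h3 h3'; apply/seteqP; split => x /=.
    by move=> [a b] j hj; case: (List.in_app_or _ _ _ hj); [exact: a|exact: b].
  by move=> h; split => j hj; apply: h; apply/List.in_or_app; [left|right].
have := @co_indep (js ++ js') (l (size s)) _ _ _ mD.
rewrite -EE => -[].
- move=> j; rewrite map_cat mem_cat => /orP[/h2[k ks ->]|/h2'[k ks ->]]; first exact: fresh.
  by rewrite ll; exact: fresh'.
- by move=> j hj; case: (List.in_app_or _ _ _ hj); [exact: h1|exact: h1'].
move=> mE eE; rewrite (_ : split_at s s' = E `&` co (l (size s)) @^-1` [set y | sm (cond W s) y <>
  sm (cond W' s') y]).
  by rewrite eE; apply: lee_pmul.
apply/seteqP; split => x /=.
  rewrite /split_at /= => -[xs xs']; rewrite xs xs' last_rcons => h; split => //.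
  by rewrite ll => e; apply: h; rewrite -e ll.
rewrite /split_at /E /= => -[[xs xs']] h; split => //.
by rewrite xs xs' last_rcons => /rcons_inj[]; rewrite -ll.
Qed.

Lemma take_chain l0 W0 t x : take t (chain l0 W0 t.+1 x) = chain l0 W0 t x.
Proof. by rewrite /= -cats1 take_size_cat// size_chain. Qed.

Lemma measurable_split_at : measurable (split_at s s').
Proof.
rewrite (_ : split_at s s' = [set x | [/\ take (size s) (chain l W (size s).+1 x) = s,
  take (size s') (chain l' W' (size s').+1 x) = s' &
  chain l W (size s).+1 x <> rcons s (last 0%N (chain l' W' (size s').+1 x))]]).
  exact: (measurable_chain2 l W (size s).+1 l' W' (size s').+1 (fun s1 s2 =>
    [/\ take (size s) s1 = s, take (size s') s2 = s' & s1 <> rcons s (last 0%N s2)])).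
by rewrite /split_at; apply/seteqP; split => x; rewrite /mkset !take_chain.
Qed.

Let mE : measurable E.
Proof. by apply: measurableI; exact: measurable_chain. Qed.

Let PE : (P E <= (W s)%:E)%E.
Proof. by rewrite -(chain_law s lI tW); apply: le_measure; rewrite ?inE;
  [exact: mE|exact: measurable_chain|move=> x []]. Qed.

Let PE' : (P E <= (W' s')%:E)%E.
Proof. by rewrite -(chain_law s' lI' tW'); apply: le_measure; rewrite ?inE;
  [exact: mE|exact: measurable_chain|move=> x []]. Qed.

Let split_at_E : (P (split_at s s') <= P E)%E.
Proof. by apply: le_measure; rewrite ?inE//; [exact: measurable_split_at|move=> x []]. Qed.

(** The probability of the joint history is bounded by [W' s']. This asymmetric form is meant for a
    history [s'] that extends [s] to the left: [W' s' / W s] is then the conditional mass of the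
    prefix. *)
Lemma split_at_le_rescaled : (P (split_at s s') <=
  \sum_(0 <= n <oo) `|W' (rcons s' n) - W' s' / W s * W (rcons s n)|%:E)%E.
Proof.
have [W0 _ _] := tW; have [W0' _ _] := tW'.
have sum0 : (0 <= \sum_(0 <= n <oo) `|W' (rcons s' n) - W' s' / W s * W (rcons s n)|%:E)%E.
  by apply: nneseries_ge0 => n _ _; rewrite lee_fin.
have [Ws|Ws] := eqVneq (W s) 0.
  by apply: le_trans split_at_E _; apply: le_trans PE _; rewrite [in leLHS]Ws.
have [Ws'|Ws'] := eqVneq (W' s') 0.
  by apply: le_trans split_at_E _; apply: le_trans PE' _; rewrite [in leLHS]Ws'.
have Wp : 0 < W s by rewrite lt_neqAle eq_sym Ws W0.
have Wp' : 0 < W' s' by rewrite lt_neqAle eq_sym Ws' W0'.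
apply: (le_trans (split_at_prob Wp Wp')).
apply: (@le_trans _ _ ((W' s')%:E * \sum_(0 <= n <oo) `|cond W s n - cond W' s' n|%:E)%E).
  by apply: lee_wpmul2r => //; apply: nneseries_ge0 => n _ _; rewrite lee_fin.
rewrite -nneseriesZl; last by move=> n _; rewrite lee_fin.
apply: lee_nneseries => [n _ _|n _].
  by rewrite -EFinM lee_fin mulr_ge0// ltW.
rewrite -EFinM lee_fin -[X in X * _]gtr0_norm// -normrM distrC mulrBr /cond.
have -> : W' s' * (W' (rcons s' n) / W' s') = W' (rcons s' n) by field.
by rewrite mulrA mulrAC.
Qed.

(** The probability of the joint history is at most the smaller of the two masses, say [a <= b].
    Then [a * |p - q| <= |a * p - b * q| + (b - a) * q], and the last terms sum to [b - a]. *)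
Lemma split_at_le : (P (split_at s s') <=
  `|W s - W' s'|%:E + \sum_(0 <= n <oo) `|W (rcons s n) - W' (rcons s' n)|%:E)%E.
Proof.
have [W0 _ WS] := tW; have [W0' _ WS'] := tW'.
have sum0 : (0 <= `|W s - W' s'|%:E + \sum_(0 <= n <oo) `|W (rcons s n) - W' (rcons s' n)|%:E)%E.
  by apply: adde_ge0; rewrite ?lee_fin//; apply: nneseries_ge0 => n _ _; rewrite lee_fin.
have [Ws|Ws] := eqVneq (W s) 0.
  by apply: le_trans split_at_E _; apply: le_trans PE _; rewrite [in leLHS]Ws.
have [Ws'|Ws'] := eqVneq (W' s') 0.
  by apply: le_trans split_at_E _; apply: le_trans PE' _; rewrite [in leLHS]Ws'.
have Wp : 0 < W s by rewrite lt_neqAle eq_sym Ws W0.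
have Wp' : 0 < W' s' by rewrite lt_neqAle eq_sym Ws' W0'.
have [p0 p1] := cond_prob tW Wp; have [q0 q1] := cond_prob tW' Wp'.
apply: (le_trans (split_at_prob Wp Wp')).
have key (a b : R) (p q : nat -> R) : 0 <= a -> a <= b -> prob_vec p -> prob_vec q ->
    (a%:E * \sum_(0 <= n <oo) `|p n - q n|%:E <=
     `|a - b|%:E + \sum_(0 <= n <oo) `|a * p n - b * q n|%:E)%E.
  move=> a0 ab [hp0 hp1] [hq0 hq1].
  have -> : (`|a - b|%:E = \sum_(0 <= n <oo) (`|b - a| * q n)%:E)%E.
    under eq_eseriesr do rewrite EFinM.
    by rewrite nneseriesZl ?hq1 ?mule1 ?(distrC a)// => n _; rewrite lee_fin.
  rewrite -nneseriesZl; last by move=> n _; rewrite lee_fin.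
  rewrite -nneseriesD; [|by move=> *; rewrite lee_fin ?mulr_ge0..].
  apply: lee_nneseries => [n _ _|n _]; first by rewrite -EFinM lee_fin mulr_ge0.
  rewrite -EFinM -EFinD lee_fin -{1}(ger0_norm a0) -normrM.
  rewrite -{2}(ger0_norm (hq0 n)) -normrM; apply: le_trans (ler_normD _ _).
  by have -> : (b - a) * q n + (a * p n - b * q n) = a * (p n - q n) by ring.
have e (c z : R) : c != 0 -> c * (z / c) = z by move=> c0; field.
have sum0' : (0 <= \sum_(0 <= n <oo) `|cond W s n - cond W' s' n|%:E)%E.
  by apply: nneseries_ge0 => n _ _; rewrite lee_fin.
have cE : (\sum_(0 <= n <oo) `|W s * cond W s n - W' s' * cond W' s' n|%:E =
    \sum_(0 <= n <oo) `|W (rcons s n) - W' (rcons s' n)|%:E)%E.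
  by apply: eq_eseriesr => n _; rewrite /cond !e.
have [ab|ab] := leP (W s) (W' s').
  apply: le_trans (lee_wpmul2r sum0' PE) _.
  by rewrite -cE; apply: key => //; split.
apply: le_trans (lee_wpmul2r sum0' PE') _.
rewrite -cE distrC.
rewrite (_ : \sum_(0 <= n <oo) `|cond W s n - cond W' s' n|%:E = \sum_(0 <= n <oo) `|cond W' s' n -
  cond W s n|%:E)%E; last first.
  by apply: eq_eseriesr => n _; rewrite distrC.
rewrite [X in (_ <= _ + X)%E](_ : _ = \sum_(0 <= n <oo) `|W' s' * cond W' s' n - W s * cond W s
  n|%:E)%E; last first.
  by apply: eq_eseriesr => n _; rewrite distrC.
by apply: key; rewrite ?ltW//; split.
Qed.

End two.

Section disagree.
Context (l : nat -> nat) (W W' : seq nat -> R).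
Context (lI : injective l) (tW : tree_law W) (tW' : tree_law W').

Definition disagree t : set Om :=
  [set x | chain l W t x = chain l W' t x /\ chain l W t.+1 x <> chain l W' t.+1 x].

Lemma measurable_disagree t : measurable (disagree t).
Proof.
rewrite (_ : disagree t = [set x | take t (chain l W t.+1 x) = take t (chain l W' t.+1 x) /\
   chain l W t.+1 x <> chain l W' t.+1 x]).
  exact: (measurable_chain2 l W t.+1 l W' t.+1 (fun s1 s2 => take t s1 = take t s2 /\ s1 <> s2)).
by rewrite /disagree; apply/seteqP; split => x; rewrite /mkset !take_chain.
Qed.

(** [split_at_le] with the same history for both chains, summed over this history. *)
Lemma disagree_le t : (P (disagree t) <=
  tsum t (fun s => `|W s - W' s|%:E) + tsum t.+1 (fun s => `|W s - W' s|%:E))%E.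
Proof.
rewrite (@tsum_measure _ _ _ P t (chain l W) (fun t x => sm (cond W (chain l W t x))
  (co (l t) x)))//; last 2 first.
- by move=> u s; exact: measurable_chain.
- exact: measurable_disagree.
rewrite /= -tsumD; [|by move=> s; rewrite ?lee_fin// nneseries_ge0// => n _ _; rewrite lee_fin..].
apply: le_tsum => s st; first exact: measure_ge0.
have fr k : (k < size s)%N -> l k != l (size s).
  by move=> ks; apply/eqP => /lI ke; rewrite ke ltnn in ks.
apply: le_trans (split_at_le lI lI tW tW' erefl fr fr).
apply: le_measure; rewrite ?inE.
- by apply: measurableI; [exact: measurable_disagree|exact: measurable_chain].
- by apply: measurable_split_at.
rewrite /disagree /split_at st => x /= [[ht h] hs]; split => //; first by rewrite -ht.
by move: h; rewrite -ht last_rcons hs.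
Qed.

End disagree.
End chain.

(** * Sampling by races of independent variables *)

Section iid.
Context (R : realType) d (Om : measurableType d) (P : probability Om R).
Context (s1 s2 : Om -> Om) (ms1 : measurable_fun setT s1) (ms2 : measurable_fun setT s2).
Context (s12 : independent_halves P s1 s2).

Lemma split_integral (f : Om * Om -> \bar R) : measurable_fun setT f -> (forall z, 0 <= f z)%E ->
  (\int[P]_x f (s1 x, s2 x) = \int[P]_y \int[P]_z f (y, z))%E.
Proof.
move=> mf f0.
have mp : measurable_fun setT (fun x => (s1 x, s2 x)) by exact: measurable_fun_pair.
transitivity (\int[push P mp]_z f z)%E.
  by rewrite [RHS]ge0_integral_pushforward// preimage_setT.
transitivity (\int[P \x P]_z f z)%E; last exact: fubini_tonelli1.
apply: eq_measure_integral => A mA _; apply/esym; apply: product_measure_unique => // B C mB mC.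
Qed.

(** Each split spends its first half as a copy and keeps the second half for all later copies. *)
Fixpoint iid (k : nat) (x : Om) : Om := if k is k'.+1 then iid k' (s2 x) else s1 x.

Lemma measurable_iid k : measurable_fun setT (iid k).
Proof. by elim: k => [|k IH] //=; move: (measurableT_comp IH ms2). Qed.

Lemma iid_inter n (G : nat -> set Om) : (forall k, measurable (G k)) ->
  measurable [set x | forall k, (k < n)%N -> G k (iid k x)] /\
  P [set x | forall k, (k < n)%N -> G k (iid k x)] = (\prod_(k < n) P (G k))%E.
Proof.
elim: n G => [|n IH] G mG.
  rewrite (_ : [set _ | _] = setT) ?probability_setT ?big_ord0//; exact/seteqP.
have [mI eI] := IH (fun k => G k.+1) (fun k => mG k.+1).
rewrite (_ : [set _ | _] = s1 @^-1` (G 0%N) `&` s2 @^-1` [set x | forall k, (k < n)%N ->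
  G k.+1 (iid k x)]).
  split; last by rewrite s12// eI big_ord_recl.
  by apply: measurableI; exact: measurable_pre.
apply/seteqP; split => x /=.
  by move=> h; split; [exact: (h 0%N)|move=> k kn; exact: (h k.+1)].
by move=> [h0 hS] [|k]//= kn; apply: hS.
Qed.

Lemma iid_inter_all (G : nat -> set Om) : (forall k, measurable (G k)) ->
  (\prod_(k < n) P (G k))%E @[n --> \oo] --> P [set x | forall k, G k (iid k x)].
Proof.
move=> mG.
pose F n := [set x | forall k, (k < n)%N -> G k (iid k x)].
have mF n : measurable (F n) by have [] := iid_inter n mG.
rewrite (_ : [set x | _] = \bigcap_n F n); last first.
  apply/seteqP; split => x /=; first by move=> h n _ k _; exact: h.
  by move=> h k; exact: (h k.+1 I k).
rewrite (_ : (fun n => _) = P \o F); last first.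
  by apply/funext => n /=; have [] := iid_inter n mG.
apply: nonincreasing_cvg_mu => //.
- by rewrite (le_lt_trans (probability_le1 _ _)) ?ltry.
- exact: bigcapT_measurable.
- by move=> m n mn; apply/subsetPset => x h k km; apply: h; exact: leq_trans mn.
Qed.

(** Indices may be repeated in the list, so the constraints are first grouped: [H k] gathers those
    on copy [k]. Both sides then become finite products of [iid_inter], and they differ only at the
    index [l], where [H l] is the whole space. *)
Lemma iid_indep : independent_copies P iid.
Proof.
move=> js l G jl mjs mG.
pose H k := [set y | forall j, List.In j js -> j.1 = k -> j.2 y].
have mH k : measurable (H k).
  rewrite /H; elim: js mjs {jl H} => [|j js IH] mjs.
    by rewrite (_ : [set _ | _] = setT)//; apply/seteqP; split => // y _ j [].
  rewrite (_ : [set _ | _] = [set y | j.1 = k -> j.2 y] `&` [set y | forall j, List.In j js ->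
    j.1 = k -> j.2 y]); last first.
    apply/seteqP; split => y /=; first by move=> h; split => [|j' hj']; apply: h; [left|right].
    by move=> [h1 h2] j' [<-//|]; exact: h2.
  apply: measurableI; last by apply: IH => j' hj'; apply: mjs; right.
  have [jk|jk] := pselect (j.1 = k).
    by rewrite (_ : [set _ | _] = j.2); [apply: mjs; left|apply/seteqP; split => y /=; [exact|]].
  rewrite (_ : [set _ | _] = setT)//; apply/seteqP; split => //= y _ jk'; exact: False_ind (jk jk').
pose M := (\max_(j <- map fst js) j + l).+1.
have jM j : List.In j js -> (j.1 < M)%N.
  move=> hj; rewrite ltnS; apply: leq_trans (leq_addr _ _).
  rewrite (@leq_bigmax_seq _ _ xpredT (fun j => j))//.
  elim: js hj {jl mjs H mH M} => [//|a js IH] /= [->|/IH h]; rewrite in_cons ?eqxx// h orbT //.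
have lM : (l < M)%N by rewrite ltnS leq_addl.
have E1 : [set x | forall j, List.In j js -> j.2 (iid j.1 x)] = [set x | forall k, (k < M)%N ->
  H k (iid k x)].
  apply/seteqP; split => x /=.
    by move=> h k _ j hj jk; rewrite -jk; exact: h.
  by move=> h j hj; apply: (h j.1 (jM j hj)).
pose H' k := if k == l then G else H k.
have mH' k : measurable (H' k) by rewrite /H'; case: ifP.
have Hl : H l = setT.
  apply/seteqP; split => // y _ j hj jE.
  have : j.1 \in map fst js.
    elim: js hj {jl mjs H mH M jM lM E1 H' mH'} => [//|a js IH] /= [->|/IH h];
      rewrite in_cons ?eqxx// h orbT //.
  by move/jl; rewrite jE eqxx.
have E2 : [set x | forall j, List.In j js -> j.2 (iid j.1 x)] `&` iid l @^-1` G = [set x | forall k,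
  (k < M)%N -> H' k (iid k x)].
  rewrite E1; apply/seteqP; split => x /=.
    by move=> [h1 h2] k kM; rewrite /H'; case: eqP => [->//|_]; exact: h1.
  move=> h; split; last by have := h l lM; rewrite /H' eqxx.
  move=> k kM; have := h k kM; rewrite /H'; case: eqP => [->|//]; by rewrite Hl.
have [m1 e1] := iid_inter M mH; have [m2 e2] := iid_inter M mH'.
rewrite E2 e2 E1 e1; split => //.
rewrite (bigD1 (Ordinal lM))//= [in RHS](bigD1 (Ordinal lM))//= {1}/H' eqxx Hl probability_setT
  mul1e muleC.
congr (_ * _)%E; apply: eq_bigr => i; rewrite /H' -val_eqE /= => /negbTE -> //.
Qed.

Lemma cvg_psum (v : nat -> R) V : (forall m, 0 <= v m) ->
  (\sum_(0 <= m <oo) (v m)%:E = V%:E)%E -> \sum_(k < n) v k @[n --> \oo] --> V.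
Proof.
move=> v0 vV.
have : cvgn (fun n => \sum_(0 <= i < n) (v i)%:E)%E.
  by apply: is_cvg_nneseries => n _ _; rewrite lee_fin.
move=> /cvg_toP/(_ vV)/fine_cvg; apply: cvg_trans; apply: near_eq_cvg; apply: nearW => n /=.
by rewrite sumEFin/= big_mkord.
Qed.

Section race.
Context (U : Om -> R) (mU : measurable_fun setT U) (U0 : forall x, 0 <= U x) (U1 : forall x,
  U x <= 1).
Context (Ucdf : forall t : R, 0 <= t <= 1 -> P [set x | U x < t] = t%:E).
Context (Uint : forall b : R, 0 <= b -> (\int[P]_x (U x `^ b)%:E = ((1 + b)^-1)%:E)%E).

Lemma powR_add (t a b : R) : 0 <= a -> 0 <= b -> t `^ (a + b) = t `^ a * t `^ b.
Proof.
move=> a0 b0; have [ab|ab] := eqVneq (a + b) 0; last by rewrite powRD// (negbTE ab).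
move: (ab) => /eqP; rewrite paddr_eq0// => /andP[/eqP-> /eqP->].
by rewrite addr0 powRr0 mul1r.
Qed.

Lemma powR_le_exp (t a b : R) : 0 <= t <= 1 -> 0 <= a <= b -> t `^ b <= t `^ a.
Proof.
move=> /andP[t0 t1] /andP[a0 ab]; have [->|tn0] := eqVneq t 0.
  rewrite /powR eqxx ler_nat; case: (eqVneq b 0) => // b0.
  suff -> : a = 0 by rewrite eqxx.
  by apply/le_anti; rewrite a0 andbT -b0.
by rewrite ger_powR// lt_neqAle eq_sym tn0 t0.
Qed.

Lemma powR_le1 (t a : R) : 0 <= t <= 1 -> 0 <= a -> t `^ a <= 1.
Proof.
move=> /andP[t0 t1] a0; have [->|tn0] := eqVneq t 0.
  by rewrite /powR eqxx; case: eqP.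
by rewrite -(powRr0 t) ger_powR// lt_neqAle eq_sym tn0 t0.
Qed.

Lemma cvg_powR_sum (t : R) (v : nat -> R) V : 0 <= t -> (forall m, 0 <= v m) ->
  \sum_(k < n) v k @[n --> \oo] --> V ->
  \prod_(k < n) t `^ v k @[n --> \oo] --> t `^ V.
Proof.
move=> t0 v0 vV.
have -> : (fun n => \prod_(k < n) t `^ v k) = (fun n => t `^ (\sum_(k < n) v k)).
  apply/funext; elim=> [|n IH]; first by rewrite !big_ord0 powRr0.
  by rewrite !big_ord_recr/= IH powR_add// sumr_ge0.
have nd : nondecreasing_seq (fun n => \sum_(k < n) v k).
  by apply/nondecreasing_seqP => n; rewrite big_ord_recr lerDl.
have sV n : \sum_(k < n) v k <= V by have := nondecreasing_cvgn_le nd (cvgP _ vV) n;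
  rewrite (cvg_lim _ vV).
have [->|tn0] := eqVneq t 0; last first.
  rewrite /powR (negbTE tn0).
  have h : (\sum_(k < n) v k) * ln t @[n --> \oo] --> V * ln t by apply: cvgM => //; exact: cvg_cst.
  exact: (cvg_comp _ _ h (@continuous_expR _ _)).
(* For [t = 0] the power is 1 at exponent 0 and 0 elsewhere, so the products are eventually
   constant. *)
rewrite /powR eqxx; have [V0|V0] := eqVneq V 0.
  apply: cvg_near_cst; apply: nearW => n; congr (_ %:R); congr (nat_of_bool _); apply/eqP/eqP => //.
  by apply/eqP/le_anti; rewrite sumr_ge0// andbT -[X in _ <= X]V0 sV.
apply: cvg_near_cst.
have Vp : 0 < V by rewrite lt_neqAle eq_sym V0 (le_trans _ (sV 0%N))// big_ord0.
have /cvgrPdist_lt/(_ _ Vp) := vV; apply: filterS => n h.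
suff /negbTE -> : \sum_(k < n) v k != 0 by [].
by apply: contraTneq h => ->; rewrite subr0 gtr0_norm// ltxx.
Qed.

Lemma measurable_lt d' (T1 : measurableType d') (f g : T1 -> R) : measurable_fun setT f ->
  measurable_fun setT g ->
  measurable [set x | f x < g x].
Proof.
move=> mf mg; have := measurable_fun_ltr mf mg measurableT (Y := [set true]) I.
by rewrite setTI; congr measurable; apply/seteqP; split.
Qed.

Let mUi m : measurable_fun setT (fun x => U (iid m x)).
Proof. by move: (measurableT_comp mU (measurable_iid m)). Qed.

Let mpow d' (T : measurableType d') (f : T -> R) a : measurable_fun setT f ->
  measurable_fun setT (fun x => f x `^ a).
Proof. by move=> mf; move: (measurableT_comp (measurable_powR a) mf). Qed.

(** Independence gives the product of the [t ^ v m]; there are infinitely many factors, hence the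
    passage to the limit. *)
Lemma race_all (v : nat -> R) (V t : R) : (forall m, 0 <= v m) -> \sum_(k < n) v k @[n --> \oo] -->
  V -> 0 <= t <= 1 ->
  P [set x | forall m, U (iid m x) < t `^ v m] = (t `^ V)%:E.
Proof.
move=> v0 vV t01.
have c1 := @iid_inter_all (fun m => [set y | U y < t `^ v m]) _.
have mG k : measurable [set y | U y < t `^ v k].
  by apply: measurable_lt => //; exact: measurable_cst.
apply: cvg_unique (c1 mG) _ => //.
rewrite (_ : (fun n => _) = (fun n => (\prod_(k < n) t `^ v k)%:E)).
  apply: cvg_EFin; first exact: nearW.
  by apply: cvg_powR_sum => //; case/andP: t01.
apply/funext => n; rewrite -prodEFin; apply: eq_bigr => k _.
by rewrite Ucdf// powR_ge0 powR_le1.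
Qed.

(** For [v m = p m / p n] this is a race of exponential clocks: the clock [- ln U_n / p n], of rate
    [p n], rings before every clock [- ln U_m / p m]. In the form of powers, a competitor with
    [v m = 0] loses as soon as [U_m < 1]. *)
Definition win (v : nat -> R) (n : nat) : set Om :=
  [set x | forall m, m != n -> U (iid m x) < U (iid n x) `^ v m].

Lemma measurable_win v n : measurable (win v n).
Proof.
rewrite (_ : win v n = \bigcap_m [set x | m != n -> U (iid m x) < U (iid n x) `^ v m]); last first.
  by apply/seteqP; split => x h m; [move=> _|]; exact: h.
apply: bigcapT_measurable => m; have [mn|mn] := boolP (m != n); last first.
  by rewrite (_ : [set _ | _] = setT)//; exact/seteqP.
rewrite (_ : [set _ | _] = [set x | U (iid m x) < U (iid n x) `^ v m]).
  by apply: measurable_lt => //; exact: mpow.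
by apply/seteqP; split => x /=; [exact|].
Qed.

(** Induction on the position [n] of the candidate. Integrating out the competitor in front
    multiplies the integrand by [U_n ^ v 0], which is why a power [a] is carried along. When the
    candidate is in front, all the others lose with probability [U_n ^ V], and a moment of the
    uniform law remains. *)
Lemma race_int n (v : nat -> R) (V a : R) : (forall m, 0 <= v m) -> v n = 0 ->
  \sum_(k < n) v k @[n --> \oo] --> V -> 0 <= a ->
  (\int[P]_x ((U (iid n x) `^ a)%:E * (\1_(win v n) x)%:E) = ((1 + a + V)^-1)%:E)%E.
Proof.
elim: n v V a => [|n IH] v V a v0 vn vV a0.
  have V0 : 0 <= V.
    have := @limr_ge _ _ _ _ 0 (fun n => \sum_(k < n) v k) (cvgP _ vV).
    by rewrite (cvg_lim _ vV)//; apply; apply: nearW => n; rewrite sumr_ge0.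
  pose W := [set p : Om * Om | forall m, U (iid m p.2) < U p.1 `^ v m.+1].
  have mW : measurable W.
    rewrite (_ : W = \bigcap_m [set p | U (iid m p.2) < U p.1 `^ v m.+1]); last first.
      by apply/seteqP; split => x h m; [move=> _|]; exact: h.
    apply: bigcapT_measurable => m; apply: measurable_lt.
      by move: (measurableT_comp (mUi m) (@measurable_snd _ _ Om Om)).
    apply: mpow; by move: (measurableT_comp mU (@measurable_fst _ _ Om Om)).
  pose f (p : Om * Om) := ((U p.1 `^ a)%:E * (\1_W p)%:E)%E.
  transitivity (\int[P]_x f (s1 x, s2 x))%E.
    apply: eq_integral => x _; rewrite /f /=; congr (_ * (_ %:E))%E.
    rewrite !indicE; congr (_ %:R); congr nat_of_bool; apply/idP/idP; rewrite !inE.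
      by move=> h m; apply: (h m.+1).
    by move=> h [//|m] _; exact: h.
  rewrite split_integral//; last 2 first.
  - apply: emeasurable_funM; last exact/measurable_EFinP/measurable_indic.
    apply/measurable_EFinP/mpow; by move: (measurableT_comp mU (@measurable_fst _ _ Om Om)).
  - by move=> z; rewrite /f -EFinM lee_fin mulr_ge0 ?powR_ge0.
  transitivity (\int[P]_y (U y `^ (a + V))%:E)%E; last by rewrite Uint ?addrA ?addr_ge0.
  apply: eq_integral => y _; rewrite /f /= ge0_integralZl_EFin ?powR_ge0//; last first.
    apply/measurable_EFinP. 
    by move: (measurableT_comp (@measurable_indic _ _ R setT _ mW) (pair1_measurable y)).
  rewrite (_ : (\int[P]_x _)%E = P [set z | forall m, U (iid m z) < U y `^ v m.+1]); last first.
    have mWy : measurable [set z | forall m, U (iid m z) < U y `^ v m.+1].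
      by have := measurable_pre (pair1_measurable y) mW.
    rewrite -[X in P X]setIT -integral_indic//.
  rewrite (race_all (V := V))//; last 2 first.
  - have : \sum_(k < n.+1) v k @[n --> \oo] --> V by rewrite (cvg_shiftS (fun n =>
    \sum_(k < n) v k)).
    by under eq_cvg do rewrite big_ord_recl vn add0r.
  - by rewrite U0 U1.
  by rewrite -EFinM powR_add.
pose v' m := v m.+1.
have vV' : \sum_(k < n) v' k @[n --> \oo] --> V - v 0%N.
  rewrite (_ : (fun n => \sum_(k < n) v' k) = (fun n => \sum_(k < n.+1) v k - v 0%N)); last first.
    by apply/funext => k; rewrite big_ord_recl addrAC subrr add0r.
  by apply: cvgB; [rewrite (cvg_shiftS (fun n => \sum_(k < n) v k))|exact: cvg_cst].
pose f (p : Om * Om) := (((U (iid n p.2) `^ a)%:E * (\1_(win v' n) p.2)%:E) *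
  (\1_[set p | U p.1 < U (iid n p.2) `^ v 0%N] p)%:E)%E.
have mn2 : measurable_fun setT (fun p : Om * Om => U (iid n p.2)).
  by move: (measurableT_comp (mUi n) (@measurable_snd _ _ Om Om)).
have mI : measurable [set p : Om * Om | U p.1 < U (iid n p.2) `^ v 0%N].
  apply: measurable_lt; last exact: mpow.
  by move: (measurableT_comp mU (@measurable_fst _ _ Om Om)).
have mf : measurable_fun setT f.
  apply: emeasurable_funM; last exact/measurable_EFinP/measurable_indic.
  apply: emeasurable_funM; first exact/measurable_EFinP/mpow.
  apply/measurable_EFinP.
  by move: (measurableT_comp (@measurable_indic _ _ R setT _ (measurable_win v' n)) (@measurable_snd
    _ _ Om Om)).
have f0 z : (0 <= f z)%E.
  by rewrite /f -!EFinM lee_fin !mulr_ge0 ?powR_ge0.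
transitivity (\int[P]_x f (s1 x, s2 x))%E.
  apply: eq_integral => x _; rewrite /f /= -muleA; congr (_ * _)%E; rewrite -EFinM; congr (_ %:E).
  rewrite !indicE -natrM mulnb; congr (_ %:R); congr nat_of_bool; apply/idP/idP.
    rewrite inE => h; apply/andP; split; rewrite inE.
      by move=> m mn; apply: (h m.+1).
    by apply: (h 0%N).
  move=> /andP[]; rewrite !inE => h h0 [|m] mn; first exact: h0.
  exact: h.
rewrite split_integral// fubini_tonelli//.
transitivity (\int[P]_z ((U (iid n z) `^ (a + v 0%N))%:E * (\1_(win v' n) z)%:E))%E; last first.
  rewrite (IH _ (V - v 0%N)) ?addr_ge0//; last by move=> m; exact: v0.
  by congr (_^-1%:E); ring.
apply: eq_integral => z _; rewrite /fubini_G /f /=.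
rewrite -EFinM ge0_integralZl_EFin//; last 2 first.
- apply/measurable_EFinP.
  by move: (measurableT_comp (@measurable_indic _ _ R setT _ mI) (pair2_measurable z)).
- by rewrite mulr_ge0 ?powR_ge0.
rewrite (_ : (\int[P]_x _)%E = P [set y | U y < U (iid n z) `^ v 0%N]); last first.
  have mWy : measurable [set y | U y < U (iid n z) `^ v 0%N].
    by have := measurable_pre (pair2_measurable z) mI.
  rewrite -[X in P X]setIT -integral_indic//.
rewrite Ucdf ?powR_ge0 ?powR_le1 ?U0 ?U1//.
by rewrite -!EFinM powR_add// mulrAC.
Qed.

(** In [race_int] the candidate has weight 0, while here its own weight 1 is counted in [V]; the
    value is [1 / (1 + 0 + (V - 1))]. *)
Lemma race_win n (v : nat -> R) V : (forall m, 0 <= v m) -> v n = 1 ->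
  (\sum_(0 <= m <oo) (v m)%:E = V%:E)%E ->
  P (win v n) = V^-1%:E.
Proof.
move=> v0 vn vV.
pose v' m := if m == n then 0 else v m.
have v'0 m : 0 <= v' m by rewrite /v'; case: ifP.
have -> : win v n = win v' n.
  by apply/seteqP; split => x h m mn; have := h m mn; rewrite /v' (negbTE mn).
have sV : (\sum_(0 <= m <oo) (v' m)%:E = (V - 1)%:E)%E.
  move: vV; rewrite (@nneseriesD1 _ _ n)//; last by move=> k _; rewrite lee_fin.
  rewrite vn (_ : \sum_(0 <= k <oo | _ ) (v k)%:E = \sum_(0 <= m <oo) (v' m)%:E)%E; last first.
    rewrite [LHS]eseries_mkcond; apply: eq_eseriesr => i _; rewrite /v'; case: eqP => //.
  by move=> h; rewrite EFinB -h addeAC subee// add0e.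
have := @race_int n v' (V - 1) 0 v'0 _ (cvg_psum v'0 sV) (lexx _).
rewrite /v' eqxx => /(_ erefl).
under eq_integral do rewrite powRr0 mul1e.
rewrite integral_indic//; last exact: measurable_win.
rewrite setIT => ->; congr (_^-1%:E); ring.
Qed.

Definition ratio (p : nat -> R) n m : R := p m / p n.
Definition wins (p : nat -> R) (x : Om) : set nat := [set n | 0 < p n /\ win (ratio p n) n x].
(** The default 0 is returned when nobody wins, an event of probability 0 for a probability
    vector. *)
Definition sampler (p : nat -> R) (x : Om) : nat := xget 0%N (wins p x).

(** The exponents [ratio p n n'] and [ratio p n' n] are inverse to each other, so two winners would
    give [U_n' < U_n']. *)
Lemma wins_uniq p x n n' : wins p x n -> wins p x n' -> n = n'.
Proof.
move=> [pn h] [pn' h']; apply/eqP/negPn/negP => nn'.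
have := h n' _; rewrite eq_sym nn' => /(_ isT) h1.
have := h' n nn' => h2.
have r0 : 0 < ratio p n n' by rewrite divr_gt0.
have : U (iid n x) `^ ratio p n n' < (U (iid n' x) `^ ratio p n' n) `^ ratio p n n'.
  by apply: gt0_ltr_powR; rewrite ?nnegrE ?powR_ge0.
have -> : (U (iid n' x) `^ ratio p n' n) `^ ratio p n n' = U (iid n' x).
    rewrite -powRrM (_ : ratio p n' n * ratio p n n' = 1) ?powRr1// /ratio.
    by field; rewrite !gt_eqF.
  move=> h3.
by move: (lt_trans h1 h3); rewrite ltxx.
Qed.

Let Wn (p : nat -> R) n : set Om := [set x | wins p x n].

Let mWn p n : measurable (Wn p n).
Proof.
have [pn|pn] := boolP (0 < p n).
  rewrite (_ : Wn p n = win (ratio p n) n); first exact: measurable_win.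
  by apply/seteqP; split => x; [case|split].
rewrite (_ : Wn p n = set0)//; apply/seteqP; split => // x [].
by rewrite (negbTE pn).
Qed.

Lemma sampler_wins p x n : wins p x n -> sampler p x = n.
Proof. by move=> h; rewrite /sampler; case: xgetP => [m _|/(_ n)//]; move/wins_uniq; apply. Qed.

Lemma measurable_sampler p n : measurable [set x | sampler p x = n].
Proof.
have -> : [set x | sampler p x = n] = Wn p n `|` (if n == 0%N then ~` (\bigcup_k Wn p k) else set0).
  apply/seteqP; split => x /=.
    rewrite /sampler; case: xgetP => [m mE hm <-|h <-]; first by left.
    by right; rewrite eqxx => -[k _]; exact: h.
  move=> [/sampler_wins//|]; case: eqP => // -> h.
  by rewrite /sampler; case: xgetP => // m _ hm; case: h; exists m.
apply: measurableU; first exact: mWn.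
case: ifP => // _; apply: measurableC; exact: bigcupT_measurable.
Qed.


Let sum_scale (p : nat -> R) c V : (forall n, 0 <= p n) -> 0 <= c ->
  (\sum_(0 <= n <oo) (p n)%:E = V%:E)%E ->
  (\sum_(0 <= n <oo) (p n * c)%:E = (V * c)%:E)%E.
Proof.
move=> p0 c0 pV; rewrite mulrC EFinM -pV -nneseriesZl//.
  by apply: eq_eseriesr => n _; rewrite mulrC EFinM.
by move=> n _; rewrite lee_fin.
Qed.

Let P_Wn p n : prob_vec p -> P (Wn p n) = (p n)%:E.
Proof.
move=> [p0 p1]; have [pn|pn] := boolP (0 < p n).
  rewrite (_ : Wn p n = win (ratio p n) n); last first.
    by apply/seteqP; split => x; [case|split].
  rewrite (@race_win _ _ (1 / p n)).
  - by rewrite div1r invrK.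
  - by move=> m; rewrite divr_ge0.
  - by rewrite /ratio divff ?gt_eqF.
  - by apply: sum_scale; rewrite ?invr_ge0.
have -> : p n = 0 by apply/eqP; rewrite eq_le p0 andbT leNgt.
rewrite (_ : Wn p n = set0) ?measure0//; apply/seteqP; split => // x [].
by rewrite (negbTE pn).
Qed.

Let trivW p : trivIset setT (Wn p).
Proof. by move=> i j _ _ [x [hi hj]]; exact: wins_uniq hi hj. Qed.

(** The events of winning are disjoint and their probabilities [p n] add up to 1, so what lies
    outside them is null. *)
Lemma sampler_law : samples P sampler.
Proof.
move=> p n pp.
have full : P (\bigcup_k Wn p k) = 1%E.
  rewrite measure_semi_bigcup//; last exact: bigcupT_measurable.
  by rewrite -(proj2 pp); apply: eq_eseriesr => k _; apply: P_Wn.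
have N0 : P (~` \bigcup_k Wn p k) = 0%E.
  by rewrite probability_setC ?full ?subee//; exact: bigcupT_measurable.
apply/eqP; rewrite eq_le; apply/andP; split; last first.
  rewrite -(P_Wn n pp); apply: le_measure; rewrite ?inE//; first exact: measurable_sampler.
  by move=> x; exact: sampler_wins.
rewrite -(P_Wn n pp) -[leRHS]adde0 -N0.
apply: le_trans (measureU2 _ _ _) => //; last by apply: measurableC; exact: bigcupT_measurable.
apply: le_measure; rewrite ?inE//; first exact: measurable_sampler.
  by apply: measurableU => //; apply: measurableC; exact: bigcupT_measurable.
move=> x /= xn; have [h|] := pselect ((\bigcup_k Wn p k) x); last by right.
by left; case: h => k _ hk; rewrite -xn (sampler_wins hk).
Qed.

(** Let [S] and [M] be the sums of the maxima and of the minima of [p] and [q], so that [S - M] is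
    the l^1 distance. Symbol [n] wins both races with probability at least [mi n / S], so the
    samples agree with probability at least [M / S], and [(S - M) / S <= S - M] because [1 <= S]. *)
Lemma sampler_dist : couples P sampler.
Proof.
move=> p q pp qq; have [p0 p1] := pp; have [q0 q1] := qq.
have mD : measurable [set x | sampler p x <> sampler q x].
  rewrite (_ : [set x | _] = ~` \bigcup_n ([set x | sampler p x = n] `&` [set x | sampler q
    x = n])).
    apply: measurableC; apply: bigcupT_measurable => n.
    by apply: measurableI; exact: measurable_sampler.
  apply/seteqP; split => x /=; first by move=> h [n _ [h1 h2]]; apply: h; rewrite h1 h2.
  by move=> h e; apply: h; exists (sampler p x).
split => //.
pose mi n := Num.min (p n) (q n); pose ma n := Num.max (p n) (q n).
have mi0 n : 0 <= mi n by rewrite le_min p0 q0.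
have ma0 n : 0 <= ma n by rewrite le_max p0.
have mm n : ma n + mi n = p n + q n by rewrite /ma /mi addr_max_min.
have sumE : (\sum_(0 <= n <oo) (ma n)%:E + \sum_(0 <= n <oo) (mi n)%:E = (2:R)%:E)%E.
  rewrite -nneseriesD; [|by move=> *; rewrite lee_fin..].
  rewrite (_ : (2:R)%:E = (1 + 1)%E); last by rewrite -EFinD.
  rewrite -[in X in (_ = X + _)%E]p1 -q1 -nneseriesD; [|by move=> *; rewrite lee_fin..].
  by apply: eq_eseriesr => n _; rewrite -!EFinD mm.
have sma0 : (0 <= \sum_(0 <= n <oo) (ma n)%:E)%E by apply: nneseries_ge0 => n _ _; rewrite lee_fin.
have smi0 : (0 <= \sum_(0 <= n <oo) (mi n)%:E)%E by apply: nneseries_ge0 => n _ _; rewrite lee_fin.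
have fma : (\sum_(0 <= n <oo) (ma n)%:E)%E \is a fin_num.
  by rewrite ge0_fin_numE// (le_lt_trans (leeDl _ smi0))// sumE ltry.
have fmi : (\sum_(0 <= n <oo) (mi n)%:E)%E \is a fin_num.
  by rewrite ge0_fin_numE// (le_lt_trans (leeDr _ sma0))// sumE ltry.
have : (\sum_(0 <= n <oo) (mi n)%:E + \sum_(0 <= n <oo) `|p n - q n|%:E = \sum_(0 <= n <oo)
  (ma n)%:E)%E.
  rewrite -nneseriesD; [|by move=> *; rewrite lee_fin..].
  apply: eq_eseriesr => n _; rewrite -!EFinD; congr EFin; rewrite /mi /ma.
  by case: (leP (p n) (q n)) => h; [rewrite ler0_norm|rewrite gtr0_norm]; lra.
have le1S : (1 <= \sum_(0 <= n <oo) (ma n)%:E)%E.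
  rewrite -p1; apply: lee_nneseries => [n _ _|n _]; rewrite lee_fin//.
  by rewrite le_max lexx.
move: sumE le1S fma; move Sx : (\sum_(0 <= n <oo) (ma n)%:E)%E => Se; case: Se Sx => [S| |]// Sx.
move: fmi; move Mx : (\sum_(0 <= n <oo) (mi n)%:E)%E => Me; case: Me Mx => [M| |]// Mx _.
rewrite -EFinD => -[SM]; rewrite lee_fin => S1 _ DD.
have -> : (\sum_(0 <= n <oo) `|p n - q n|%:E = (S - M)%:E)%E.
  by case: (\sum_(0 <= n <oo) _)%E DD => [r [<-]|//|//]; congr EFin; ring.
(* Powers of a number of [[0, 1]] decrease with the exponent, so a win against the larger of the two
   ratios is a win in both races. *)
pose v n m := Num.max (ratio p n m) (ratio q n m).
pose E n := [set x | 0 < mi n /\ win (v n) n x].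
have mE n : measurable (E n).
  have [pn|pn] := boolP (0 < mi n).
    rewrite (_ : E n = win (v n) n); first exact: measurable_win.
    by apply/seteqP; split => x; [case|split].
  by rewrite (_ : E n = set0)//; apply/seteqP; split => // x []; rewrite (negbTE pn).
have Ep n x : E n x -> wins p x n /\ wins q x n.
  move=> [pq h]; move: pq; rewrite lt_min => /andP[pn qn].
  by split; split => // m mn; apply: lt_le_trans (h m mn) _;
    rewrite powR_le_exp ?U0 ?U1// divr_ge0//= le_max lexx ?orbT.
have tE : trivIset setT E.
  by move=> i j _ _ [x [/Ep[hi _] /Ep[hj _]]]; exact: wins_uniq hi hj.
have S0 : 0 < S by exact: lt_le_trans S1.
have PE n : ((mi n / S)%:E <= P (E n))%E.
  have [pn|pn] := boolP (0 < mi n); last first.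
    have -> : mi n = 0 by apply/eqP; rewrite eq_le mi0 andbT leNgt.
    by rewrite mul0r.
  move: (pn); rewrite lt_min => /andP[pn0 qn0].
  have v0 m : 0 <= v n m by rewrite le_max divr_ge0.
  have vle m : v n m <= ma m * (mi n)^-1.
    rewrite ge_max; apply/andP; split; apply: ler_pM; rewrite ?invr_ge0 ?(ltW pn0) ?(ltW qn0)//.
    - by rewrite le_max lexx.
    - by rewrite lef_pV2 ?posrE// ge_min lexx.
    - by rewrite le_max lexx orbT.
    - by rewrite lef_pV2 ?posrE// ge_min lexx orbT.
  have sv : (\sum_(0 <= m <oo) (v n m)%:E <= (S * (mi n)^-1)%:E)%E.
    rewrite -(@sum_scale ma) ?invr_ge0 ?mi0//.
    by apply: lee_nneseries => [m _ _|m _]; rewrite lee_fin.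
  have sv0 : (0 <= \sum_(0 <= m <oo) (v n m)%:E)%E by apply: nneseries_ge0 => m _ _;
    rewrite lee_fin.
  have vnn : v n n = 1 by rewrite /v /ratio !divff ?gt_eqF// maxxx.
  have sv1 : (1 <= \sum_(0 <= m <oo) (v n m)%:E)%E.
    rewrite (@nneseriesD1 _ _ n)//; last by move=> k _; rewrite lee_fin.
    by rewrite vnn leeDl// nneseries_ge0// => m _ _; rewrite lee_fin.
  move: sv sv0 sv1; move Wx : (\sum_(0 <= m <oo) (v n m)%:E)%E => We; case: We Wx => [W| |]// Wx.
  rewrite !lee_fin => WS W0 W1.
  rewrite (_ : E n = win (v n) n); last by apply/seteqP; split => x; [case|split].
  rewrite (race_win v0 vnn Wx) lee_fin -invf_div lef_pV2 ?posrE//.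
    by rewrite divr_gt0.
  exact: lt_le_trans W1.
have PUE : ((M / S)%:E <= P (\bigcup_n E n))%E.
  rewrite measure_semi_bigcup//; last exact: bigcupT_measurable.
  rewrite -(@sum_scale mi _ M) ?invr_ge0 ?(ltW S0)//.
  by apply: lee_nneseries => [m _ _|m _]; rewrite ?lee_fin ?mulr_ge0 ?invr_ge0 ?(ltW S0)//;
    exact: PE.
apply: (@le_trans _ _ (P (~` \bigcup_n E n))).
  apply: le_measure; rewrite ?inE//; first by apply: measurableC; exact: bigcupT_measurable.
  by move=> x /= h [n _ /Ep[h1 h2]]; apply: h; rewrite (sampler_wins h1) (sampler_wins h2).
rewrite probability_setC; last exact: bigcupT_measurable.
apply: (@le_trans _ _ (1 - (M / S)%:E)%E); first by rewrite leeB.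
rewrite -EFinB lee_fin.
have -> : 1 - M / S = (S - M) / S by field; rewrite gt_eqF.
rewrite ler_pdivrMr// ler_peMr//.
lra.
Qed.

End race.
End iid.

(** * Laws of words induced by kernels *)

Section dist.
Context (R : realType) d (T : measurableType d).
Local Open Scope ereal_scope.

Lemma le_dist_integral (Q : {measure set T -> \bar R}) (f g : T -> R) :
  measurable_fun setT f -> measurable_fun setT g -> (forall x, 0 <= f x)%R ->
    (forall x, 0 <= g x)%R ->
  \int[Q]_x (f x)%:E < +oo -> \int[Q]_x (g x)%:E < +oo ->
  `|fine (\int[Q]_x (f x)%:E) - fine (\int[Q]_x (g x)%:E)|%:E <= \int[Q]_x `|f x - g x|%:E.
Proof.
move=> mf mg f0 g0.
have mE (h : T -> R) : measurable_fun setT h -> measurable_fun setT (EFin \o h) by move=> mh;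
  exact/measurable_EFinP.
have mabs : measurable_fun setT (fun x => `|f x - g x|%:E).
  by apply: (mE (fun x => `|f x - g x|%R)); apply: measurableT_comp => //; exact: measurable_funB.
have I0 (h : T -> R) : (forall x, 0 <= h x)%R -> 0 <= \int[Q]_x (h x)%:E.
  by move=> h0; apply: integral_ge0 => x _; rewrite lee_fin.
have key (h1 h2 : T -> R) : measurable_fun setT h1 -> measurable_fun setT h2 ->
  (forall x, 0 <= h1 x)%R -> (forall x, 0 <= h2 x)%R ->
    (forall x, `|h1 x - h2 x|%R = `|f x - g x|%R) ->
    \int[Q]_x (h1 x)%:E <= \int[Q]_x (h2 x)%:E + \int[Q]_x `|f x - g x|%:E.
  move=> m1 m2 p1 p2 e; rewrite -ge0_integralD//; [|by [move=> x _; rewrite lee_fin|exact: mE]..].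
  apply: ge0_le_integral => //; [by move=> x _; rewrite lee_fin|exact: mE|by apply: emeasurable_funD
    => //; exact: mE|].
  by move=> x _; rewrite -EFinD lee_fin -e -lerBlDl ler_norm.
have k1 := key f g mf mg f0 g0 (fun=> erefl).
have k2 := key g f mg mf g0 f0 (fun x => distrC _ _).
move: k1 k2 (I0 _ f0) (I0 _ g0); case: (\int[Q]_x (f x)%:E) => [a| |]//; case: (\int[Q]_x (g x)%:E)
  => [b| |]//.
case: (\int[Q]_x `|f x - g x|%:E) => [c| |]//=; rewrite ?leey//.
by rewrite -!EFinD !lee_fin ler_norml => h1 h2 _ _ _ _; lra.
Qed.

Lemma integral_bounded_lty (Q : probability T R) (f : T -> R) (M : R) : measurable_fun setT f ->
  (forall x, 0 <= f x <= M)%R ->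
  \int[Q]_x (f x)%:E < +oo.
Proof.
move=> mf f01; apply: (@le_lt_trans _ _ (\int[Q]_x (cst M%:E x))); last first.
  by rewrite integral_cst//= probability_setT mule1 ltry.
apply: ge0_le_integral => //.
- by move=> x _; rewrite lee_fin; case/andP: (f01 x).
- exact/measurable_EFinP.
- by move=> x _; rewrite lee_fin; case/andP: (f01 x).
Qed.

End dist.

Section kernels.
Context (R : realType) d (T : measurableType d).
Local Open Scope ereal_scope.

(** Conditional mass of the word [s] given the point [x]: given [x], the symbols of the successive
    levels are independent. *)
Definition prodk (k : nat -> nat -> T -> R) (s : seq nat) (x : T) : R :=
  (\prod_(i < size s) k i (nth 0%N s i) x)%R.

Lemma prodk_nil k x : prodk k [::] x = 1%R.
Proof. by rewrite /prodk big_ord0. Qed.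

Lemma prodk_rcons k s n x : prodk k (rcons s n) x = (prodk k s x * k (size s) n x)%R.
Proof.
rewrite /prodk size_rcons big_ord_recr/= nth_rcons ltnn eqxx; congr (_ * _)%R.
by apply: eq_bigr => i _; rewrite nth_rcons ltn_ord.
Qed.

Lemma prodk_cat k z s x : prodk k (z ++ s) x = (prodk k z x * prodk (fun i =>
  k (size z + i)%N) s x)%R.
Proof.
elim/last_ind: s => [|s n IH]; first by rewrite cats0 prodk_nil mulr1.
by rewrite -rcons_cat !prodk_rcons IH size_cat mulrA.
Qed.

Record kernel_family (k : nat -> nat -> T -> R) : Prop := KernelFamily {
  kf_meas : forall i n, measurable_fun setT (k i n);
  kf_ge0 : forall i n x, (0 <= k i n x)%R;
  kf_sum : forall i x, \sum_(0 <= n <oo) (k i n x)%:E = 1 }.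

Section family.
Context (k : nat -> nat -> T -> R) (kf : kernel_family k).

Lemma prodk_ge0 s x : (0 <= prodk k s x)%R.
Proof. by apply: prodr_ge0 => i _; exact: kf_ge0. Qed.

Lemma k_le1 i n x : (k i n x <= 1)%R.
Proof.
rewrite -lee_fin -(kf_sum kf i x) (@nneseriesD1 _ _ n)//; last by move=> *; rewrite lee_fin kf_ge0.
by rewrite leeDl// nneseries_ge0// => m _ _; rewrite lee_fin kf_ge0.
Qed.

Lemma prodk_le1 s x : (prodk k s x <= 1)%R.
Proof. by apply: prodr_ile1 => i _; rewrite kf_ge0// k_le1. Qed.

Lemma measurable_prodk s : measurable_fun setT (prodk k s).
Proof. by apply: measurable_prod => i _; exact: kf_meas. Qed.

Lemma sum_prodk_rcons s x : \sum_(0 <= n <oo) (prodk k (rcons s n) x)%:E = (prodk k s x)%:E.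
Proof.
under eq_eseriesr do rewrite prodk_rcons EFinM.
by rewrite nneseriesZl ?kf_sum ?mule1// => n _; rewrite lee_fin kf_ge0.
Qed.

Lemma tsum_prodk t x : tsum t (fun s => (prodk k s x)%:E) = 1.
Proof.
elim: t => [|t IH] /=; first by rewrite prodk_nil.
by rewrite -[RHS]IH; apply: eq_tsum => s _; rewrite sum_prodk_rcons.
Qed.

Lemma tsum_prodk_diff_le2 t x y : tsum t (fun s => `|prodk k s x - prodk k s y|%:E) <= (2:R)%:E.
Proof.
apply: (@le_trans _ _ (tsum t (fun s => (prodk k s x)%:E + (prodk k s y)%:E))).
  apply: le_tsum => s _; first by rewrite lee_fin.
  rewrite -EFinD lee_fin; apply: le_trans (ler_normB _ _) _.
  by rewrite !ger0_norm ?prodk_ge0.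
rewrite tsumD; [|by move=> s; rewrite lee_fin prodk_ge0..].
by rewrite !tsum_prodk -EFinD.
Qed.

(** The factors are exchanged one by one: [|p * k - p' * k'| <= |p - p'| * k + p' * |k - k'|], and
    summing out the next symbol turns [k] into 1. *)
Lemma tsum_prodk_diff t x y (del : nat -> R) :
  (forall i, \sum_(0 <= n <oo) `|k i n x - k i n y|%:E <= (del i)%:E) ->
  tsum t (fun s => `|prodk k s x - prodk k s y|%:E) <= (\sum_(i < t) del i)%:E.
Proof.
move=> hdel; elim: t => [|t IH] /=; first by rewrite !prodk_nil subrr normr0 big_ord0.
apply: (@le_trans _ _ (tsum t (fun s => `|prodk k s x - prodk k s y|%:E + (del t)%:E *
  (prodk k s y)%:E))).
  apply: le_tsum => s st; first by apply: nneseries_ge0 => n _ _; rewrite lee_fin.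
  apply: (@le_trans _ _ (\sum_(0 <= n <oo) ((`|prodk k s x - prodk k s y| * k t n x)%:E +
    (prodk k s y * `|k t n x - k t n y|)%:E))).
    apply: lee_nneseries => [n _ _|n _]; first by rewrite lee_fin.
    rewrite -EFinD lee_fin !prodk_rcons st.
    have -> : (`|prodk k s x - prodk k s y| * k t n x = `|(prodk k s x - prodk k s y) * k t n x|)%R.
      by rewrite normrM (ger0_norm (kf_ge0 kf t n x)).
    have -> : (prodk k s y * `|k t n x - k t n y| = `|prodk k s y * (k t n x - k t n y)|)%R.
      by rewrite normrM (ger0_norm (prodk_ge0 s y)).
    apply: le_trans (ler_normD _ _).
    by apply: le_of_eq; congr `|_|%R; ring.
  rewrite nneseriesD; [|by move=> *; rewrite lee_fin mulr_ge0// ?kf_ge0 ?prodk_ge0..].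
  apply: leeD.
    under eq_eseriesr do rewrite EFinM.
    by rewrite nneseriesZl ?kf_sum ?mule1// => n _; rewrite lee_fin kf_ge0.
  under eq_eseriesr do rewrite EFinM.
  rewrite nneseriesZl; last by move=> n _; rewrite lee_fin.
  by rewrite muleC; apply: lee_wpmul2r => //; rewrite lee_fin prodk_ge0.
have d0 : (0 <= del t)%R.
  by rewrite -lee_fin; apply: le_trans (hdel t); apply: nneseries_ge0 => n _ _; rewrite lee_fin.
rewrite tsumD; [|by move=> s; rewrite lee_fin ?mulr_ge0// ?prodk_ge0..].
rewrite tsumZl//; last by move=> s; rewrite lee_fin prodk_ge0.
by rewrite tsum_prodk mule1 big_ord_recr EFinD; apply: leeD.
Qed.

Section law.
Context (Q : probability T R).

Definition wlaw (s : seq nat) : R := fine (\int[Q]_x (prodk k s x)%:E).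

Lemma wlawE s : (wlaw s)%:E = \int[Q]_x (prodk k s x)%:E.
Proof.
rewrite /wlaw fineK// ge0_fin_numE; last by apply: integral_ge0 => x _; rewrite lee_fin prodk_ge0.
apply: (@integral_bounded_lty _ _ _ _ _ 1%R); first exact: measurable_prodk.
by move=> x; rewrite prodk_ge0 prodk_le1.
Qed.

Lemma wlaw_tree : tree_law wlaw.
Proof.
split.
- by move=> s; apply: fine_ge0; apply: integral_ge0 => x _; rewrite lee_fin prodk_ge0.
- rewrite /wlaw; under eq_integral do rewrite prodk_nil.
  by rewrite integral_cst//= probability_setT mule1.
- move=> s; under eq_eseriesr do rewrite wlawE.
  rewrite -integral_nneseries//.
  + by rewrite wlawE; apply: eq_integral => x _; rewrite sum_prodk_rcons.
  + by move=> n; apply/measurable_EFinP; exact: measurable_prodk.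
  + by move=> n x _; rewrite lee_fin prodk_ge0.
Qed.

End law.

Section coupled.
Context (Q Q' : probability T R) d' (Om' : measurableType d') (P' : probability Om' R)
  (X Y : Om' -> T).
Context (mX : measurable_fun setT X) (mY : measurable_fun setT Y).
Context (XQ : forall A, measurable A -> P' (X @^-1` A) = Q A) (YQ : forall A, measurable A ->
  P' (Y @^-1` A) = Q' A).

(** An arbitrary coupling of the two laws enters here: both mixtures are integrated over its space,
    and the norm is moved inside the integral. *)
Lemma tsum_wlaw_diff t : tsum t (fun s => `|wlaw Q s - wlaw Q' s|%:E) <=
  \int[P']_w tsum t (fun s => `|prodk k s (X w) - prodk k s (Y w)|%:E).
Proof.
have mkX s : measurable_fun setT (fun w => prodk k s (X w)) by move: (measurableT_comp
  (measurable_prodk s) mX).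
have mkY s : measurable_fun setT (fun w => prodk k s (Y w)) by move: (measurableT_comp
  (measurable_prodk s) mY).
rewrite (@integral_tsum _ _ _ P' t (fun s w => `|prodk k s (X w) - prodk k s (Y w)|%:E));
  last 2 first.
- move=> s; apply/measurable_EFinP; apply: measurableT_comp => //; exact: measurable_funB.
- by move=> s w; rewrite lee_fin.
apply: le_tsum => s st; first by rewrite lee_fin.
have chg (q : probability T R) (Z : Om' -> T) : measurable_fun setT Z -> (forall A, measurable A ->
  P' (Z @^-1` A) = q A) ->
    \int[q]_x (prodk k s x)%:E = \int[P']_w (prodk k s (Z w))%:E.
  move=> mZ Zq; transitivity (\int[push P' mZ]_x (prodk k s x)%:E).
    by apply: eq_measure_integral => A mA _; rewrite /= -Zq.
  rewrite ge0_integral_pushforward// ?preimage_setT//.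
    by apply/measurable_EFinP; exact: measurable_prodk.
  by move=> x _; rewrite lee_fin prodk_ge0.
rewrite /wlaw (chg Q X)// (chg Q' Y)//; apply: le_dist_integral => //.
- by move=> w; exact: prodk_ge0.
- by move=> w; exact: prodk_ge0.
- by apply: (@integral_bounded_lty _ _ _ _ _ 1%R) => // x; rewrite prodk_ge0 prodk_le1.
- by apply: (@integral_bounded_lty _ _ _ _ _ 1%R) => // x; rewrite prodk_ge0 prodk_le1.
Qed.
End coupled.
End family.

(* Words of length [m] drawn before the levels of [k] barely influence what comes after them. *)
Section prefix.
Context (k k' : nat -> nat -> T -> R) (kf : kernel_family k) (kf' : kernel_family k') (m : nat).
Context (kk : forall i, k' (m + i)%N = k i).
Context (Q : probability T R) (t : nat) (phi : T -> R) (M : R).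
Context (mphi : measurable_fun setT phi) (phi0 : forall x, (0 <= phi x <= M)%R).
Context (hphi : forall s x y, size s = t -> (0 < prodk k s x)%R -> (0 < prodk k s y)%R ->
  tsum m (fun z => `|prodk k' z x - prodk k' z y|%:E) <= (phi x + phi y)%:E).

(** The quotient is the conditional mass of the prefix [z] given [s]. Thus [term] measures the
    failure of conditional independence, given [s], between the prefix and the next symbol. *)
Let term s z n : R := `|wlaw k' Q (z ++ rcons s n) - wlaw k' Q (z ++ s) / wlaw k Q s * wlaw k Q
  (rcons s n)|%R.

Let prodk_cat' z s x : size z = m -> prodk k' (z ++ s) x = (prodk k' z x * prodk k s x)%R.
Proof. by move=> zm; rewrite prodk_cat zm; congr (_ * prodk _ s x)%R; apply/funext => i;
  exact: kk. Qed.

Let wlaw_sub z s : size z = m -> (wlaw k' Q (z ++ s) <= wlaw k Q s)%R.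
Proof.
move=> zm; rewrite -lee_fin !wlawE//; apply: ge0_le_integral => //.
- by move=> x _; rewrite lee_fin prodk_ge0.
- by apply/measurable_EFinP; exact: measurable_prodk.
- by apply/measurable_EFinP; exact: measurable_prodk.
- by move=> x _; rewrite lee_fin prodk_cat'// ler_piMl ?prodk_ge0 ?prodk_le1.
Qed.

(** Given [s], the point has density [prodk k s / wlaw k Q s] with respect to [Q], and [c z] is the
    mean of [prodk k' z] under it. Two points compatible with [s] have prefix laws within
    [phi x + phi y]; averaging over both points gives twice the mean of [phi]. *)
Lemma prefix_influence_word s : size s = t ->
  tsum m (fun z => \sum_(0 <= n <oo) (term s z n)%:E) <= (2:R)%:E * \int[Q]_x (phi x * prodk
    k s x)%:E.
Proof.
move=> st.
have mps : measurable_fun setT (fun x => phi x * prodk k s x)%R by apply: measurable_funM => //;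
  exact: measurable_prodk.
have ps0 x : (0 <= phi x * prodk k s x <= M)%R.
  case/andP: (phi0 x) => p0 pM; rewrite mulr_ge0 ?prodk_ge0//=.
  by apply: le_trans pM; rewrite ler_piMr// prodk_le1.
have I0 : 0 <= \int[Q]_x (phi x * prodk k s x)%:E.
  by apply: integral_ge0 => x _; rewrite lee_fin; case/andP: (ps0 x).
have [W0 _ _] := wlaw_tree kf Q; have [W0' _ _] := wlaw_tree kf' Q.
have [b0|b0] := eqVneq (wlaw k Q s) 0%R.
  apply: (@le_trans _ _ 0); last by rewrite mule_ge0// lee_fin.
  have -> : tsum m (fun z => \sum_(0 <= n <oo) (term s z n)%:E) = tsum m (fun z => (0:R)%:E * 0).
    apply: eq_tsum => z zm; rewrite mule0; apply: eseries0 => n _ _.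
    have e1 : wlaw k Q (rcons s n) = 0%R.
      by apply/le_anti; rewrite W0 andbT -b0; apply: tree_law_sub; exact: wlaw_tree.
    have e2 : wlaw k' Q (z ++ rcons s n) = 0%R.
      by apply/le_anti; rewrite W0' andbT -e1; exact: wlaw_sub.
    by rewrite /term e1 e2 mulr0 subr0 normr0.
  by rewrite tsumZl// mul0e.
have bp : (0 < wlaw k Q s)%R by rewrite lt_neqAle eq_sym b0 W0.
pose c z := (wlaw k' Q (z ++ s) / wlaw k Q s)%R.
have c0 z : (0 <= c z)%R by rewrite divr_ge0.
have c1 z : size z = m -> (c z <= 1)%R by move=> zm; rewrite ler_pdivrMr// mul1r wlaw_sub.
have mh z : measurable_fun setT (fun x => `|prodk k' z x - c z|)%R.
  apply: measurableT_comp => //; apply: measurable_funB => //; exact: measurable_prodk.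
have mhn z : measurable_fun setT (fun x => `|prodk k' z x - c z| * prodk k s x)%R.
  by apply: measurable_funM => //; exact: measurable_prodk.
(* Both members of [term] are integrals against [prodk k (rcons s n)]; summing over [n] after taking
   absolute values leaves [prodk k s]. *)
have stepA z : size z = m -> \sum_(0 <= n <oo) (term s z n)%:E <= \int[Q]_x (`|prodk k' z x - c z| *
  prodk k s x)%:E.
  move=> zm.
  have -> : \int[Q]_x (`|prodk k' z x - c z| * prodk k s x)%:E =
      \sum_(0 <= n <oo) \int[Q]_x (`|prodk k' z x - c z| * prodk k (rcons s n) x)%:E.
    rewrite -integral_nneseries//.
    - apply: eq_integral => x _; under eq_eseriesr do rewrite EFinM.
      rewrite nneseriesZl; last by move=> n _; rewrite lee_fin prodk_ge0.
      by rewrite sum_prodk_rcons.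
    - by move=> n; apply/measurable_EFinP/measurable_funM => //; exact: measurable_prodk.
    - by move=> n x _; rewrite lee_fin mulr_ge0// prodk_ge0.
  apply: lee_nneseries => [n _ _|n _]; first by rewrite lee_fin; exact: normr_ge0.
  have -> : term s z n = `|fine (\int[Q]_x (prodk k' (z ++ rcons s n) x)%:E) -
    fine (\int[Q]_x (c z * prodk k (rcons s n) x)%:E)|%R.
    congr (`|_ - _|)%R; under eq_integral do rewrite EFinM.
    rewrite ge0_integralZl_EFin//.
    - by rewrite -wlawE.
    - by move=> x _; rewrite lee_fin prodk_ge0.
    - by apply/measurable_EFinP; exact: measurable_prodk.
  have cp x : (0 <= c z * prodk k (rcons s n) x <= 1)%R.
    by rewrite mulr_ge0 ?prodk_ge0//= mulr_ile1 ?prodk_ge0 ?prodk_le1 ?c1.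
  apply: le_trans (le_dist_integral _ _ _ _ _ _) _.
  - exact: measurable_prodk.
  - by apply: measurable_funM => //; exact: measurable_prodk.
  - by move=> x; exact: prodk_ge0.
  - by move=> x; case/andP: (cp x).
  - apply: (@integral_bounded_lty _ _ _ _ _ 1%R); first exact: measurable_prodk.
    by move=> x; rewrite prodk_ge0 ?prodk_le1.
  - apply: (@integral_bounded_lty _ _ _ _ _ 1%R) => //.
    by apply: measurable_funM => //; exact: measurable_prodk.
  apply: le_of_eq; apply: eq_integral => x _.
  by rewrite prodk_cat'// -mulrBl normrM (ger0_norm (prodk_ge0 kf _ _)).
apply: (@le_trans _ _ (tsum m (fun z => \int[Q]_x (`|prodk k' z x - c z| * prodk k s x)%:E))).
  by apply: le_tsum => z zm; [apply: nneseries_ge0 => n _ _; rewrite lee_fin;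
    exact: normr_ge0|exact: stepA].
rewrite -(@integral_tsum _ _ _ Q m (fun z x => (`|prodk k' z x - c z| * prodk k s x)%:E));
  last 2 first.
- by move=> z; apply/measurable_EFinP.
- by move=> z x; rewrite lee_fin mulr_ge0// prodk_ge0.
move: I0; case Ix : (\int[Q]_x (phi x * prodk k s x)%:E) => [I| |] I0; last 2 first.
- by have := @integral_bounded_lty _ _ _ Q _ M mps ps0; rewrite Ix.
- by [].
(* [c z] is written as an average over [y], and [hphi] is applied to [x] and [y]. Points [y] with
   [prodk k s y = 0] do not contribute. *)
have stepB x : (0 < prodk k s x)%R -> tsum m (fun z => `|prodk k' z x - c z|%:E) <=
  (phi x + I / wlaw k Q s)%:E.
  move=> sx.
  have step1 z : size z = m -> `|prodk k' z x - c z|%:E <=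
      ((wlaw k Q s)^-1)%:E * \int[Q]_y (`|prodk k' z x - prodk k' z y| * prodk k s y)%:E.
    move=> zm.
    have -> : (`|prodk k' z x - c z| = (wlaw k Q s)^-1 * `|prodk k' z x * wlaw k Q s - wlaw k' Q
      (z ++ s)|)%R.
      rewrite -[X in (X * `|_|)%R]gtr0_norm ?invr_gt0// -normrM /c; congr `|_|%R; by field.
    rewrite EFinM; apply: lee_wpmul2l; first by rewrite lee_fin invr_ge0 ltW.
    have -> : (prodk k' z x * wlaw k Q s)%R = fine (\int[Q]_y (prodk k' z x * prodk k s y)%:E).
      under eq_integral do rewrite EFinM.
      rewrite ge0_integralZl_EFin//.
      - by rewrite -wlawE.
      - by move=> y _; rewrite lee_fin prodk_ge0.
      - by apply/measurable_EFinP; exact: measurable_prodk.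
      - exact: prodk_ge0.
    apply: le_trans (le_dist_integral _ _ _ _ _ _) _.
    - by apply: measurable_funM => //; exact: measurable_prodk.
    - exact: measurable_prodk.
    - by move=> y; rewrite mulr_ge0 ?prodk_ge0.
    - by move=> y; exact: prodk_ge0.
    - apply: (@integral_bounded_lty _ _ _ _ _ 1%R).
        by apply: measurable_funM => //; exact: measurable_prodk.
      by move=> y; rewrite mulr_ge0 ?mulr_ile1 ?prodk_ge0 ?prodk_le1.
    - apply: (@integral_bounded_lty _ _ _ _ _ 1%R); first exact: measurable_prodk.
      by move=> y; rewrite prodk_ge0 ?prodk_le1.
    apply: le_of_eq; apply: eq_integral => y _.
    by rewrite prodk_cat'// -mulrBl normrM (ger0_norm (prodk_ge0 kf _ _)).
  have mzy z : measurable_fun setT (fun y => `|prodk k' z x - prodk k' z y| * prodk k s y)%R.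
    apply: measurable_funM; last exact: measurable_prodk.
    by apply: measurableT_comp => //; apply: measurable_funB => //; exact: measurable_prodk.
  apply: le_trans (le_tsum _ step1) _; first by move=> z _; rewrite lee_fin.
  rewrite tsumZl; last 2 first.
  - by rewrite invr_ge0 ltW.
  - by move=> z; apply: integral_ge0 => y _; rewrite lee_fin mulr_ge0// prodk_ge0.
  rewrite -(@integral_tsum _ _ _ Q m (fun z y => (`|prodk k' z x - prodk k' z y| * prodk k s
    y)%:E)); last 2 first.
  - by move=> z; apply/measurable_EFinP.
  - by move=> z y; rewrite lee_fin mulr_ge0// prodk_ge0.
  apply: (@le_trans _ _ (((wlaw k Q s)^-1)%:E * \int[Q]_y ((phi x * prodk k s y)%:E +
    (phi y * prodk k s y)%:E))).
    apply: lee_wpmul2l; first by rewrite lee_fin invr_ge0 ltW.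
    apply: ge0_le_integral => //.
    - by move=> y _; apply: tsum_ge0 => z _; rewrite lee_fin mulr_ge0// prodk_ge0.
    - apply: (@measurable_tsum _ _ _ m (fun z y => (`|prodk k' z x - prodk k' z y| * prodk k
      s y)%:E)).
        by move=> z; apply/measurable_EFinP.
      by move=> z y; rewrite lee_fin mulr_ge0// prodk_ge0.
    - apply: emeasurable_funD; apply/measurable_EFinP => //.
      by apply: measurable_funM => //; exact: measurable_prodk.
    - move=> y _; have [sy|sy] := eqVneq (prodk k s y) 0%R.
        rewrite sy !mulr0 adde0; have -> : tsum m (fun z => (`|prodk k' z x - prodk k' z y| * 0)%:E)
          = tsum m (fun z => (0:R)%:E * 0).
          by apply: eq_tsum => z _; rewrite mulr0 mule0.
        by rewrite tsumZl// mul0e.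
      have syp : (0 < prodk k s y)%R by rewrite lt_neqAle eq_sym sy prodk_ge0.
      rewrite -EFinD -mulrDl EFinM muleC.
      under [X in tsum _ X]eq_fun do rewrite mulrC EFinM.
      rewrite tsumZl ?prodk_ge0//.
      by apply: lee_wpmul2l; [rewrite lee_fin ltW|exact: (hphi st sx syp)].
  rewrite ge0_integralD//; last 4 first.
  - by move=> y _; rewrite lee_fin mulr_ge0 ?prodk_ge0//; case/andP: (phi0 x).
  - by apply/measurable_EFinP; apply: measurable_funM => //; exact: measurable_prodk.
  - by move=> y _; rewrite lee_fin; case/andP: (ps0 y).
  - exact/measurable_EFinP.
  under eq_integral do rewrite EFinM.
  rewrite ge0_integralZl_EFin//; last 3 first.
  - by move=> y _; rewrite lee_fin prodk_ge0.
  - by apply/measurable_EFinP; exact: measurable_prodk.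
  - by case/andP: (phi0 x).
  rewrite -(wlawE kf Q s) Ix -!(EFinM,EFinD) lee_fin; apply: le_of_eq; by field.
apply: (@le_trans _ _ (\int[Q]_x ((phi x * prodk k s x)%:E + (I / wlaw k Q s * prodk k s x)%:E))).
  apply: ge0_le_integral => //.
  - by move=> y _; apply: tsum_ge0 => z _; rewrite lee_fin mulr_ge0// prodk_ge0.
  - apply: (@measurable_tsum _ _ _ m (fun z y => (`|prodk k' z y - c z| * prodk k s y)%:E)).
      by move=> z; apply/measurable_EFinP.
    by move=> z y; rewrite lee_fin mulr_ge0// prodk_ge0.
  - apply: emeasurable_funD; apply/measurable_EFinP => //.
    by apply: measurable_funM => //; exact: measurable_prodk.
  - move=> y _; have [sy|sy] := eqVneq (prodk k s y) 0%R.
      rewrite sy !mulr0 adde0; have -> : tsum m (fun z => (`|prodk k' z y - c z| * 0)%:E) = tsum m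
        (fun z => (0:R)%:E * 0).
        by apply: eq_tsum => z _; rewrite mulr0 mule0.
      by rewrite tsumZl// mul0e.
    have syp : (0 < prodk k s y)%R by rewrite lt_neqAle eq_sym sy prodk_ge0.
    rewrite -EFinD -mulrDl EFinM muleC.
    under [X in tsum _ X]eq_fun do rewrite mulrC EFinM.
    rewrite tsumZl ?prodk_ge0//.
    by apply: lee_wpmul2l; [rewrite lee_fin ltW|exact: stepB].
have Ib : (0 <= I / wlaw k Q s)%R by rewrite divr_ge0 ?(ltW bp)// -lee_fin.
rewrite ge0_integralD//; last 4 first.
- by move=> y _; rewrite lee_fin; case/andP: (ps0 y).
- exact/measurable_EFinP.
- by move=> y _; rewrite lee_fin mulr_ge0 ?prodk_ge0.
- by apply/measurable_EFinP; apply: measurable_funM => //; exact: measurable_prodk.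
under [X in _ + X]eq_integral do rewrite EFinM.
rewrite ge0_integralZl_EFin//; last 2 first.
- by move=> y _; rewrite lee_fin prodk_ge0.
- by apply/measurable_EFinP; exact: measurable_prodk.
rewrite -(wlawE kf Q s) Ix -!(EFinM,EFinD) lee_fin; apply: le_of_eq; by field.
Qed.

Lemma prefix_influence :
  tsum t (fun s => tsum m (fun z => \sum_(0 <= n <oo) (term s z n)%:E)) <= (2:R)%:E * \int[Q]_x
    (phi x)%:E.
Proof.
apply: le_trans (le_tsum _ prefix_influence_word) _.
  by move=> s _; apply: tsum_ge0 => z _; apply: nneseries_ge0 => n _ _; rewrite lee_fin;
    exact: normr_ge0.
have p0 x : (0 <= phi x)%R by case/andP: (phi0 x).
rewrite tsumZl//; last first.
  by move=> s; apply: integral_ge0 => x _; rewrite lee_fin mulr_ge0// prodk_ge0.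
rewrite -(@integral_tsum _ _ _ Q t (fun s x => (phi x * prodk k s x)%:E)); last 2 first.
- by move=> s; apply/measurable_EFinP; apply: measurable_funM => //; exact: measurable_prodk.
- by move=> s x; rewrite lee_fin mulr_ge0// prodk_ge0.
apply: le_of_eq; congr (_ * _); apply: eq_integral => x _.
under [X in tsum _ X]eq_fun do rewrite EFinM.
by rewrite tsumZl ?tsum_prodk ?mule1// => s; rewrite lee_fin prodk_ge0.
Qed.

End prefix.
End kernels.

(** * Probability measures on metric spaces *)

Section metric.
Context (R : realType) (X : completeMetricType R).

Definition thick (F : set X) (e : R) : set X := \bigcup_(y in F) ball y e.

Lemma open_thick F e : open (thick F e).
Proof.
apply: bigcup_open => y _; rewrite openE => z; rewrite ballEmdist /= => yz.
rewrite /interior -nbhs_ballE; exists (e - mdist y z) => /=; first by rewrite subr_gt0.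
move=> u; rewrite !ballEmdist /= => zu; apply: le_lt_trans (metric_triangle _ z _) _; lra.
Qed.

Lemma thickP F e x : thick F e x <-> exists2 y, F y & mdist y x < e.
Proof. by rewrite /thick; split=> [[y Fy]|[y Fy h]]; [rewrite ballEmdist /= => h; exists y|exists y;
  rewrite ?ballEmdist]. Qed.

Lemma sub_thick (F : set X) e : 0 < e -> F `<=` thick F e.
Proof. by move=> e0 x Fx; apply/thickP; exists x => //; rewrite mdistxx. Qed.

Lemma thick_trans (F : set X) a b x y : thick F a x -> mdist x y < b -> thick F (a + b) y.
Proof.
move=> /thickP[z Fz zx] xy; apply/thickP; exists z => //.
by rewrite (le_lt_trans (metric_triangle _ x _))// ltrD.
Qed.

Lemma le_thick (F : set X) a b : a <= b -> thick F a `<=` thick F b.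
Proof. by move=> ab x /thickP[y Fy yx]; apply/thickP; exists y => //; exact: lt_le_trans ab. Qed.

Lemma closed_thick (F : set X) (e : nat -> R) : closed F -> e @ \oo --> 0 -> (forall n, 0 < e n) ->
  \bigcap_n thick F (e n) = F.
Proof.
move=> cF e0 ep; apply/seteqP; split => x; last by move=> Fx n _; exact: sub_thick.
move=> h; apply: cF => U; rewrite -nbhs_ballE => -[/= d d0 dU].
have /cvgrPdist_lt/(_ _ d0)[n _ /(_ n (leqnn n))] := e0.
rewrite /= sub0r normrN gtr0_norm// => en.
have /thickP[y Fy yx] := h n I; exists y; split => //; apply: dU.
by rewrite ballEmdist /= metric_sym (lt_trans yx).
Qed.

Lemma measurable_open (A : set X) : open A -> measurable (A : set (borel X)).
Proof. by move=> oA; apply: sub_sigma_algebra. Qed.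

Lemma measurable_closed (A : set X) : closed A -> measurable (A : set (borel X)).
Proof. by move=> cA; rewrite -(setCK A); apply: measurableC; apply: measurable_open;
  exact: closed_openC. Qed.

Lemma measurable_borel_fun d (Om : measurableType d) (f : Om -> borel X) :
  (forall F : set X, closed F -> measurable (f @^-1` F)) -> measurable_fun setT f.
Proof.
move=> h; apply: (@measurability _ _ Om (borel X) setT f open) => // _ [A oA <-].
rewrite setTI -(setCK A) preimage_setC; apply: measurableC.
exact: (h (~` A) (open_closedC oA)).
Qed.

(** Complements turn the inequality into the reverse one on open sets. A closed set is the
    decreasing intersection of its open neighbourhoods, which gives equality on closed sets, hence
    on open sets, which generate. *)
Lemma eq_borel_prob (P Q : {measure set (borel X) -> \bar R}) : P setT = 1%E -> Q setT = 1%E ->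
  (forall F : set X, closed F -> (P F <= Q F)%E) -> forall A : set (borel X), measurable A ->
    P A = Q A.
Proof.
move=> P1 Q1 PQ A mA.
have fin (m : {measure set (borel X) -> \bar R}) (B : set (borel X)) : m setT = 1%E ->
  measurable B -> (m B \is a fin_num).
  by move=> m1 mB; rewrite ge0_fin_numE// (@le_lt_trans _ _ 1%E) ?ltry// -m1 le_measure ?inE.
have C (m : {measure set (borel X) -> \bar R}) (B : set (borel X)) : m setT = 1%E -> measurable B ->
  m (~` B) = (1 - m B)%E.
  move=> m1 mB; have -> : ~` B = [set: borel X] `\` B by rewrite setTD.
  have lt : (m [set: borel X] < +oo)%E by rewrite m1 ltry.
  have := measureD measurableT mB lt; rewrite setTI => ->.
  by congr (_ - _)%E.
have opn (O : set X) : open O -> (Q O <= P O)%E.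
  move=> oO; have cO := open_closedC oO; have := PQ _ cO.
  have mO := measurable_open oO.
  rewrite !C//; move: (fin P O P1 mO) (fin Q O Q1 mO); case: (P O) => [p| |]// _; case: (Q O) =>
    [q| |]// _.
  by rewrite -!EFinB !lee_fin; lra.
have cls (F : set X) : closed F -> P F = Q F.
  move=> cF; apply/eqP; rewrite eq_le PQ//=.
  have e0 : (fun n => (n.+1%:R^-1 : R)) @ \oo --> 0 by exact: cvg_harmonic.
  have ep n : 0 < n.+1%:R^-1 :> R by rewrite invr_gt0.
  have mt n : measurable (thick F n.+1%:R^-1 : set (borel X)) by apply: measurable_open;
    exact: open_thick.
  have cP : (P \o (fun n => thick F n.+1%:R^-1)) @ \oo --> P (\bigcap_n thick F n.+1%:R^-1).
    apply: nonincreasing_cvg_mu => //.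
    - by rewrite -ge0_fin_numE// fin.
    - by rewrite closed_thick//; exact: measurable_closed.
    - by move=> m n mn; apply/subsetPset; apply: le_thick; rewrite lef_pV2 ?posrE// ler_nat.
  rewrite -(closed_thick cF e0 ep); rewrite -(cvg_lim _ cP)//.
  apply: lime_ge; first by apply/cvg_ex; exists (P (\bigcap_n thick F n.+1%:R^-1)).
  apply: nearW => n /=; apply: le_trans (opn _ (open_thick _ _)).
  apply: le_measure; rewrite ?inE//; first by rewrite closed_thick//; exact: measurable_closed.
  by move=> x; apply.
apply: (@measure_unique _ R (borel X) open (fun=> setT) _ _ _ _ P Q) => //.
- by move=> U V; exact: openI.
- by move=> _; exact: openT.
- by rewrite bigcup_const.
- move=> O oO; have cO := open_closedC oO; have := cls _ cO.
  have mO := measurable_open oO.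
  rewrite !C//; move: (fin P O P1 mO) (fin Q O Q1 mO); case: (P O) => [p| |]// _; case: (Q O) =>
    [q| |]// _.
  by rewrite -!EFinB => -[pq]; congr EFin; lra.
- by move=> _; rewrite P1 ltry.
Qed.

End metric.

(** * Sequences of random variables that become eventually constant *)

Section eventual.
Context (R : realType) d (Om : measurableType d) (P : probability Om R) d' (T : measurableType d')
  (Q : probability T R).
Context (f : nat -> Om -> T) (mf : forall i, measurable_fun setT (f i)) (fQ : forall i A,
  measurable A -> P (f i @^-1` A) = Q A).
Context (E : nat -> set Om) (mE : forall i, measurable (E i)) (PE : forall i,
  (P (E i) <= (2^-1 ^+ i.+1)%:E)%E).
Context (ff : forall i x, ~ E i x -> f i x = f i.+1 x).


(** Borel-Cantelli: outside [tailE i], of probability at most [2^-i], the sequence is constant from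
    index [i] on. For the law of [g] it suffices to prove one inequality, which is then applied to
    the complement as well. *)
Lemma eventual_selection : exists g : Om -> T, [/\ measurable_fun setT g,
  forall A, measurable A -> P (g @^-1` A) = Q A &
  forall i, exists B, [/\ measurable B, (P B <= (2^-1 ^+ i)%:E)%E & forall x, ~ B x ->
    g x = f i x]].
Proof.
pose tailE i : set Om := \bigcup_j E (i + j)%N.
have mT i : measurable (tailE i) by apply: bigcupT_measurable => j; exact: mE.
have PT i : (P (tailE i) <= (2^-1 ^+ i)%:E)%E.
  apply: le_trans (generalized_Boole_inequality P (fun j => mE (i + j)%N) (mT i)) _.
  apply: (@le_trans _ _ (\sum_(0 <= j <oo) (2^-1 ^+ i / (2 ^ j.+1)%:R)%:E)%E).
    apply: lee_nneseries => [j _ _|j _]; first exact: measure_ge0.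
    by apply: le_trans (PE _) _; rewrite lee_fin natrX -exprVn -exprD addnS.
  by apply: epsilon_trick0; rewrite exprn_ge0.
have stab i j x : ~ tailE i x -> f i x = f (i + j)%N x.
  move=> h; elim: j => [|j ->]; first by rewrite addn0.
  by rewrite addnS; apply: ff => Ex; apply: h; exists j.
have stab2 i j x : ~ tailE i x -> ~ tailE j x -> f i x = f j x.
  by move=> hi hj; rewrite (stab _ j _ hi) (stab _ i _ hj) addnC.
(* Every index with [~ tailE i x] gives the same value; the default index 0 serves on a null set. *)
pose g x := f (xget 0%N [set i | ~ tailE i x]) x.
have gE i x : ~ tailE i x -> g x = f i x.
  by move=> hi; apply: stab2 => //; exact: (xgetPex 0%N (P := [set i | ~ tailE i x])
    (ex_intro _ i hi)).
have g0 x : (forall i, tailE i x) -> g x = f 0%N x.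
  move=> h; rewrite /g; case: xgetP => // i _ /=; by have := h i.
have mfA i A : measurable A -> measurable (f i @^-1` A) by move=> mA;
  rewrite -[X in measurable X]setTI; exact: mf.
have gA A : g @^-1` A = (\bigcap_i tailE i `&` f 0%N @^-1` A) `|` \bigcup_i (f i @^-1` A `\`
  tailE i).
  apply/seteqP; split => x /=.
    move=> gx; have [h|/existsNP[i h]] := pselect (forall i, tailE i x).
      by left; split=> [i _//|]; rewrite -g0.
    by right; exists i => //; split => //=; rewrite -gE.
  by move=> [[h]|[i _ [/= fx h]]]; [rewrite g0// => i; exact: h|rewrite (gE i)].
have mgA A : measurable A -> measurable (g @^-1` A).
  move=> mA; rewrite gA; apply: measurableU.
    by apply: measurableI; [exact: bigcapT_measurable|exact: mfA].
  by apply: bigcupT_measurable => i; apply: measurableD => //; exact: mfA.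
have le A : measurable A -> (P (g @^-1` A) <= Q A)%E.
  move=> mA; apply/lee_addgt0Pr => e e0.
  have [i ie] : exists i, 2^-1 ^+ i < e.
    have : (fun i => (2^-1 ^+ i : R)) @ \oo --> 0.
      by apply: cvg_expr; rewrite ger0_norm// invf_lt1// ltr1n.
    move=> /cvgrPdist_lt/(_ _ e0)[i _ /(_ i (leqnn i))] /=.
    by rewrite sub0r normrN ger0_norm ?exprn_ge0// => h; exists i.
  apply: (@le_trans _ _ (P (f i @^-1` A `|` tailE i))).
    apply: le_measure; rewrite ?inE; [exact: mgA|apply: measurableU => //; exact: mfA|].
    move=> x /= gx; have [h|h] := pselect (tailE i x); first by right.
    by left; rewrite -gE.
  apply: le_trans (measureU2 _ _ _) _ => //; first exact: mfA.
  apply: leeD; first by rewrite -(fQ i mA).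
  by apply: le_trans (PT i) _; rewrite lee_fin ltW.
exists g; split.
- by move=> _ A mA; rewrite setTI; exact: mgA.
- move=> A mA; apply/eqP; rewrite eq_le le//=.
  have := le _ (measurableC mA); rewrite preimage_setC !probability_setC//; last exact: mgA.
  move: (le _ mA) (measure_ge0 P (g @^-1` A)) (measure_ge0 Q A) (probability_le1 Q mA).
  case: (P _) => [p| |]//; case: (Q A) => [r| |]//.
  by rewrite -!EFinB !lee_fin => *; lra.
- by move=> i; exists (tailE i); split => //; exact: gE.
Qed.
End eventual.

(** * Limits of chains of nearby points *)

Section null.
Context d (T : measurableType d) (R : realType) (m : {measure set T -> \bar R}).

Lemma le_measure_cover (A B N : set T) : measurable A -> measurable B -> measurable N ->
  A `<=` B `|` N ->
  (m A <= m B + m N)%E.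
Proof.
move=> mA mB mN h; apply: le_trans (measureU2 _ mB mN).
by apply: le_measure; rewrite ?inE//; exact: measurableU.
Qed.

Lemma le_measure_null (A B N : set T) : measurable A -> measurable B -> measurable N -> m N = 0%E ->
  A `<=` B `|` N ->
  (m A <= m B)%E.
Proof. by move=> mA mB mN N0 h; rewrite -[leRHS]adde0 -N0; exact: le_measure_cover. Qed.

End null.

Lemma mdist_le_via (R : realType) (X : metricType R) (y x z : X) (e : R) :
  mdist x y <= e -> mdist z y <= e -> mdist x z <= 2 * e.
Proof. by move=> h1 h2; apply: le_trans (metric_triangle x y z) _; rewrite (metric_sym y); lra. Qed.

Section scales.
Context (R : realType) dO (Om : measurableType dO) (P : probability Om R).
Context (co : nat -> Om -> Om).
Context (co_indep : independent_copies P co).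
Context (mco : forall l, measurable_fun setT (co l)).
Context (sm : (nat -> R) -> Om -> nat).
Context (msm : forall p n, measurable [set x | sm p x = n]).
Context (sm_law : samples P sm) (sm_dist : couples P sm).
Context (X : completeMetricType R) (a : nat -> X) (ker : int -> nat -> borel X -> R) (w : int ->
  R) (theta rad A B : R).
Context (w_gt0 : forall i, 0 < w i) (wS : forall i, w (i + 1) = theta * w i) (theta_gt2 : 2 < theta)
  (rad_gt0 : 0 < rad).
Context (mmd : measurable_fun setT (fun z : borel X * borel X => mdist (z.1 : X) z.2)).
Context (A_ge0 : 0 <= A) (AB : A / theta + B = A).
Context (mker : forall i n, measurable_fun setT (ker i n)) (ker_ge0 : forall i n x, 0 <= ker i n x)
  (ker_sum : forall i x, (\sum_(0 <= n <oo) (ker i n x)%:E = 1)%E)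
  (ker_near : forall i n x, 0 < ker i n x -> mdist (x : X) (a n) <= rad * w i)
  (ker_diff : forall i x y, (\sum_(0 <= n <oo) `|ker i n x - ker i n y|%:E <= (2 * B * mdist (x : X)
    y / w i)%:E)%E).

(* Step [t] of the chain started at level [n] takes place at scale [w (n - t)]. Its randomness
   is indexed by the level only, so it is shared by chains with different starting levels.
   The hypothesis [AB] makes [A] the sum of the series [B * (1 + theta^-1 + theta^-2 + ...)]. *)
Let lev (n t : nat) : int := n%:Z - t%:Z.
Let kn (n i : nat) := ker (lev n i).
Let ln (n i : nat) : nat := pickle (lev n i).

Let lnI n : injective (ln n).
Proof. by move=> i j /(pcan_inj pickleK) /addrI /oppr_inj []. Qed.

Let knf n : kernel_family (kn n).
Proof. by split => *; [exact: mker|exact: ker_ge0|exact: ker_sum]. Qed.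

Let theta_gt1 : 1 < theta := lt_trans (ltr1n R 2) theta_gt2.

Let theta_gt0 : 0 < theta := lt_trans ltr01 theta_gt1.

Lemma scale_lev n t : w (lev n t) = w n%:Z / theta ^+ t.
Proof.
elim: t => [|t IH]; first by rewrite /lev subr0 expr0 divr1.
have e : lev n t = lev n t.+1 + 1 by rewrite /lev -(addn1 t) PoszD; ring.
move: IH; rewrite e wS => h; apply: (mulfI (lt0r_neq0 theta_gt0)); rewrite h exprS.
by field; rewrite expf_neq0// gt_eqF.
Qed.

Let mn (d v : R) : R := Num.min 1 (A * d / v).

Lemma prodk_near n s i x : (i < size s)%N -> 0 < prodk (kn n) s x -> mdist (x : X) (a (nth 0%N s i))
  <= rad * w (lev n i).
Proof.
move=> si; rewrite /prodk (bigD1 (Ordinal si))//= => h; apply: ker_near.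
rewrite lt_neqAle ker_ge0 andbT eq_sym; apply: contraTneq h => h.
by rewrite /kn h mul0r ltxx.
Qed.

(** The distances at the successive scales form a geometric sum governed by the finest scale used.
    This is the scale of step [t - 1], hence [w (lev n t + 1)]. By [AB] the induction closes without
    loss. *)
Lemma tsum_kernel_diff n t x y : (tsum t (fun s => `|prodk (kn n) s x - prodk (kn n) s y|%:E) <=
  (2 * mn (mdist (x : X) y) (w (lev n t + 1)))%:E)%E.
Proof.
have d0 : 0 <= mdist (x : X) y := mdist_ge0 _ _.
rewrite /mn minr_pMr// mulr1 EFin_min le_min tsum_prodk_diff_le2//=.
apply: le_trans (tsum_prodk_diff (knf n) t (fun i => ker_diff (lev n i) x y)) _.
rewrite lee_fin; elim: t => [|t IH].
  by rewrite big_ord0 mulr_ge0// divr_ge0 ?mulr_ge0// ltW.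
rewrite big_ord_recr /=; apply: le_trans (lerD IH (lexx _)) _.
have -> : lev n t.+1 + 1 = lev n t by rewrite /lev -(addn1 t) PoszD; ring.
rewrite wS; have wp := w_gt0 (lev n t).
apply: le_of_eq; rewrite -{2}AB; field.
by rewrite !gt_eqF.
Qed.

Section single.
Context (Q : probability (borel X) R) (n : nat).

Let W := wlaw (kn n) Q.
Let tW : tree_law W := wlaw_tree (knf n) Q.
Let Z := chain co sm (ln n) W.
Let symb t x := last 0%N (Z t.+1 x).
Let Y t x : X := a (symb t x).

Let mZ t (S : set (seq nat)) : measurable [set x | S (Z t x)].
Proof. exact: (measurable_chain2 mco msm (ln n) W t (ln n) W t (fun s _ => S s)). Qed.

Let nth_Z t i x : (i < t)%N -> nth 0%N (Z t x) i = symb i x.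
Proof.
move=> it; rewrite -(subnKC it) addSn; elim: (t - i.+1)%N => [|m IH].
  by rewrite addn0 /symb -nth_last /Z size_chain.
rewrite addnS -[RHS]IH /Z [chain _ _ _ _ (i + m).+2 _]/= -/(chain co sm (ln n) W (i + m).+1 x)
  nth_rcons size_chain.
by rewrite ltnS leq_addr.
Qed.

(** The mass of a word is the integral of its conditional mass given the point. For a word in [S]
    this vanishes outside [D], and the conditional masses of all words sum to 1. *)
Lemma chain_pred_le t (S : set (seq nat)) (D : set (borel X)) : measurable D ->
  (forall s x, size s = t -> S s -> 0 < prodk (kn n) s x -> D x) ->
    (P [set x | S (Z t x)] <= Q D)%E.
Proof.
move=> mD h.
rewrite (@tsum_measure _ _ _ P t Z (fun t x => sm (cond W (Z t x)) (co (ln n t) x))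
  [set x | S (Z t x)])//; last first.
  by move=> u s; exact: measurable_chain.
have mI s : measurable_fun setT (fun x : borel X => (\1_D x * prodk (kn n) s x)%:E).
  by apply/measurable_EFinP/measurable_funM; [exact: measurable_indic|exact: measurable_prodk].
apply: (@le_trans _ _ (tsum t (fun s => \int[Q]_x (\1_D x * prodk (kn n) s x)%:E)%E)).
  apply: le_tsum => s st; first exact: measure_ge0.
  have I0 : (0 <= \int[Q]_x (\1_D x * prodk (kn n) s x)%:E)%E.
    by apply: integral_ge0 => x _; rewrite lee_fin mulr_ge0 ?(prodk_ge0 (knf n)).
  have [Ss|Ss] := pselect (S s); last first.
    rewrite (_ : _ `&` _ = set0) ?measure0//.
    by apply/seteqP; split => // x [/= Sx xs]; apply: Ss; rewrite -xs.
  apply: (@le_trans _ _ (W s)%:E).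
    rewrite -(chain_law co_indep msm sm_law s (@lnI n) tW) st; apply: le_measure; rewrite ?inE.
    - by apply: measurableI; [exact: mZ|exact: measurable_chain].
    - exact: measurable_chain.
    - by move=> x [].
  rewrite (wlawE (knf n)); apply: ge0_le_integral => //.
  - by move=> x _; rewrite lee_fin (prodk_ge0 (knf n)).
  - by apply/measurable_EFinP; exact: measurable_prodk.
  - move=> x _; rewrite lee_fin; have := prodk_ge0 (knf n) s x.
    rewrite le_eqVlt => /orP[/eqP<-|sx]; first by rewrite mulr0.
    by rewrite indicE mem_set ?mul1r//; exact: (h s).
rewrite -(@integral_tsum _ _ _ Q t (fun s x => (\1_D x * prodk (kn n) s x)%:E))//; last first.
  by move=> s x; rewrite lee_fin mulr_ge0// (prodk_ge0 (knf n)).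
rewrite -[X in (_ <= Q X)%E]setIT -integral_indic//; apply: le_of_eq.
apply: eq_integral => x _; under [X in tsum _ X]eq_fun do rewrite EFinM.
by rewrite tsumZl ?tsum_prodk ?mule1// => s; rewrite lee_fin (prodk_ge0 (knf n)).
Qed.

(** A word of positive mass is compatible with some point, and this point is close to all the code
    points met so far. Hence the code points form a Cauchy sequence on this event, whose complement
    is null. *)
Definition good : set Om := \bigcap_t [set x | 0 < W (Z t x)].

Lemma measurable_good : measurable good.
Proof. by apply: bigcapT_measurable => t; exact: (mZ t (fun s => 0 < W s)). Qed.

Lemma good_ae : P (~` good) = 0%E.
Proof.
have -> : ~` good = \bigcup_t [set x | ~ 0 < W (Z t x)] by rewrite /good setC_bigcap.
have m0 t : measurable [set x | ~ 0 < W (Z t x)] by exact: (mZ t (fun s => ~ 0 < W s)).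
apply/eqP; rewrite eq_le measure_ge0 andbT.
apply: le_trans (generalized_Boole_inequality P m0 _) _; first exact: bigcupT_measurable.
rewrite eseries0// => t _ _.
rewrite (@tsum_measure _ _ _ P t Z (fun t x => sm (cond W (Z t x)) (co (ln n t) x)) [set x | ~ 0 < W
  (Z t x)])//; last first.
  by move=> u s; exact: measurable_chain.
have [W0 _ _] := tW.
have -> : tsum t (fun s => P ([set x | ~ 0 < W (Z t x)] `&` [set x | Z t x = s])) = tsum t (fun s =>
  (0:R)%:E * 0)%E.
  apply: eq_tsum => s st; rewrite mule0.
  have [Ws|Ws] := ltP 0 (W s).
    rewrite (_ : _ `&` _ = set0) ?measure0//.
    by apply/seteqP; split => // x [/= h xs]; apply: h; rewrite xs.
  apply/eqP; rewrite eq_le measure_ge0 andbT; apply: (@le_trans _ _ (W s)%:E);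
    last by rewrite lee_fin.
  rewrite -(chain_law co_indep msm sm_law s (@lnI n) tW) st; apply: le_measure; rewrite ?inE.
  - by apply: measurableI; [exact: m0|exact: measurable_chain].
  - exact: measurable_chain.
  - by move=> x [].
by rewrite tsumZl// mul0e.
Qed.

Lemma good_point t x : good x -> exists y : X, forall i, (i < t)%N -> mdist y (Y i x) <= rad *
  w (lev n i).
Proof.
move=> /(_ t I) /= Wp.
have [y yp] : exists y, 0 < prodk (kn n) (Z t x) y.
  apply: contrapT => h; move: Wp; rewrite /W /wlaw (_ : (\int[Q]_x0 _ = 0)%E) ?ltxx//.
  rewrite -[RHS](integral0 Q setT); apply: eq_integral => y _; congr EFin; apply/le_anti.
  rewrite (prodk_ge0 (knf n)) andbT leNgt; apply/negP => yp; apply: h; by exists y.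
exists y => i it; have := @prodk_near n (Z t x) i y.
by rewrite /Z size_chain => /(_ it yp); rewrite nth_Z.
Qed.

Lemma dist_Y i j x : good x -> mdist (Y i x) (Y j x) <= rad * w (lev n i) + rad * w (lev n j).
Proof.
move=> gx; have [y hy] := good_point (maxn i j).+1 gx.
apply: le_trans (metric_triangle _ y _) _; rewrite metric_sym; apply: lerD; apply: hy;
  by rewrite ltnS ?leq_maxl ?leq_maxr.
Qed.

Definition limit_point (x : Om) : X := if `[<good x>] then lim (Y ^~ x @ \oo) else point.

Lemma scale_small (e : R) : 0 < e -> exists t0, forall t, (t0 <= t)%N -> rad * w (lev n t) < e.
Proof.
move=> e0; have : (fun t => rad * w n%:Z * theta^-1 ^+ t : R) @ \oo --> rad * w n%:Z * 0.
  apply: cvgMr; apply: cvg_expr; rewrite ger0_norm ?invr_ge0 ?(ltW theta_gt0)//.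
  by rewrite invf_lt1.
rewrite mulr0 => /cvgrPdist_lt/(_ _ e0)[t0 _ h]; exists t0 => t tt.
have := h t tt; rewrite /= sub0r normrN ger0_norm.
  by rewrite scale_lev exprVn mulrA.
by rewrite !mulr_ge0 ?exprn_ge0 ?invr_ge0 ?(ltW theta_gt0)// ltW.
Qed.

Lemma limit_point_cvg x : good x -> Y ^~ x @ \oo --> limit_point x.
Proof.
move=> gx; rewrite /limit_point asboolT//.
apply: cauchy_cvg; apply: cauchy_exP => e e0.
have [t0 h] := scale_small (divr_gt0 e0 (ltr0Sn R 1)).
exists (Y t0 x); exists t0 => // t /= tt; rewrite ballEmdist /=.
apply: le_lt_trans (dist_Y t0 t gx) _; have := h t0 (leqnn _); have := h t tt.
lra.
Qed.

Lemma dist_limit_point x t : good x -> mdist (limit_point x) (Y t x) <= rad * w (lev n t).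
Proof.
move=> gx; apply/ler_addgt0Pr => e e0.
have e2 := divr_gt0 e0 (ltr0Sn R 1).
have [t0 h] := scale_small e2.
have /fcvg_ballP/(_ _ e2)[t1 _ h1] := limit_point_cvg gx.
have := h1 (maxn t0 t1) (leq_maxr _ _); rewrite /= ballEmdist /= => hl.
have := h (maxn t0 t1) (leq_maxl _ _) => hr.
have := dist_Y (maxn t0 t1) t gx; have := metric_triangle (limit_point x) (Y (maxn t0 t1)
  x) (Y t x).
lra.
Qed.

(** Twice the bound on the distance from step [t] to the limit, so that the inequality is strict, as
    [thick] requires. *)
Let thr t := 2 * (rad * w (lev n t)).

Let thr_gt0 t : 0 < thr t.
Proof. by rewrite !mulr_gt0. Qed.

Let thr_cvg (k : R) : 0 < k -> (fun t => k * thr t) @ \oo --> 0.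
Proof.
move=> k0; apply/cvgrPdist_lt => e e0.
have [t0 h] := scale_small (divr_gt0 e0 (mulr_gt0 k0 (ltr0Sn R 1))).
exists t0 => // t /= tt; have := h t tt; rewrite sub0r normrN gtr0_norm ?mulr_gt0//.
by rewrite ltr_pdivlMr ?mulr_gt0// /thr => hh; rewrite mulrA mulrC.
Qed.

(** If all [Y t x] are within [thr t] of [F], the limit is within [2 * thr t] of [F] for all [t],
    hence in [F]. The right-hand side consists of countably many events about words, whence
    measurability. *)
Lemma limit_point_closed (F : set X) : closed F ->
  limit_point @^-1` F = (good `&` \bigcap_t [set x | thick F (thr t) (Y t x)]) `|` (~` good `&`
    [set x | F point]).
Proof.
move=> cF; apply/seteqP; split => x /=.
  have [gx Fx|gx] := pselect (good x); last by rewrite /limit_point asboolF// => h; right.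
  left; split => // t _; apply/thickP; exists (limit_point x) => //.
  by apply: le_lt_trans (dist_limit_point t gx) _; rewrite /thr ltr_pMl ?mulr_gt0// ltr1n.
move=> [[gx h]|[gx]]; last by rewrite /limit_point asboolF.
rewrite -(closed_thick cF (thr_cvg (ltr0Sn R 1))) => [|t]; last by rewrite mulr_gt0.
move=> t _; rewrite (_ : 2%:R * thr t = thr t + thr t); last by ring.
apply: (thick_trans (h t I)); rewrite metric_sym.
by apply: le_lt_trans (dist_limit_point t gx) _; rewrite /thr ltr_pMl ?mulr_gt0// ltr1n.
Qed.

Let mY t (S : set X) : measurable [set x | S (Y t x)].
Proof. exact: (mZ t.+1 (fun s => S (a (last 0%N s)))). Qed.

Lemma measurable_limit_point : measurable_fun setT (limit_point : Om -> borel X).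
Proof.
apply: measurable_borel_fun => F cF; rewrite limit_point_closed//.
have [Fp|Fp] := pselect (F point).
  rewrite (_ : [set x | F point] = setT); last by apply/seteqP; split.
  rewrite setIT; apply: measurableU; last by apply: measurableC; exact: measurable_good.
  by apply: measurableI; [exact: measurable_good|apply: bigcapT_measurable => t; exact: mY].
rewrite (_ : [set x | F point] = set0); last by apply/seteqP; split.
rewrite setI0 setU0.
by apply: measurableI; [exact: measurable_good|apply: bigcapT_measurable => t; exact: mY].
Qed.

(** For [F] closed, the probability that the limit is in [F] is at most that of [thick F (thr t)]
    for the code point [Y t], hence by [chain_pred_le] at most [Q (thick F (2 * thr t))], which
    tends to [Q F]. Then [eq_borel_prob] applies. *)
Lemma limit_point_law (D : set (borel X)) : measurable D -> P (limit_point @^-1` D) = Q D.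
Proof.
pose m : {measure set (borel X) -> \bar R} := push P measurable_limit_point.
have mEx D0 : m D0 = P (limit_point @^-1` D0) by [].
move=> mD; rewrite -mEx; apply: eq_borel_prob => //.
- by rewrite mEx preimage_setT probability_setT.
- exact: probability_setT.
move=> F cF; rewrite mEx.
have mt t : measurable (thick F (2 * thr t) : set (borel X)) by apply: measurable_open;
  exact: open_thick.
have c2 : (Q \o (fun t => thick F (2 * thr t))) @ \oo --> Q (\bigcap_t thick F (2 * thr t)).
  apply: nonincreasing_cvg_mu => //.
  - by rewrite (le_lt_trans (probability_le1 _ _))// ltry.
  - by apply: bigcapT_measurable.
  - move=> t u tu; apply/subsetPset; apply: le_thick; rewrite /thr !ler_pM2l// !scale_lev.
    by rewrite ler_pM2l// lef_pV2 ?posrE ?exprn_gt0//; apply: ler_weXn2l => //; exact: ltW.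
rewrite -[in leRHS](closed_thick cF (thr_cvg (ltr0Sn R 1))); last by move=> t; rewrite mulr_gt0.
apply: (@le_trans _ _ (limn (Q \o (fun t => thick F (2 * thr t))))); last first.
  by rewrite (cvg_lim _ c2).
apply: lime_ge; first by apply/cvg_ex; exists (Q (\bigcap_t thick F (2 * thr t))).
apply: nearW => t /=.
apply: (@le_trans _ _ (P [set x | thick F (thr t) (Y t x)])).
  apply: (le_measure_null (N := ~` good)).
  - by rewrite -[X in measurable X]setTI; apply: measurable_limit_point => //;
    exact: measurable_closed.
  - exact: mY.
  - by apply: measurableC; exact: measurable_good.
  - exact: good_ae.
  - by rewrite limit_point_closed// => x [[_ h]|[]]; [left; exact: h|right].
apply: (@chain_pred_le t.+1 (fun s => thick F (thr t) (a (last 0%N s)))) => // s x st Fs sx.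
rewrite (_ : 2 * thr t = thr t + thr t); last by ring.
apply: (thick_trans Fs); rewrite metric_sym.
have := @prodk_near n s t x; rewrite st => /(_ (ltnSn t) sx).
rewrite -(_ : last 0%N s = nth 0%N s t); last by rewrite (last_nth 0%N) st /=; case: (s) st.
by move=> hh; apply: le_lt_trans hh _; rewrite /thr ltr_pMl ?mulr_gt0// ltr1n.
Qed.

End single.

Lemma measurable_mdist d' (T' : measurableType d') (f g : T' -> borel X) :
  measurable_fun setT f -> measurable_fun setT g -> measurable_fun setT (fun x =>
    mdist (f x : X) (g x)).
Proof.
move=> mf mg.
have mfg : measurable_fun setT (fun x => (f x, g x)) by exact: measurable_fun_pair.
by move: (measurableT_comp mmd mfg).
Qed.

Let mn_ge0 d v : 0 <= d -> 0 < v -> 0 <= mn d v.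
Proof. by move=> d0 v0; rewrite /mn le_min ler01 divr_ge0 ?mulr_ge0 ?(ltW v0). Qed.

Let mn_le1 d v : mn d v <= 1.
Proof. by rewrite /mn ge_min lexx. Qed.

Let measurable_mn d' (T' : measurableType d') (f : T' -> R) v : measurable_fun setT f ->
  measurable_fun setT (fun x => mn (f x) v).
Proof.
move=> mf; apply: measurable_minr => //; apply: measurable_funM => //.
by apply: measurable_funM.
Qed.

(** Dominated convergence: the truncation at 1 provides the dominating function, whatever the
    integrability of [f]. *)
Lemma scale_cvg_mn d' (T' : measurableType d') (Q : probability T' R) (f : T' -> R) (k : int) :
  measurable_fun setT f -> (forall x, 0 <= f x) ->
  forall e, 0 < e -> exists n0, forall n, (n0 <= n)%N -> (\int[Q]_x (mn (f x) (w (n%:Z + k)))%:E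
    <= e%:E)%E.
Proof.
move=> mf f0 e e0.
have wn n : w (n%:Z + k) = theta ^+ n * w k.
  elim: n => [|n IH]; first by rewrite expr0 mul1r add0r.
  by rewrite exprS -mulrA -IH -wS -addn1 PoszD addrAC.
have cv x : (fun n : nat => (mn (f x) (w (n%:Z + k)))%:E) @ \oo --> 0%E.
  apply: cvg_EFin; first by apply: nearW.
  apply: (@squeeze_cvgr _ _ _ _ (fun=> 0) (fun n : nat => A * f x / w k * theta^-1 ^+ n)).
  - apply: nearW => n; rewrite mn_ge0//= /mn ge_min; apply/orP; right.
    rewrite wn exprVn; apply: le_of_eq; field.
    by rewrite !gt_eqF ?exprn_gt0.
  - exact: cvg_cst.
  - rewrite -[X in _ --> X](mulr0 (A * f x / w k)); apply: cvgMr; apply: cvg_expr.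
    by rewrite ger0_norm ?invr_ge0 ?(ltW theta_gt0)// invf_lt1.
have mfn n : measurable_fun setT (fun x => (mn (f x) (w (n%:Z + k)))%:E) by apply/measurable_EFinP;
  exact: measurable_mn.
have iQ : Q.-integrable setT (EFin \o cst (1:R)) by exact: finite_measure_integrable_cst.
have dom x n : [set: T'] x -> (`|(mn (f x) (w (n%:Z + k)))%:E| <= (1:R)%:E)%E.
  by move=> _; rewrite /= lee_fin ger0_norm ?mn_ge0 ?mn_le1.
have [_ _] := @dominated_convergence _ _ _ Q setT measurableT (fun n x =>
  (mn (f x) (w (n%:Z + k)))%:E) (cst 0%E) _ mfn
  (measurable_cst _) (aeW _ (fun x _ => cv x)) iQ (aeW _ dom).
rewrite integral0 => /fine_cvgP[[n1 _ h1] /cvgrPdist_lt/(_ _ e0)[n2 _ h2]].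
exists (maxn n1 n2) => n; rewrite geq_max => /andP[nn1 nn2].
have := h2 n nn2; rewrite /= sub0r normrN => h3; rewrite -[leLHS]fineK; last exact: h1.
by rewrite lee_fin; apply: le_trans (ler_norm _) (ltW h3).
Qed.

(** * Letting the starting level tend to infinity *)

Section climb.
Context (Q : probability (borel X) R).

Let W n := wlaw (kn n) Q.
Let tW n : tree_law (W n) := wlaw_tree (knf n) Q.
Let Z n := chain co sm (ln n) (W n).

(* The chain started at level [n + m] leaves the chain started at level [n] at step [t] of the
   latter. *)
Definition deviate n m t : set Om :=
  [set x | drop m (Z (n + m) (m + t) x) = Z n t x /\ drop m (Z (n + m) (m + t).+1 x) <> Z n t.+1 x].

Let take_Z n m t x : take m (Z n (m + t) x) = Z n m x.
Proof.
elim: t => [|t IH]; first by rewrite addn0 take_oversize// size_chain.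
by rewrite addnS -IH /Z [chain _ _ _ _ _.+1 _]/= -cats1 takel_cat// size_chain leq_addr.
Qed.

Lemma measurable_deviate n m t : measurable (deviate n m t).
Proof.
rewrite (_ : deviate n m t = [set x | drop m (take (m + t) (Z (n + m) (m + t).+1 x)) = take t
  (Z n t.+1 x) /\
  drop m (Z (n + m) (m + t).+1 x) <> Z n t.+1 x]).
  exact: (measurable_chain2 mco msm (ln (n + m)) (W (n + m)) (m + t).+1 (ln n) (W n) t.+1
    (fun s1 s2 => drop m (take (m + t) s1) = take t s2 /\ drop m s1 <> s2)).
by rewrite /deviate; apply/seteqP; split => x; rewrite /mkset !take_chain.
Qed.

(** The word of the higher chain is [z ++ s], where [z] has the [m] symbols drawn above level [n]
    and [s] is the word of the lower chain. The bound of [split_at_le_rescaled], summed over [z] and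
    [s], is the left-hand side of [prefix_influence]. The finest level met by [z] is [n + 1]. *)
Lemma deviate_le n m t (phi : borel X -> R) M : measurable_fun setT phi ->
  (forall x, 0 <= phi x <= M) ->
  (forall s x y, size s = t -> 0 < prodk (kn n) s x -> 0 < prodk (kn n) s y ->
    2 * mn (mdist (x : X) y) (w (n%:Z + 1)) <= phi x + phi y) ->
  (P (deviate n m t) <= 2%:E * \int[Q]_x (phi x)%:E)%E.
Proof.
move=> mphi phi0 hphi.
have levE i : lev (n + m) (m + i) = lev n i by rewrite /lev !PoszD; ring.
have kk i : kn (n + m) (m + i) = kn n i by rewrite /kn levE.
apply: le_trans (@prefix_influence _ _ _ _ _ (knf n) (knf (n + m)) _ kk Q t _ _ mphi phi0 _);
  last first.
  move=> s x y st sx sy; apply: le_trans (tsum_kernel_diff (n + m) m x y) _.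
  have -> : lev (n + m) m + 1 = n%:Z + 1 by rewrite /lev PoszD; ring.
  by rewrite lee_fin; exact: (hphi s).
have mD := measurable_deviate n m t.
rewrite (@tsum_measure _ _ _ P t (Z n) (fun t x => sm (cond (W n) (Z n t x)) (co (ln n t) x))
  (deviate n m t))//; last first.
  by move=> u s; exact: measurable_chain.
apply: le_tsum => s st; first exact: measure_ge0.
have mDs : measurable (deviate n m t `&` [set x | Z n t x = s]) by apply: measurableI => //;
  exact: measurable_chain.
rewrite (@tsum_measure _ _ _ P m (Z (n + m)) (fun t x => sm (cond (W (n + m)) (Z (n + m) t x))
  (co (ln (n + m) t) x)) _)//; last first.
  by move=> u z; exact: measurable_chain.
apply: le_tsum => z zm; first exact: measure_ge0.
have ll : ln n (size s) = ln (n + m) (size (z ++ s)) by rewrite size_cat zm /ln levE.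
have fr n' (s' : seq nat) k : (k < size s')%N -> ln n' k != ln n' (size s').
  by move=> ks; apply/eqP => /lnI ke; rewrite ke ltnn in ks.
have := split_at_le_rescaled co_indep mco msm sm_law sm_dist (@lnI n) (@lnI (n + m)) (tW n)
  (tW (n + m)) ll (fr n s) (fr _ (z ++ s)).
under eq_eseriesr do rewrite rcons_cat.
apply: le_trans; apply: le_measure; rewrite ?inE.
- by apply: measurableI => //; exact: measurable_chain.
- exact: measurable_split_at.
move=> x [[[/= dx1 dx2] xs] xz]; rewrite /split_at /= size_cat zm st.
rewrite -/(Z n) -/(Z (n + m)).
have e1 : Z (n + m) (m + t) x = z ++ s.
  by rewrite -[LHS](cat_take_drop m) take_Z dx1 xs xz.
split => // h; apply: dx2; rewrite /Z /= -/(Z (n + m) (m + t) x) -/(Z n t x) xs.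
move: h; rewrite /Z /= -/(Z (n + m) (m + t) x) -/(Z n t x) xs e1 last_rcons => ->.
by rewrite drop_rcons ?size_cat ?zm ?leq_addr// drop_size_cat.
Qed.

Let md0 : measurable_fun setT (fun x : borel X => mdist (x : X) point).
Proof. by apply: (measurable_mdist (f := fun x : borel X => x) (g := fun=> point)). Qed.

(** Two points compatible with the same [t + 1] symbols are within [2 * rad * w n / theta^t], so
    [phi] can be taken constant. *)
Lemma deviate_le_tail n m t : (P (deviate n m t.+1) <= (4 * A * rad / theta ^+ t.+1)%:E)%E.
Proof.
pose v := 2 * A * rad / theta ^+ t.+1.
have v0 : 0 <= v by rewrite !mulr_ge0 ?invr_ge0 ?exprn_ge0 ?(ltW rad_gt0) ?(ltW theta_gt0).
apply: le_trans (@deviate_le n m t.+1 (cst v) v _ _ _) _ => //.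
- by move=> x; rewrite v0 /=.
- move=> s x y st sx sy.
  have dx : mdist (x : X) y <= 2 * rad * (w n%:Z / theta ^+ t).
    apply: le_trans (metric_triangle _ (a (nth 0%N s t)) _) _.
    have tt : (t < size s)%N by rewrite st.
    have := prodk_near tt sx; have := prodk_near tt sy; rewrite scale_lev (metric_sym (a _)); lra.
  apply: (@le_trans _ _ (2 * (A * mdist (x : X) y / w (n%:Z + 1)))).
    by rewrite ler_pM2l// /mn ge_min lexx orbT.
  apply: (@le_trans _ _ (2 * (A * (2 * rad * (w n%:Z / theta ^+ t)) / w (n%:Z + 1)))).
    by rewrite ler_pM2l// ler_pM2r ?invr_gt0//; apply: ler_wpM2l.
  rewrite wS /cst /v exprS; apply: le_of_eq; field.
  by rewrite !gt_eqF ?exprn_gt0.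
have -> : (\int[Q]_x (cst v x)%:E = v%:E)%E.
  by rewrite -[RHS]mule1 -(probability_setT Q) -integral_cst.
rewrite -EFinM lee_fin /v; apply: le_of_eq; field.
by rewrite expf_neq0// gt_eqF.
Qed.

(** Serves for the early steps, where [deviate_le_tail] gives nothing small: the right-hand side
    tends to 0 as [n] grows, uniformly in [m] and [t]. The distance of two points is split at
    [point], and the truncated linear function is subadditive. *)
Lemma deviate_le_base n m t : (P (deviate n m t) <= 4%:E * \int[Q]_x (mn (mdist (x : X) point)
  (w (n%:Z + 1)))%:E)%E.
Proof.
have mm : measurable_fun setT (fun x : borel X => mn (mdist (x : X) point) (w (n%:Z + 1)))
  by exact: measurable_mn.
apply: le_trans (@deviate_le n m t (fun x : borel X => 2 * mn (mdist (x : X) point) (w (n%:Z + 1)))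
  2 _ _ _) _.
- exact: measurable_funM.
- by move=> x; rewrite mulr_ge0 ?mn_ge0 ?mdist_ge0//= ler_piMr ?mn_le1.
- move=> s x y _ _ _; rewrite -mulrDr ler_pM2l// /mn.
  have tr := metric_triangle x point y; rewrite (metric_sym point) in tr.
  have wp := w_gt0 (n%:Z + 1).
  have h (u : X) : 0 <= A * mdist u point / w (n%:Z + 1) by rewrite !mulr_ge0 ?invr_ge0 ?mdist_ge0
    ?(ltW wp).
  have t2 : A * mdist (x : X) y / w (n%:Z + 1) <= A * mdist (x : X) point / w (n%:Z + 1) + A * mdist
    (y : X) point / w (n%:Z + 1).
    by rewrite -mulrDl -mulrDr ler_pM2r ?invr_gt0//; apply: ler_wpM2l.
  move: (h x) (h y) t2; set u := _ / _; set u1 := _ / _; set u2 := _ / _ => *.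
  rewrite /Num.min; case: ifP; case: ifP; case: ifP; lra.
under eq_integral do rewrite EFinM.
rewrite ge0_integralZl_EFin//.
- by rewrite muleA -EFinM lee_wpmul2r ?lee_fin//; [apply: integral_ge0 => x _;
  rewrite lee_fin mn_ge0 ?mdist_ge0|lra].
- by move=> x _; rewrite lee_fin mn_ge0 ?mdist_ge0.
- exact/measurable_EFinP.
Qed.

Lemma limit_point_stable n m x : good Q n x -> good Q (n + m) x -> (forall t, ~ deviate n m t x) ->
  limit_point Q (n + m) x = limit_point Q n x.
Proof.
move=> gx gx' h.
have same t : drop m (Z (n + m) (m + t) x) = Z n t x.
  elim: t => [|t IH]; first by rewrite addn0 drop_oversize// size_chain.
  by apply: contrapT => hh; apply: (h t); rewrite /deviate /= -/(Z n) -/(Z (n + m)) -addnS.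
apply: mdist_positivity; apply/le_anti; rewrite mdist_ge0 andbT; apply/ler_addgt0Pr => e e0;
  rewrite add0r.
have [t0 h0] := scale_small n (divr_gt0 e0 (ltr0Sn R 1)).
have {h0} := h0 t0 (leqnn _).
have := dist_limit_point (m + t0) gx'; have := dist_limit_point t0 gx.
have -> : lev (n + m) (m + t0) = lev n t0 by rewrite /lev !PoszD; ring.
have -> : last 0%N (chain co sm (ln (n + m)) (wlaw (kn (n + m)) Q) (m + t0).+1 x) = last 0%N
  (chain co sm (ln n) (wlaw (kn n) Q) t0.+1 x).
  have := same t0.+1; rewrite /Z addnS => st; rewrite -[in RHS]st.
  rewrite -[in LHS](cat_take_drop m (chain co sm (ln (n + m)) _ _ x)) last_cat.
  have := size_chain co sm (ln n) (W n) t0.+1 x; rewrite -st; by case: (drop _ _).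
have := metric_triangle (limit_point Q (n + m) x) (a (last 0%N (chain co sm (ln n) (wlaw (kn n) Q)
  t0.+1 x))) (limit_point Q n x).
rewrite [mdist (a _) _]metric_sym; lra.
Qed.

(** A union bound over the steps, with weights [e / 2^(t + 1)]: the tail bound covers the steps
    after [t0], for all [n] and [m], and the base bound covers the others once [n] is large. *)
Lemma limit_point_settle e : 0 < e -> exists n0, forall n m, (n0 <= n)%N ->
  exists S, [/\ measurable S, (P S <= e%:E)%E & forall x, ~ S x -> limit_point Q (n + m) x =
    limit_point Q n x].
Proof.
move=> e0.
have C0 : 0 <= 8 * A * rad by rewrite !mulr_ge0// ltW.
(* The hypothesis [2 < theta] is used here: [theta^-t] has to fall below the weights [2^-t]. *)
have [t0 ht0] : exists t0, forall t, (t0 <= t)%N -> 4 * A * rad / theta ^+ t.+1 <=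
  e / (2 ^ t.+2)%:R.
  have : (fun t => 8 * A * rad * (2 / theta) ^+ t : R) @ \oo --> 8 * A * rad * 0.
    apply: cvgMr; apply: cvg_expr; rewrite ger0_norm ?divr_ge0 ?(ltW theta_gt0)//.
    by rewrite ltr_pdivrMr// mul1r.
  rewrite mulr0 => /cvgrPdist_lt/(_ _ e0)[t1 _ h1]; exists t1 => t tt.
  have := h1 t.+1 (leqW tt); rewrite /= sub0r normrN ger0_norm; last by rewrite mulr_ge0 ?exprn_ge0
    ?divr_ge0// ltW.
  move=> /ltW h; rewrite natrX ler_pdivlMr ?exprn_gt0//; apply: le_trans h.
  rewrite exprMn exprVn; apply: le_of_eq; rewrite [in LHS](exprS 2 t.+1); field.
  by rewrite expf_neq0// gt_eqF.
have e1 : 0 < e / (2 ^ t0.+1)%:R / 4 by rewrite !divr_gt0// ltr0n expn_gt0.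
have [n0 hn0] := scale_cvg_mn Q 1 md0 (fun x => mdist_ge0 _ _) e1.
exists n0 => n m nn0.
have small t : (P (deviate n m t) <= (e / (2 ^ t.+1)%:R)%:E)%E.
  have [tt|tt] := leqP t t0.
    apply: le_trans (deviate_le_base n m t) _.
    apply: le_trans (lee_wpmul2l _ (hn0 n nn0)) _; first by rewrite lee_fin.
    rewrite -EFinM lee_fin mulrCA divff// mulr1 ler_pM2l// lef_pV2 ?posrE ?ltr0n
      ?expn_gt0// ler_nat.
    by rewrite leq_exp2l.
  case: t tt => // t; rewrite ltnS => tt.
  apply: le_trans (deviate_le_tail n m t) _; rewrite lee_fin.
  exact: (ht0 t tt).
exists (~` good Q n `|` (~` good Q (n + m) `|` \bigcup_t deviate n m t)); split.
- apply: measurableU; first by apply: measurableC; exact: measurable_good.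
  apply: measurableU; first by apply: measurableC; exact: measurable_good.
  by apply: bigcupT_measurable => t; exact: measurable_deviate.
- have mU : measurable (\bigcup_t deviate n m t) by apply: bigcupT_measurable => t;
  exact: measurable_deviate.
  have mg k : measurable (~` good Q k) by apply: measurableC; exact: measurable_good.
  apply: (@le_trans _ _ (P (\bigcup_t deviate n m t))).
    apply: (le_measure_null (N := ~` good Q n `|` ~` good Q (n + m))) => //.
    + by apply: measurableU => //; apply: measurableU.
    + exact: measurableU.
    + by apply: null_set_setU => //; exact: good_ae.
    + by move=> x [|[|]]; [right; left|right; right|left].
  apply: le_trans (generalized_Boole_inequality P (measurable_deviate n m) mU) _.
  apply: le_trans (epsilon_trick0 xpredT (ltW e0)).
  by apply: lee_nneseries => [t _ _|t _]; [exact: measure_ge0|exact: small].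
- move=> x h; apply: limit_point_stable.
  + by apply: contrapT => hh; apply: h; left.
  + by apply: contrapT => hh; apply: h; right; left.
  + by move=> t hh; apply: h; right; right; exists t.
Qed.

(** Along a fast subsequence the limit points are eventually constant. The last clause holds for all
    large [n] and not only along the subsequence, because two laws, with different subsequences,
    have to be compared at a common starting level. *)
Lemma climb_limit : exists g : Om -> borel X, [/\ measurable_fun setT g,
  forall D, measurable D -> P (g @^-1` D) = Q D &
  forall e, 0 < e -> exists n0, forall n, (n0 <= n)%N ->
    exists S, [/\ measurable S, (P S <= e%:E)%E & forall x, ~ S x -> g x = limit_point Q n x]].
Proof.
have half i : 0 < 2^-1 ^+ i.+1 :> R by rewrite exprn_gt0.
have [N hN] := choice (fun i => limit_point_settle (half i)).
(* The maximum makes [G] nondecreasing, so that consecutive terms are [G i] and [G i + m]. *)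
pose G := fix G i := if i is j.+1 then maxn (G j) (N j.+1) else N 0%N.
have GN i : (N i <= G i)%N by case: i => //= i; rewrite leq_maxr.
have GS i : (G i <= G i.+1)%N by rewrite /= leq_maxl.
have stp i : exists S, [/\ measurable S, (P S <= (2^-1 ^+ i.+1)%:E)%E &
    forall x, ~ S x -> limit_point Q (G i) x = limit_point Q (G i.+1) x].
  have [S [mS PS hS]] := hN i (G i) (G i.+1 - G i)%N (GN i).
  by exists S; split => // x /hS; rewrite subnKC// => ->.
have [S hS] := choice stp.
have [g [mg gQ gh]] := @eventual_selection R _ Om P _ (borel X) Q (fun i => limit_point Q (G i))
  (fun i => measurable_limit_point Q (G i)) (fun i => limit_point_law Q (G i)) S
  (fun i => let: And3 h _ _ := hS i in h) (fun i => let: And3 _ h _ := hS i in h) (fun i =>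
    let: And3 _ _ h := hS i in h).
exists g; split => // e e0.
have [i ie] : exists i, 2 * 2^-1 ^+ i <= e.
  have : (fun i => 2 * (2^-1 ^+ i) : R) @ \oo --> 2 * (0:R).
    by apply: cvgMr; apply: cvg_expr; rewrite ger0_norm// invf_lt1// ltr1n.
  rewrite mulr0 => /cvgrPdist_lt/(_ _ e0)[i _ /(_ i (leqnn i))] /=.
  by rewrite sub0r normrN ger0_norm ?mulr_ge0 ?exprn_ge0// => /ltW h; exists i.
exists (G i) => n Gn.
have [B1 [mB1 PB1 hB1]] := gh i.
have [B2 [mB2 PB2 hB2]] := hN i (G i) (n - G i)%N (GN i).
exists (B1 `|` B2); split; first exact: measurableU.
- apply: le_trans (measureU2 _ mB1 mB2) _; apply: le_trans (leeD PB1 PB2) _.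
  rewrite -EFinD lee_fin; apply: le_trans ie; rewrite exprS.
  have : 0 <= 2^-1 ^+ i :> R by rewrite exprn_ge0.
  lra.
- move=> x h; rewrite hB1; last by move=> hh; apply: h; left.
  by rewrite -hB2 ?subnKC// => hh; apply: h; right.
Qed.

End climb.

(** * Two laws compared through chains with a common starting level *)

Section pair.
Context (Q Q' : probability (borel X) R) d' (Om' : measurableType d') (P' : probability Om' R)
  (U V : Om' -> borel X).
Context (mU : measurable_fun setT U) (mV : measurable_fun setT V).
Context (UQ : forall S, measurable S -> P' (U @^-1` S) = Q S) (VQ : forall S, measurable S ->
  P' (V @^-1` S) = Q' S).
Context (n : nat).

Let W := wlaw (kn n) Q.
Let W' := wlaw (kn n) Q'.
Let dis := disagree co sm (ln n) W W'.
Let mtv (v : R) : \bar R := (\int[P']_x (mn (mdist (U x : X) (V x)) v)%:E)%E.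

Let mUV : measurable_fun setT (fun x => mdist (U x : X) (V x)).
Proof. exact: measurable_mdist. Qed.

Lemma tsum_coupled_le t : (tsum t (fun s => `|W s - W' s|%:E) <= 2%:E * mtv (w (lev n t + 1)))%E.
Proof.
apply: le_trans (tsum_wlaw_diff (knf n) mU mV UQ VQ t) _.
rewrite /mtv -ge0_integralZl_EFin//; last 2 first.
- by move=> x _; rewrite lee_fin mn_ge0 ?mdist_ge0.
- by apply/measurable_EFinP; exact: measurable_mn.
apply: ge0_le_integral => //.
- by move=> x _; apply: tsum_ge0 => s _; rewrite lee_fin.
- apply: (@measurable_tsum _ _ _ t (fun s x => `|prodk (kn n) s (U x) - prodk (kn n) s (V x)|%:E)).
    move=> s; apply/measurable_EFinP; apply: measurableT_comp => //.
    have mp := measurable_prodk (knf n) s.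
    by apply: measurable_funB; [move: (measurableT_comp mp mU)|move: (measurableT_comp mp mV)].
  by move=> s x; rewrite lee_fin.
- by apply: emeasurable_funM => //; apply/measurable_EFinP; exact: measurable_mn.
- by move=> x _; rewrite -EFinM; exact: tsum_kernel_diff.
Qed.

Lemma disagree_mtv t : (P (dis t) <= 2%:E * (mtv (w (lev n t + 1)) + mtv (w (lev n t))))%E.
Proof.
apply: le_trans (disagree_le co_indep mco msm sm_law sm_dist (@lnI n) (wlaw_tree (knf n) Q)
  (wlaw_tree (knf n) Q') t) _.
have m0 v : 0 < v -> (0 <= mtv v)%E by move=> v0; apply: integral_ge0 => x _;
  rewrite lee_fin mn_ge0 ?mdist_ge0.
rewrite ge0_muleDr ?m0//; apply: leeD; first exact: tsum_coupled_le.
have -> : lev n t = lev n t.+1 + 1 by rewrite /lev -(addn1 t) PoszD; ring.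
exact: (tsum_coupled_le t.+1).
Qed.

(** At a first disagreement [t.+1] the symbols of step [t] still agree, so both limits are within
    [rad * w (lev n t)] of the same code point. Step 0 is set apart since no earlier symbol bounds
    the distance. *)
Lemma disagree_dist x : good Q n x -> good Q' n x -> ~ dis 0 x ->
  limit_point Q n x <> limit_point Q' n x ->
  exists2 t, dis t.+1 x & mdist (limit_point Q n x) (limit_point Q' n x) <= 2 * rad * w (lev n t).
Proof.
move=> gx gx' nd0 ne.
pose C := chain co sm (ln n).
have [t ht] : exists t, dis t x.
  apply: contrapT => h; apply: ne.
  have same t : C W t x = C W' t x.
    elim: t => // t IH; apply: contrapT => hh; apply: h; exists t; split => //.
  apply: mdist_positivity; apply/le_anti; rewrite mdist_ge0 andbT; apply/ler_addgt0Pr => e e0;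
    rewrite add0r.
  have [t0 h0] := scale_small n (divr_gt0 e0 (ltr0Sn R 1)).
  apply: le_trans (mdist_le_via (dist_limit_point t0 gx) _) _.
    by have := dist_limit_point t0 gx'; have := same t0.+1; rewrite /C /W /W' => ->.
  by rewrite mulrC -ler_pdivlMr// ltW// h0.
case: t ht => // t ht; exists t => //; rewrite -mulrA.
apply: (mdist_le_via (dist_limit_point t gx)).
by have [+ _] := ht; rewrite /W /W' => ->; exact: dist_limit_point.
Qed.

End pair.

Section cost.
Context (q : R) (q_gt0 : 0 < q).
Context (Q Q' : probability (borel X) R) d' (Om' : measurableType d') (P' : probability Om' R)
  (U V : Om' -> borel X).
Context (mU : measurable_fun setT U) (mV : measurable_fun setT V).
Context (UQ : forall S, measurable S -> P' (U @^-1` S) = Q S) (VQ : forall S, measurable S ->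
  P' (V @^-1` S) = Q' S).
Context (g g' : Om -> borel X) (mg : measurable_fun setT g) (mg' : measurable_fun setT g').
Context (gE : forall e, 0 < e -> exists n0, forall n, (n0 <= n)%N ->
    exists S, [/\ measurable S, (P S <= e%:E)%E & forall x, ~ S x -> g x = limit_point Q n x]).
Context (gE' : forall e, 0 < e -> exists n0, forall n, (n0 <= n)%N ->
    exists S, [/\ measurable S, (P S <= e%:E)%E & forall x, ~ S x -> g' x = limit_point Q' n x]).

Let mtv (v : R) : \bar R := (\int[P']_x (mn (mdist (U x : X) (V x)) v)%:E)%E.

(** On the exceptional event, where a limit has not settled or the chains differ from step 0 on,
    nothing bounds the distance. The event has small probability, and truncating the cost at [M]
    makes its contribution at most [e]. *)
Lemma truncated_cost_le (M e : R) : 0 < M -> 0 < e -> exists n0, forall n, (n0 <= n)%N ->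
  (\int[P]_x (Num.min (mdist (g x : X) (g' x) `^ q) M)%:E <=
   e%:E + \sum_(0 <= t <oo) ((2 * rad * w (lev n t)) `^ q * 2)%:E * (mtv (w (lev n t)) +
     mtv (w (lev n t.+1))))%E.
Proof.
(* Six shares: one for each of [S] and [S'], and four for step 0, where the factor 2 of
   [disagree_mtv] multiplies two terms. *)
move=> M0 e0; have e1 : 0 < e / (6 * M) by rewrite divr_gt0 ?mulr_gt0.
have mUV : measurable_fun setT (fun x => mdist (U x : X) (V x)) by exact: measurable_mdist.
have [n1 h1] := gE e1; have [n2 h2] := gE' e1.
have [n3 h3] := scale_cvg_mn P' 1 mUV (fun x => mdist_ge0 _ _) e1.
have [n4 h4] := scale_cvg_mn P' 0 mUV (fun x => mdist_ge0 _ _) e1.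
exists (maxn (maxn n1 n2) (maxn n3 n4)) => n; rewrite !geq_max =>
  /andP[/andP[nn1 nn2] /andP[nn3 nn4]].
have [S [mS PS hS]] := h1 n nn1; have [S' [mS' PS' hS']] := h2 n nn2.
pose dis := disagree co sm (ln n) (wlaw (kn n) Q) (wlaw (kn n) Q').
have mdis t : measurable (dis t) by exact: measurable_disagree.
have P0 : (P (dis 0%N) <= (4 * (e / (6 * M)))%:E)%E.
  apply: le_trans (disagree_mtv mU mV UQ VQ n 0) _.
  have := h3 n nn3; have := h4 n nn4; rewrite addr0 /lev subr0 => i4 i3.
  apply: le_trans (lee_wpmul2l _ (leeD i3 i4)) _; first by rewrite lee_fin.
  by rewrite -EFinD -EFinM lee_fin; lra.
pose G := ~` good Q n `|` ~` good Q' n.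
have mG : measurable G by apply: measurableU; apply: measurableC; exact: measurable_good.
have PG : P G = 0%E by apply: null_set_setU; try (by apply: measurableC; exact: measurable_good);
  exact: good_ae.
pose Bad := (S `|` S') `|` dis 0%N.
have mBad : measurable Bad by do 2 apply: measurableU => //.
have PBad : (P Bad <= (e / M)%:E)%E.
  apply: le_trans (measureU2 _ (measurableU _ _ mS mS') (mdis 0%N)) _.
  apply: le_trans (leeD (le_trans (measureU2 _ mS mS') (leeD PS PS')) P0) _.
  rewrite -!EFinD lee_fin; apply: le_of_eq; field; by rewrite gt_eqF.
have mBG : measurable (Bad `|` G) by exact: measurableU.
have PBG : (P (Bad `|` G) <= (e / M)%:E)%E.
  exact: le_trans (le_measure_null mBG mBad mG PG (fun x h => h)) PBad.
pose r t := (2 * rad * w (lev n t)) `^ q.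
have r0 t : 0 <= r t by exact: powR_ge0.
have mF : measurable_fun setT (fun x => Num.min (mdist (g x : X) (g' x) `^ q) M).
  apply: measurable_minr => //.
  have := @measurable_powR R q => mp.
  by move: (measurableT_comp mp (measurable_mdist mg mg')).
have mD t : measurable_fun setT (fun x : Om => (r t * \1_(dis t.+1) x)%:E).
  by apply/measurable_EFinP/measurable_funM => //; exact: measurable_indic.
have D0 t (x : Om) : (0 <= (r t * \1_(dis t.+1) x)%:E)%E by rewrite lee_fin mulr_ge0.
apply: (@le_trans _ _ (\int[P]_x ((M * \1_(Bad `|` G) x)%:E + \sum_(0 <= t <oo) (r t * \1_(dis t.+1)
  x)%:E))%E).
  have mMB : measurable_fun setT (fun x : Om => (M * \1_(Bad `|` G) x)%:E).
    by apply/measurable_EFinP/measurable_funM => //; exact: measurable_indic.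
  apply: ge0_le_integral => //.
  - by move=> x _; rewrite lee_fin le_min powR_ge0 ltW.
  - exact/measurable_EFinP.
  - by apply: emeasurable_funD => //; apply: ge0_emeasurable_sum => //.
  move=> x _; have S0 : (0 <= \sum_(0 <= t <oo) (r t * \1_(dis t.+1) x)%:E)%E
    by apply: nneseries_ge0.
  have [BGx|BGx] := pselect ((Bad `|` G) x).
    by apply: (@le_trans _ _ M%:E); rewrite ?lee_fin ?ge_min ?lexx ?orbT// indicE
      mem_set// mulr1 leeDl.
  have [gx gx'] : good Q n x /\ good Q' n x.
    by split; apply: contrapT => h; apply: BGx; right; [left|right].
  have nd : ~ dis 0%N x by move=> h; apply: BGx; left; right.
  have gl : g x = limit_point Q n x by apply: hS => h; apply: BGx; left; left; left.
  have gl' : g' x = limit_point Q' n x by apply: hS' => h; apply: BGx; left; left; right.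
  have [eq|ne] := pselect (limit_point Q n x = limit_point Q' n x).
    apply: (@le_trans _ _ 0%E); first by rewrite lee_fin ge_min gl gl' eq mdistxx powR0
      ?gt_eqF// lexx.
    by rewrite adde_ge0// lee_fin mulr_ge0// ltW.
  have [t dt hd] := disagree_dist gx gx' nd ne.
  rewrite gl gl'; apply: (@le_trans _ _ ((r t)%:E)).
    by rewrite lee_fin ge_min ge0_ler_powR ?nnegrE ?mdist_ge0 ?mulr_ge0 ?(ltW rad_gt0) ?(ltW q_gt0)
      ?(ltW (w_gt0 _)).
  have i1 : \1_(dis t.+1) x = 1 :> R by rewrite indicE mem_set.
  rewrite (@nneseriesD1 _ _ t)// i1 mulr1 addeCA leeDl// adde_ge0//.
    by rewrite lee_fin mulr_ge0// ltW.
  by apply: nneseries_ge0.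
rewrite ge0_integralD//; last 4 first.
- by move=> x _; rewrite lee_fin mulr_ge0// ltW.
- by apply/measurable_EFinP/measurable_funM => //; exact: measurable_indic.
- by move=> x _; apply: nneseries_ge0.
- by apply: ge0_emeasurable_sum.
have iE (k : R) (D : set Om) : 0 <= k -> measurable D -> (\int[P]_x (k * \1_D x)%:E = k%:E * P D)%E.
  move=> k0 mDD; under eq_integral do rewrite EFinM.
  rewrite ge0_integralZl_EFin//; first by rewrite integral_indic// setIT.
  by apply/measurable_EFinP; exact: measurable_indic.
rewrite iE ?(ltW M0)//; apply: leeD.
  apply: le_trans (lee_wpmul2l _ PBG) _; first by rewrite lee_fin ltW.
  by rewrite -EFinM lee_fin mulrC divfK ?gt_eqF.
rewrite integral_nneseries//; apply: lee_nneseries => [t _ _|t _]; first by apply: integral_ge0.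
rewrite iE// EFinM -muleA; apply: lee_wpmul2l; first by rewrite lee_fin.
apply: le_trans (disagree_mtv mU mV UQ VQ n t.+1) _.
have -> : lev n t.+1 + 1 = lev n t by rewrite /lev -(addn1 t) PoszD; ring.
exact: lexx.
Qed.

End cost.
End scales.

(** * Sums over scales *)

Section primitive.
Context (R : realType) (q : R) (q_gt0 : 0 < q) (q_lt1 : q < 1).

(** Tangent line at [ln y] of the convex function sending [ln x] to [x ^ p]. *)
Lemma powR_tangent (x y p : R) : 0 < x -> 0 < y -> y `^ p * (1 + p * (ln x - ln y)) <= x `^ p.
Proof.
move=> x0 y0; have -> : x `^ p = y `^ p * expR (p * (ln x - ln y)).
  by rewrite /powR !gt_eqF// -expRD; congr expR; ring.
by rewrite ler_pM2l ?powR_gt0// expR_ge1Dx.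
Qed.

Definition kink (a v : R) : R := v `^ q * Num.min 1 (a / v).

(* An antiderivative of [u => u^-1 * min (u^q) (b * u^(q - 1))]. *)
Definition kink_primitive (b u : R) : R :=
  Num.min u b `^ q / q + b / (1 - q) * (b `^ (q - 1) - Num.max u b `^ (q - 1)).

Lemma kink_primitive_ge0 (b u : R) : 0 < b -> 0 < u -> 0 <= kink_primitive b u.
Proof.
move=> b0 u0; have q1 : 0 < 1 - q by rewrite subr_gt0.
apply: addr_ge0; first by rewrite divr_ge0 ?powR_ge0// ltW.
apply: mulr_ge0; first by rewrite divr_ge0// ltW.
have m0 : 0 < Num.max u b by rewrite lt_max b0 orbT.
rewrite subr_ge0 -(opprB 1 q) !powRN lef_pV2 ?posrE ?powR_gt0//.
by apply: ge0_ler_powR; rewrite ?nnegrE ?(ltW b0) ?(ltW m0) ?le_max ?lexx ?orbT//; exact: ltW.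
Qed.

(** The bound is the limit as [u] tends to infinity, [b^q / q + b^q / (1 - q)]; the second term is
    where [q < 1] is essential. *)
Lemma kink_primitive_le (b u : R) : 0 < b -> 0 < u -> kink_primitive b u <= b `^ q / (q * (1 - q)).
Proof.
move=> b0 u0; have q1 : 0 < 1 - q by rewrite subr_gt0.
have bq := mulr_powRB1 (ltW b0) q_gt0.
have -> : b `^ q / (q * (1 - q)) = b `^ q / q + b / (1 - q) * b `^ (q - 1).
  have -> : b / (1 - q) * b `^ (q - 1) = b `^ q / (1 - q) by rewrite -bq; ring.
  by field; rewrite !gt_eqF.
apply: lerD; last by rewrite ler_pM2l ?divr_gt0// gerBl powR_ge0.
have m0 : 0 < Num.min u b by rewrite lt_min b0 u0.
rewrite ler_pM2r ?invr_gt0//; apply: ge0_ler_powR; rewrite ?nnegrE ?(ltW b0) ?(ltW m0) ?ge_min ?lexx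
  ?orbT//; exact: ltW.
Qed.

(** Comparison of a term with an integral: [ln rho] is the mass of [[v, rho * v]] for [du / u], and
    with [b = rho * a] the integrand [min (u^q, b * u^(q - 1))] stays above [kink a v] there, since
    [b * (rho * v)^(q - 1) = rho^q * a * v^(q - 1)]. The tangent inequalities [lo] and [hi], on
    either side of [b], replace the integration. *)
Lemma kink_step (a rho v : R) : 0 < a -> 1 <= rho -> 0 < v ->
  kink a v * ln rho <= kink_primitive (rho * a) (rho * v) - kink_primitive (rho * a) v.
Proof.
move=> a0 r1 v0; have r0 : 0 < rho by lra.
set b := rho * a; set r := rho * v.
have b0 : 0 < b by rewrite mulr_gt0.
have rp : 0 < r by rewrite mulr_gt0.
have q1 : 0 < 1 - q by rewrite subr_gt0.
have vr : v <= r by rewrite /r ler_peMl// ltW.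
have lr : ln rho = ln r - ln v by rewrite /r lnM ?posrE//; ring.
have lvr : ln v <= ln r by rewrite ler_ln ?posrE.
have k1 : kink a v <= v `^ q.
  by rewrite /kink ler_piMr ?powR_ge0// ge_min lexx.
have k2 : kink a v <= b * r `^ (q - 1).
  apply: (@le_trans _ _ (v `^ q * (a / v))).
    by rewrite /kink ler_wpM2l ?powR_ge0// ge_min lexx orbT.
  rewrite -(mulr_powRB1 (ltW v0) q_gt0) /b /r powRM ?(ltW v0) ?(ltW r0)//.
  have -> : v * v `^ (q - 1) * (a / v) = 1 * (a * v `^ (q - 1)) by field; rewrite gt_eqF.
  have -> : rho * a * (rho `^ (q - 1) * v `^ (q - 1)) = rho `^ q * (a * v `^ (q - 1)).
    by rewrite -(mulr_powRB1 (ltW r0) q_gt0); ring.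
  rewrite ler_wpM2r ?mulr_ge0 ?powR_ge0 ?(ltW a0)//.
  by rewrite -(powRr0 rho); apply: ler_powR => //; exact: ltW.
have lo (x y : R) : 0 < y -> y <= x -> y `^ q * (ln x - ln y) <= (x `^ q - y `^ q) / q.
  move=> y0 yx; have x0 := lt_le_trans y0 yx.
  rewrite ler_pdivlMr//; have := powR_tangent q x0 y0; lra.
have hi (x y : R) : 0 < y -> y <= x -> x `^ (q - 1) * (ln x - ln y) <= (y `^ (q - 1) - x `^ (q - 1))
  / (1 - q).
  move=> y0 yx; have x0 := lt_le_trans y0 yx.
  rewrite ler_pdivlMr//; have := powR_tangent (q - 1) y0 x0; lra.
rewrite lr /kink_primitive.
have [rb|br] := leP r b.
  rewrite (min_l (le_trans vr rb)) (max_r (le_trans vr rb)).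
  apply: (@le_trans _ _ (v `^ q * (ln r - ln v))); first by rewrite ler_wpM2r// subr_ge0.
  apply: le_trans (lo _ _ v0 vr) _; apply: le_of_eq; ring.
have lbr : ln b <= ln r by rewrite ler_ln ?posrE// ltW.
have hib (x : R) : 0 < x -> x <= r -> b * r `^ (q - 1) * (ln r - ln x) <= b / (1 - q) *
  (x `^ (q - 1) - r `^ (q - 1)).
  move=> x0 xr; have := hi _ _ x0 xr; rewrite -(ler_pM2l b0) => h.
  rewrite -[leLHS]mulrA; apply: le_trans h _; apply: le_of_eq; ring.
have [vb|bv] := leP v b.
  have lvb : ln v <= ln b by rewrite ler_ln ?posrE.
  have -> : ln r - ln v = (ln b - ln v) + (ln r - ln b) by ring.
  rewrite mulrDr; apply: (@le_trans _ _ (v `^ q * (ln b - ln v) + b * r `^ (q - 1) *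
    (ln r - ln b))).
    by apply: lerD; rewrite ler_wpM2r// subr_ge0.
  apply: le_trans (lerD (lo _ _ v0 vb) (hib _ b0 (ltW br))) _.
  apply: le_of_eq; ring.
apply: (@le_trans _ _ (b * r `^ (q - 1) * (ln r - ln v))); first by rewrite ler_wpM2r// subr_ge0.
apply: le_trans (hib _ v0 vr) _; apply: le_of_eq; ring.
Qed.

(** The levels [k + N * (n - t)] run once through consecutive levels of the progression of ratio
    [rho], so the bounds of [kink_step] telescope. The factor [rho] comes from
    [(rho * a)^q <= rho * a^q]. *)
Lemma sum_kink_le (v : int -> R) (rho a : R) (N T : nat) (n : int) : (forall j, 0 < v j) ->
  (forall j, v (j + 1) = rho * v j) ->
  1 <= rho -> 0 <= a ->
  (\sum_(t < T) \sum_(k < N) kink a (v (k%:Z + N%:Z * (n - t%:Z)))) * ln rho <= rho * a `^ q / (q *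
    (1 - q)).
Proof.
move=> v0 vS r1; have r0 : 0 < rho by lra.
have q1 : 0 < 1 - q by rewrite subr_gt0.
rewrite le_eqVlt => /predU1P[<-|a0].
  rewrite powR0 ?gt_eqF// mulr0 mul0r big1 ?mul0r// => t _; rewrite big1// => k _.
  by rewrite /kink mul0r min_r ?mulr0.
have b0 : 0 < rho * a by rewrite mulr_gt0.
pose Phi j := kink_primitive (rho * a) (v j).
have inner K m : (\sum_(k < K) kink a (v (k%:Z + m))) * ln rho <= Phi (K%:Z + m) - Phi m.
  elim: K => [|K IH]; first by rewrite big_ord0 mul0r add0r subrr.
  rewrite big_ord_recr /= mulrDl.
  have := kink_step a0 r1 (v0 (K%:Z + m)); rewrite -vS -/(Phi (K%:Z + m)) -/(Phi _).
  have -> : K%:Z + m + 1 = K.+1%:Z + m by rewrite -addn1 PoszD; ring.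
  by move: IH; lra.
have outer : (\sum_(t < T) \sum_(k < N) kink a (v (k%:Z + N%:Z * (n - t%:Z)))) * ln rho <=
    Phi (N%:Z * (n + 1)) - Phi (N%:Z * (n + 1 - T%:Z)).
  elim: T => [|T IH]; first by rewrite big_ord0 mul0r subr0 subrr.
  rewrite big_ord_recr /= mulrDl; have := inner N (N%:Z * (n - T%:Z)).
  have -> : N%:Z + N%:Z * (n - T%:Z) = N%:Z * (n + 1 - T%:Z) by ring.
  have -> : n + 1 - T.+1%:Z = n - T%:Z by rewrite -addn1 PoszD; ring.
  by move: IH; lra.
apply: le_trans outer _.
have := kink_primitive_ge0 b0 (v0 (N%:Z * (n + 1 - T%:Z))); have :=
  kink_primitive_le b0 (v0 (N%:Z * (n + 1))).
rewrite -/(Phi _) -/(Phi (_ * (_ - _))) => h1 h2.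
apply: (@le_trans _ _ ((rho * a) `^ q / (q * (1 - q)))); first by lra.
rewrite ler_pM2r ?invr_gt0 ?mulr_gt0// powRM ?(ltW a0) ?(ltW r0)//.
rewrite ler_wpM2r ?powR_ge0//; apply: ler1_powR => //; exact: ltW.
Qed.

End primitive.

(** * Averaging over interlaced progressions *)

Section mixture.
Context (R : realType) d (Om : measurableType d) (P : probability Om R).
Context (s1 s2 : Om -> Om) (ms1 : measurable_fun setT s1) (ms2 : measurable_fun setT s2).
Context (s12 : independent_halves P s1 s2).
Context (idx : Om -> nat) (midx : forall k, measurable [set x | idx x = k]) (p : nat -> R)
  (pidx : forall k, P [set x | idx x = k] = (p k)%:E).

(** The index uses one half of the input and is therefore independent of the randomness given to the
    chosen variable. *)
Definition mix (T : Type) (f : nat -> Om -> T) (x : Om) : T := f (idx (s1 x)) (s2 x).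

Lemma measurable_mix d' (T : measurableType d') (f : nat -> Om -> T) :
  (forall k, measurable_fun setT (f k)) -> measurable_fun setT (mix f).
Proof.
move=> mf _ A mA; rewrite setTI.
have -> : mix f @^-1` A = \bigcup_k (s1 @^-1` [set x | idx x = k] `&` s2 @^-1` (f k @^-1` A)).
  apply/seteqP; split => x /=; first by move=> h; exists (idx (s1 x)).
  by move=> [k _ /= [<-]].
apply: bigcupT_measurable => k; apply: measurableI; apply: measurable_pre => //.
by rewrite -[X in measurable X]setTI; exact: mf.
Qed.

Lemma mix_integral (f : nat -> Om -> \bar R) : (forall k, measurable_fun setT (f k)) -> (forall k x,
  0 <= f k x)%E ->
  (\int[P]_x mix f x = \sum_(0 <= k <oo) (p k)%:E * \int[P]_x f k x)%E.
Proof.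
move=> mf f0.
pose F k (z : Om * Om) : \bar R := ((\1_[set x | idx x = k] z.1)%:E * f k z.2)%E.
have mF k : measurable_fun setT (F k).
  apply: emeasurable_funM.
    apply/measurable_EFinP.
    have m1 : measurable_fun setT (\1_[set x | idx x = k] : Om -> R) by exact: measurable_indic.
    by move: (measurableT_comp m1 (@measurable_fst _ _ Om Om)).
  by move: (measurableT_comp (mf k) (@measurable_snd _ _ Om Om)).
have F0 k z : (0 <= F k z)%E by rewrite mule_ge0 ?lee_fin.
have ms : measurable_fun setT (fun x => (s1 x, s2 x)) by exact: measurable_fun_pair.
transitivity (\int[P]_x \sum_(0 <= k <oo) F k (s1 x, s2 x))%E.
  apply: eq_integral => x _; rewrite (@nneseriesD1 _ _ (idx (s1 x)))//.
  rewrite eseries0 => [|k _ /= kk].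
    by rewrite adde0 /F /= indicE mem_set// mul1e.
  by rewrite /F /= indicE memNset ?mul0e//= => e; move: kk; rewrite e eqxx.
rewrite integral_nneseries//; last by move=> k; move: (measurableT_comp (mF k) ms).
apply: eq_eseriesr => k _.
rewrite (split_integral ms1 ms2 s12 (mF k) (F0 k)) /F /=.
have I0 : (0 <= \int[P]_x f k x)%E by apply: integral_ge0.
rewrite (eq_integral (fun y => (\1_[set x | idx x = k] y)%:E * \int[P]_x f k x)%E) => [|y _];
  last first.
  by rewrite ge0_integralZl// ?lee_fin.
rewrite ge0_integralZr//; first by congr (_ * _)%E; rewrite integral_indic// setIT; exact: pidx.
by apply/measurable_EFinP; exact: measurable_indic.
Qed.

Lemma mix_law d' (T : measurableType d') (Q : probability T R) (f : nat -> Om -> T) : (forall k,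
  measurable_fun setT (f k)) ->
  (\sum_(0 <= k <oo) (p k)%:E = 1)%E ->
  (forall k A, measurable A -> P (f k @^-1` A) = Q A) -> forall A, measurable A ->
    P (mix f @^-1` A) = Q A.
Proof.
move=> mf p1 fQ A mA.
have mm := measurable_mix mf.
have mfA k : measurable (f k @^-1` A) by rewrite -[X in measurable X]setTI; exact: mf.
have mmA : measurable (mix f @^-1` A) by rewrite -[X in measurable X]setTI; exact: mm.
transitivity (\int[P]_x mix (fun k x => (\1_(f k @^-1` A) x)%:E) x)%E.
  rewrite -[in LHS](setIT (mix f @^-1` A)) -integral_indic//; apply: eq_integral => x _.
rewrite mix_integral.
- have e k : (\int[P]_x (\1_(f k @^-1` A) x)%:E = Q A)%E by rewrite integral_indic// setIT;
  exact: fQ.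
  under eq_eseriesr do rewrite e.
  have QA : (Q A \is a fin_num) by rewrite ge0_fin_numE// (le_lt_trans (probability_le1 _
    _))// ltry.
  rewrite -(fineK QA); under eq_eseriesr => k _ do rewrite muleC.
  rewrite nneseriesZl ?p1 ?mule1// => k _.
  by rewrite -pidx.
- by move=> k; apply/measurable_EFinP; exact: measurable_indic.
- by move=> k x; rewrite lee_fin.
Qed.

End mixture.

Lemma nneseries_le_partial (R : realType) (u : nat -> R) (c : R) : (forall n, 0 <= u n) ->
  (forall T, \sum_(t < T) u t <= c) ->
  (\sum_(0 <= t <oo) (u t)%:E <= c%:E)%E.
Proof.
move=> u0 h; apply: lime_le; first by apply: is_cvg_nneseries => n _ _; rewrite lee_fin.
by apply: nearW => T; rewrite sumEFin lee_fin big_mkord.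
Qed.

Section average.
Context (R : realType) dO (Om : measurableType dO) (P : probability Om R).
Context (s1 s2 : Om -> Om) (ms1 : measurable_fun setT s1) (ms2 : measurable_fun setT s2).
Context (s12 : independent_halves P s1 s2).
Context (sm : (nat -> R) -> Om -> nat).
Context (msm : forall p n, measurable [set x | sm p x = n]).
Context (sm_law : samples P sm) (sm_dist : couples P sm).
Context (X : completeMetricType R) (a : nat -> X) (ker : int -> nat -> borel X -> R) (v : int ->
  R) (rho rad A B q : R) (N : nat).
Context (q_gt0 : 0 < q) (q_lt1 : q < 1) (v_gt0 : forall i, 0 < v i) (vS : forall i,
  v (i + 1) = rho * v i)
  (rho_gt1 : 1 < rho) (rhoN : 2 < rho ^+ N) (rad_gt0 : 0 < rad).
Context (mmd : measurable_fun setT (fun z : borel X * borel X => mdist (z.1 : X) z.2)).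
Context (A_ge0 : 0 <= A) (AB : A / rho ^+ N + B = A).
Context (mker : forall i n, measurable_fun setT (ker i n)) (ker_ge0 : forall i n x, 0 <= ker i n x)
  (ker_sum : forall i x, (\sum_(0 <= n <oo) (ker i n x)%:E = 1)%E)
  (ker_near : forall i n x, 0 < ker i n x -> mdist (x : X) (a n) <= rad * v i)
  (ker_diff : forall i x y, (\sum_(0 <= n <oo) `|ker i n x - ker i n y|%:E <= (2 * B * mdist (x : X)
    y / v i)%:E)%E).

(* The levels of the [k]-th of [N] interlaced progressions. *)
Let lvl (k : nat) (i : int) : int := k%:Z + N%:Z * i.
Let vk k i := v (lvl k i).

Let vkS k i : vk k (i + 1) = rho ^+ N * vk k i.
Proof.
have h n j : v (j + n%:Z) = rho ^+ n * v j.
  elim: n => [|n IH]; first by rewrite addr0 mul1r.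
  by rewrite exprS -mulrA -IH -vS -addn1 PoszD addrA.
by rewrite /vk -h /lvl; congr v; ring.
Qed.

Let N_gt0 : (0 < N)%N.
Proof. by case: N rhoN => //; rewrite expr0 (ltr_nat R 2 1). Qed.

Let co := iid s1 s2.
Let co_indep := iid_indep ms1 ms2 s12.
Let mco := measurable_iid ms1 ms2.

Let lim_exists k Q := climb_limit co_indep mco msm sm_law sm_dist (fun i => v_gt0 (lvl k i)) (vkS k)
  rhoN rad_gt0 mmd A_ge0 AB
  (fun i => mker (lvl k i)) (fun i => ker_ge0 (lvl k i)) (fun i => ker_sum (lvl k i)) (fun i =>
    ker_near (i := lvl k i))
  (fun i => ker_diff (lvl k i)) Q.

(** The uniform law on the [N] progressions, itself drawn by [sm]. *)
Let p k : R := if (k < N)%N then N%:R^-1 else 0.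

Let pp : prob_vec p.
Proof.
split; first by move=> k; rewrite /p; case: ifP => // _; rewrite invr_ge0.
rewrite (nneseries_split 0 N) => [|k _]; last by rewrite lee_fin /p; case: ifP => // _;
  rewrite invr_ge0.
rewrite add0n eseries0 => [|k Nk _]; last by rewrite /p ltnNge Nk.
rewrite adde0 sumEFin big_mkord (eq_bigr (fun=> N%:R^-1)) => [|k _]; last by rewrite /p ltn_ord.
by rewrite sumr_const card_ord -[_ *+ N]mulr_natr mulVf// pnatr_eq0 -lt0n.
Qed.

(** The progression is drawn once for all laws [Q], so the costs of the [N] simultaneous couplings
    are averaged for every pair at the same time. Together, the [N] sums over scales form one sum of
    ratio [rho], to which [sum_kink_le] applies. *)
Lemma averaged : exists g : probability (borel X) R -> Om -> borel X,
  [/\ forall Q, measurable_fun setT (g Q), forall (Q : probability (borel X) R) D, measurable D ->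
    P (g Q @^-1` D) = Q D &
  forall (Q Q' : probability (borel X) R) d' (Om' : measurableType d') (P' : probability Om' R)
    (U V : Om' -> borel X),
    measurable_fun setT U -> measurable_fun setT V ->
    (forall S, measurable S -> P' (U @^-1` S) = Q S) -> (forall S, measurable S ->
      P' (V @^-1` S) = Q' S) ->
    (\int[P]_x (mdist (g Q x : X) (g Q' x) `^ q)%:E <=
     ((2 * rad) `^ q * 2 * (1 + (rho ^+ N) `^ q) * (rho * A `^ q / (q * (1 - q))) / (N%:R *
       ln rho))%:E *
       \int[P']_x (mdist (U x : X) (V x) `^ q)%:E)%E].
Proof.
have [G' hG'] := choice (fun kQ : nat * probability (borel X) R => lim_exists kQ.1 kQ.2).
pose G k Q := G' (k, Q); have hG k Q := hG' (k, Q); rewrite /= in hG.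
pose idx := sm p.
have pidx k : P [set x | idx x = k] = (p k)%:E by exact: sm_law.
have midx k : measurable [set x | idx x = k] by exact: msm.
have mG k Q : measurable_fun setT (G k Q) by have [] := hG k Q.
pose g Q := mix s1 s2 idx (fun k => G k Q).
have mg Q : measurable_fun setT (g Q) by apply: measurable_mix.
exists g; split => //.
  move=> Q; apply: (mix_law ms1 ms2 s12 midx pidx) => //; first by case: pp.
  by move=> k; have [] := hG k Q.
move=> Q Q' d' Om' P' U V mU mV UQ VQ.
pose mn (d w : R) : R := Num.min 1 (A * d / w).
pose w k n t := vk k (n%:Z - t%:Z).
pose H k n t (d : R) : R := (2 * rad * w k n t) `^ q * 2 * (mn d (w k n t) + mn d (w k n t.+1)).
pose C := (2 * rad) `^ q * 2 * (1 + (rho ^+ N) `^ q) * (rho * A `^ q / (q * (1 - q))) /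
  (N%:R * ln rho).
pose D x := mdist (U x : X) (V x).
have mD : measurable_fun setT D by exact: measurable_mdist.
have D0 x : 0 <= D x by exact: mdist_ge0.
have w0 k n t : 0 < w k n t by exact: v_gt0.
have mn0 d u : 0 <= d -> 0 < u -> 0 <= mn d u.
  by move=> d0 u0; rewrite /mn le_min ler01 divr_ge0 ?mulr_ge0// ltW.
have mmn u : measurable_fun setT (fun x => mn (D x) u).
  by apply: measurable_minr => //; apply: measurable_funM => //; apply: measurable_funM.
have mH k n t : measurable_fun setT (fun x => H k n t (D x)).
  by apply: measurable_funM => //; apply: measurable_funD.
have H0 k n t d : 0 <= d -> 0 <= H k n t d.
  by move=> d0; rewrite mulr_ge0 ?addr_ge0 ?mn0 ?mulr_ge0 ?powR_ge0.
have point n T (d : R) : 0 <= d -> \sum_(t < T) \sum_(k < N) H k n t d <= N%:R * C * d `^ q.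
  move=> d0; have r0 : 0 < rho by apply: lt_trans rho_gt1.
  have lr : 0 < ln rho by rewrite ln_gt0.
  have Ad : 0 <= A * d by rewrite mulr_ge0.
  (* The weight is that of the coarser scale [w k n t], which is [rho^N] times [w k n t.+1]; the
     second term therefore acquires [(rho^N)^q]. *)
  have HE k t : H k n t d = (2 * rad) `^ q * 2 * kink q (A * d) (w k n t) + (2 * rad) `^ q * 2 *
    (rho ^+ N) `^ q * kink q (A * d) (w k n t.+1).
    have wE : w k n t = rho ^+ N * w k n t.+1.
      by rewrite /w -vkS; congr vk; rewrite -addn1 PoszD; ring.
    rewrite /H powRM ?mulr_ge0 ?(ltW rad_gt0) ?(ltW (w0 _ _ _))// mulrDr.
    congr (_ + _); first by rewrite /kink /mn; ring.
    have wq : w k n t `^ q = (rho ^+ N) `^ q * w k n t.+1 `^ q.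
      by rewrite wE powRM ?exprn_ge0 ?(ltW r0) ?(ltW (w0 _ _ _)).
    by rewrite wq /kink /mn; ring.
  under eq_bigr do under eq_bigr do rewrite HE.
  under eq_bigr do rewrite big_split /= -!mulr_sumr.
  rewrite big_split /= -!mulr_sumr.
  have h1 := sum_kink_le q_gt0 q_lt1 N T n%:Z v_gt0 vS (ltW rho_gt1) Ad.
  have h2 := sum_kink_le q_gt0 q_lt1 N T (n%:Z - 1) v_gt0 vS (ltW rho_gt1) Ad.
  set S1 := \sum_(t < T) _ in h1; set S2 := \sum_(t < T) _ in h2.
  rewrite -[X in _ * X + _]/S1.
  have -> : \sum_(i < T) \sum_(k < N) kink q (A * d) (w k n i.+1) = S2.
    apply: eq_bigr => t _; apply: eq_bigr => k _; congr kink; rewrite /w /vk /lvl; congr v.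
    by rewrite -addn1 PoszD; ring.
  rewrite powRM// in h1 h2.
  have K0 : 0 <= (2 * rad) `^ q * 2 by rewrite mulr_ge0 ?powR_ge0.
  have K1 : 0 <= (2 * rad) `^ q * 2 * (rho ^+ N) `^ q by rewrite mulr_ge0 ?powR_ge0.
  rewrite -ler_pdivlMr// in h1; rewrite -ler_pdivlMr// in h2.
  apply: le_trans (lerD (ler_wpM2l K0 h1) (ler_wpM2l K1 h2)) _.
  apply: le_of_eq; rewrite /C; field.
  by rewrite !gt_eqF// ?subr_gt0// ltr0n.
have p0 k : 0 <= p k by case: pp.
(* The cost is truncated at [M], with an error [e] that is sent to 0 at once. *)
have trunc M : 0 < M -> (\int[P]_x (Num.min (mdist (g Q x : X) (g Q' x) `^ q) M)%:E <= C%:E *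
  \int[P']_x (D x `^ q)%:E)%E.
  move=> M0; apply/lee_addgt0Pr => e e0; rewrite addeC.
  pose f k x := (Num.min (mdist (G k Q x : X) (G k Q' x) `^ q) M)%:E.
  have mf k : measurable_fun setT (f k).
    apply/measurable_EFinP; apply: measurable_minr => //.
    have mp := @measurable_powR R q.
    by move: (measurableT_comp mp (measurable_mdist mmd (mG k Q) (mG k Q'))).
  have f0 k x : (0 <= f k x)%E by rewrite lee_fin le_min powR_ge0 ltW.
  rewrite -[leLHS]/(\int[P]_x mix s1 s2 idx f x)%E (mix_integral ms1 ms2 s12 midx pidx mf f0).
  have main k := truncated_cost_le co_indep mco msm sm_law sm_dist (fun i => v_gt0 (lvl k i))
    (vkS k) rhoN rad_gt0 mmd A_ge0 AB
    (fun i => mker (lvl k i)) (fun i => ker_ge0 (lvl k i)) (fun i => ker_sum (lvl k i)) (fun i =>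
      ker_near (i := lvl k i))
    (fun i => ker_diff (lvl k i)) q_gt0 mU mV UQ VQ (mG k Q) (mG k Q')
    (let: And3 _ _ h := hG k Q in h) (let: And3 _ _ h := hG k Q' in h) M0 e0.
  have [n0 hn0] := choice main.
  (* A starting level high enough for all [N] progressions. *)
  pose n := \max_(k < N) n0 k.
  have {hn0} bnd k : (k < N)%N -> (\int[P]_x f k x <= e%:E + \sum_(0 <= t <oo) \int[P']_x
    (H k n t (D x))%:E)%E.
    move=> kN; apply: le_trans (hn0 k n _) _; first by rewrite /n (bigD1 (Ordinal kN))//= leq_maxl.
    apply: le_of_eq; congr (_ + _)%E; apply: eq_eseriesr => t _.
    rewrite -ge0_integralD//; last 4 first.
    - by move=> x _; rewrite lee_fin; exact: (mn0 _ _ (D0 x) (w0 k n t)).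
    - by apply/measurable_EFinP; exact: (mmn (w k n t)).
    - by move=> x _; rewrite lee_fin; exact: (mn0 _ _ (D0 x) (w0 k n t.+1)).
    - by apply/measurable_EFinP; exact: (mmn (w k n t.+1)).
    rewrite -ge0_integralZl_EFin//.
    - move=> x _; rewrite -EFinD lee_fin.
      by apply: addr_ge0; [exact: (mn0 _ _ (D0 x) (w0 k n t))|exact: (mn0 _ _ (D0 x)
        (w0 k n t.+1))].
    - apply: emeasurable_funD; apply/measurable_EFinP;
      [exact: (mmn (w k n t))|exact: (mmn (w k n t.+1))].
    - by rewrite mulr_ge0 ?powR_ge0.
  rewrite (nneseries_split 0 N) => [|k _]; last by rewrite mule_ge0 ?lee_fin ?p0 ?integral_ge0.
  rewrite add0n [X in (_ + X <= _)%E]eseries0 => [|k Nk _]; last by rewrite /p ltnNge Nk mul0e.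
  rewrite adde0 big_mkord.
  apply: (@le_trans _ _ (\sum_(k < N) ((N%:R^-1)%:E * (e%:E + \sum_(0 <= t <oo) \int[P']_x
    (H k n t (D x))%:E)))%E).
    by apply: lee_sum => k _; rewrite /p ltn_ord; apply: lee_wpmul2l;
      [rewrite lee_fin invr_ge0|exact: bnd].
  have I0 k t : (0 <= \int[P']_x (H k n t (D x))%:E)%E by apply: integral_ge0 => x _;
    rewrite lee_fin H0.
  rewrite -ge0_sume_distrr; last by move=> k _; rewrite adde_ge0 ?lee_fin ?(ltW e0) ?nneseries_ge0.
  rewrite big_split /= sumEFin sumr_const card_ord -nneseries_sum//.
  pose S t x := \sum_(k < N) H k n t (D x).
  have S0 t x : 0 <= S t x by apply: sumr_ge0 => k _; exact: H0.
  have mS t : measurable_fun setT (fun x => (S t x)%:E).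
    by apply/measurable_EFinP; apply: measurable_sum => k; exact: mH.
  have SE t : (\sum_(k < N) \int[P']_x (H k n t (D x))%:E = \int[P']_x (S t x)%:E)%E.
    rewrite -ge0_integral_sum//.
    - by apply: eq_integral => x _; rewrite sumEFin.
    - by move=> k; apply/measurable_EFinP; exact: mH.
    - by move=> k x _; rewrite lee_fin H0.
  under eq_eseriesr do rewrite SE.
  rewrite -integral_nneseries//; last by move=> t x _; rewrite lee_fin.
  have N0 : (0 : R) < N%:R by rewrite ltr0n.
  have C0 : 0 <= C.
    by rewrite !mulr_ge0 ?invr_ge0 ?powR_ge0 ?addr_ge0 ?powR_ge0 ?mulr_ge0 ?subr_ge0 ?(ltW q_lt1)
      ?(ltW q_gt0) ?(ltW N0) ?ln_ge0 ?(ltW rho_gt1) ?(le_trans ler01 (ltW rho_gt1)).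
  rewrite ge0_muleDr ?lee_fin ?mulrn_wge0 ?(ltW e0) ?integral_ge0//; last first.
    by move=> x _; apply: nneseries_ge0 => t _ _; rewrite lee_fin.
  rewrite -EFinM -[e *+ N]mulr_natr mulrCA mulVf ?mulr1 ?gt_eqF//; apply: leeD2l.
  have mDq : measurable_fun setT (fun x => (D x `^ q)%:E).
    apply/measurable_EFinP; have mp := @measurable_powR R q.
    by move: (measurableT_comp mp mD).
  apply: (@le_trans _ _ ((N%:R^-1)%:E * \int[P']_x ((N%:R * C)%:E * (D x `^ q)%:E))%E).
    apply: lee_wpmul2l; first by rewrite lee_fin invr_ge0.
    apply: ge0_le_integral => //.
    - by move=> x _; apply: nneseries_ge0 => t _ _; rewrite lee_fin.
    - by apply: ge0_emeasurable_sum => // t x _ _; rewrite lee_fin.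
    - exact: emeasurable_funM.
    - by move=> x _; rewrite -EFinM; apply: nneseries_le_partial => // T; exact: point.
  rewrite ge0_integralZl_EFin//.
  - by rewrite muleA -EFinM mulrA mulVf ?gt_eqF// mul1r.
  - by move=> x _; rewrite lee_fin powR_ge0.
  - by rewrite mulr_ge0// ltW.
(* Monotone convergence in the truncation level removes the truncation. *)
pose F (m : nat) (x : Om) : \bar R := (Num.min (mdist (g Q x : X) (g Q' x) `^ q) m.+1%:R)%:E.
have mdq : measurable_fun setT (fun x => mdist (g Q x : X) (g Q' x) `^ q).
  have mp := @measurable_powR R q.
  by move: (measurableT_comp mp (measurable_mdist mmd (mg Q) (mg Q'))).
have mF m : measurable_fun setT (F m) by apply/measurable_EFinP; exact: measurable_minr.
have F0 m x : [set: Om] x -> (0 <= F m x)%E by move=> _; rewrite /F lee_fin le_min powR_ge0 /=.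
have ndF x : [set: Om] x -> nondecreasing_seq (F^~ x).
  move=> _ m m' mm'; rewrite lee_fin le_min !ge_min lexx /=; apply/orP; right.
  by rewrite ler_nat.
have := cvg_monotone_convergence (mu := P) measurableT mF F0 ndF.
have -> : (\int[P]_x limn (F^~ x) = \int[P]_x (mdist (g Q x : X) (g Q' x) `^ q)%:E)%E.
  apply: eq_integral => x _; apply/cvg_lim => //.
  apply: cvg_near_cst; exists (Num.truncn (mdist (g Q x : X) (g Q' x) `^ q)) => // m /= hm.
  rewrite /F; congr EFin; apply: min_l; apply/ltW.
  by apply: lt_le_trans (truncnS_gt _) _; rewrite ler_nat ltnS.
move=> cv; rewrite -(cvg_lim _ cv)//; apply: lime_le; first by apply/cvg_ex; eexists; exact: cv.
by apply: nearW => m; exact: trunc.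
Qed.

End average.

(** * Kernels from the measures of balls *)

Section ball_kernel.
Context (R : realType) (X : completeMetricType R).
Context (mmd : measurable_fun setT (fun z : borel X * borel X => mdist (z.1 : X) z.2)).
Context (mu : {sigma_finite_measure set (borel X) -> \bar R}) (Psi : R).
Context (mu_ball : forall (x : X) (w : R), 0 < w -> (0 < mu (mcball x w) < +oo)%E).
Context (mu_diff : forall (x y : X) (w : R), 0 < w ->
     (mu (mcball x w `\` mcball y w) / mu (mcball x w) <= (Psi * mdist x y / w)%:E)%E).
Context (a : nat -> X) (a_dense : forall (x : X) (e : R), 0 < e -> exists n, mdist x (a n) < e).
Context (eps : R) (eps_gt0 : 0 < eps).

(** A point is assigned to the first [a n] within [eps * w] of it, so that the cells are disjoint
    and cover the space. *)
Definition cell (w : R) (n : nat) : set (borel X) :=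
  [set x | mdist (x : X) (a n) < eps * w /\ forall m, (m < n)%N -> ~ mdist (x : X) (a m) < eps * w].

Let mdr (y : X) : measurable_fun setT (fun x : borel X => mdist (x : X) y).
Proof.
have h : measurable_fun setT (fun x : borel X => (x, y : borel X)) by exact: measurable_fun_pair.
by move: (measurableT_comp mmd h).
Qed.

Lemma measurable_cell w n : measurable (cell w n).
Proof.
have mn (y : X) (e : R) : measurable [set x : borel X | mdist (x : X) y < e].
  rewrite (_ : [set x | _] = (fun x : borel X => mdist (x : X) y) @^-1` `]-oo, e[%classic).
    by rewrite -[X in measurable X]setTI; apply: mdr.
  by apply/seteqP; split => x /=; rewrite in_itv.
have -> : cell w n = [set x | mdist (x : X) (a n) < eps * w] `&`
    \bigcap_m [set x | (m < n)%N -> ~ mdist (x : X) (a m) < eps * w].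
  by apply/seteqP; split => x [h1 h2]; split => // m; [move=> _; exact: h2|exact: (h2 m I)].
apply: measurableI => //; apply: bigcapT_measurable => m.
have [mn'|mn'] := boolP (m < n)%N.
  rewrite (_ : [set x | _] = ~` [set x : borel X | mdist (x : X) (a m) < eps * w]);
    first exact: measurableC.
  by apply/seteqP; split => x; [exact|move=> h _].
by rewrite (_ : [set x | _] = setT)//; apply/seteqP; split.
Qed.

Lemma trivIset_cell w : trivIset setT (cell w).
Proof.
move=> i j _ _ [x [[xi hi] [xj hj]]].
by case: (ltngtP i j) => // h; [case: (hj i h)|case: (hi j h)].
Qed.

Lemma cover_cell w : 0 < w -> \bigcup_n cell w n = setT.
Proof.
move=> w0; apply/seteqP; split => // x _.
have [n hn] := a_dense x (mulr_gt0 eps_gt0 w0).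
have [m hm min] := ex_minnP (ex_intro (fun n => mdist x (a n) < eps * w) n hn).
exists m => //; split => // k km hk; have := min k hk; by rewrite leqNgt km.
Qed.

Lemma measurable_mcball (x : X) w : measurable (mcball x w : set (borel X)).
Proof.
rewrite (_ : mcball x w = (fun y : borel X => mdist (y : X) x) @^-1` `]-oo, w]%classic).
  by rewrite -[X in measurable X]setTI; apply: mdr.
by apply/seteqP; split => y /=; rewrite in_itv/= metric_sym.
Qed.

Definition ball_mass (w : R) (C : set (borel X)) (x : X) : R := fine (mu (mcball x w `&` C)).

Section radius.
Context (w : R) (w_gt0 : 0 < w).

Lemma ball_massE C x : measurable C -> (ball_mass w C x)%:E = mu (mcball x w `&` C).
Proof.
move=> mC; rewrite fineK// ge0_fin_numE//.
have /andP[_] := mu_ball x w_gt0; apply: le_lt_trans; apply: le_measure; rewrite ?inE.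
- by apply: measurableI => //; exact: measurable_mcball.
- exact: measurable_mcball.
- by move=> y [].
Qed.

Lemma ball_mass_ge0 C x : 0 <= ball_mass w C x.
Proof. exact: fine_ge0. Qed.

Lemma ball_mass_gt0 x : 0 < ball_mass w setT x.
Proof. by rewrite -lte_fin ball_massE// setIT; case/andP: (mu_ball x w_gt0). Qed.

(** The mass is the measure of a section of a measurable subset of the product, hence depends
    measurably on [x] for the sigma-finite [mu]. *)
Lemma measurable_ball_mass C : measurable C -> measurable_fun setT (ball_mass w C : borel X -> R).
Proof.
move=> mC.
pose S : set (borel X * borel X) := (fun z => mdist (z.1 : X) z.2) @^-1` `]-oo, w]%classic `&`
  snd @^-1` C.
have mS : measurable S.
  apply: measurableI; rewrite -[X in measurable X]setTI; first exact: mmd.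
  exact: measurable_snd.
have := measurable_fun_xsection mu mS => mx.
have : measurable_fun setT (fun x : borel X => fine (mu (xsection S x))) by exact: measurableT_comp.
congr (measurable_fun _ _); apply/funext => x; rewrite /ball_mass; congr (fine (mu _)).
apply/seteqP; split => y; rewrite /xsection /S /= ?inE /= in_itv/=; by [].
Qed.

Lemma sum_ball_mass (C : set (borel X)) : measurable C -> (\sum_(0 <= n <oo) mu (C `&` cell w n)
  = mu C)%E.
Proof.
move=> mC; rewrite -measure_semi_bigcup//.
- by rewrite -setI_bigcupr cover_cell// setIT.
- by move=> n; apply: measurableI => //; exact: measurable_cell.
- by apply: trivIset_setIl; exact: trivIset_cell.
- by apply: bigcupT_measurable => n; apply: measurableI => //; exact: measurable_cell.
Qed.

Definition ball_kernel n (x : borel X) : R := ball_mass w (cell w n) x / ball_mass w setT x.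

Lemma measurable_ball_kernel n : measurable_fun setT (ball_kernel n).
Proof.
apply: measurable_funM; first by apply: measurable_ball_mass; exact: measurable_cell.
have := measurableT_comp (@measurable_powR R (-1)) (measurable_ball_mass measurableT).
congr (measurable_fun _ _); apply/funext => x /=; exact/powR_inv1/ball_mass_ge0.
Qed.

Lemma ball_kernel_ge0 n x : 0 <= ball_kernel n x.
Proof. by rewrite divr_ge0 ?ball_mass_ge0. Qed.

Lemma ball_kernel_sum x : (\sum_(0 <= n <oo) (ball_kernel n x)%:E = 1)%E.
Proof.
under eq_eseriesr => n _ do rewrite /ball_kernel mulrC EFinM (ball_massE _ (measurable_cell w n)).
rewrite nneseriesZl ?sum_ball_mass//; last exact: measurable_mcball.
rewrite -(setIT (mcball x w)) -ball_massE// -EFinM mulVf// gt_eqF// ball_mass_gt0//.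
Qed.

Lemma ball_kernel_near n x : 0 < ball_kernel n x -> mdist (x : X) (a n) <= (1 + eps) * w.
Proof.
move=> h; have [y [xy [yn _]]] : (mcball (x : X) w `&` cell w n) !=set0.
  apply/set0P; apply/eqP => e; move: h; by rewrite /ball_kernel /ball_mass e measure0 /= mul0r ltxx.
apply: le_trans (metric_triangle (x : X) y (a n)) _; rewrite mulrDl mul1r; apply: lerD => //;
  exact: ltW.
Qed.

(** Both kernels have total mass 1, so the distance is twice the sum of the positive parts. If the
    ball of [x] is the heavier one, replacing the mass of the ball of [y] by that of [x] lowers the
    kernel at [y], so the positive part on a cell is at most the share of the difference of the
    balls in that cell; [mu_diff] bounds the total share. *)
Lemma ball_kernel_diff x y : (\sum_(0 <= n <oo) `|ball_kernel n x - ball_kernel n y|%:E <=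
  (2 * Psi * mdist (x : X) y / w)%:E)%E.
Proof.
wlog le : x y / ball_mass w setT y <= ball_mass w setT x.
  move=> h; have [xy|/ltW xy] := leP (ball_mass w setT y) (ball_mass w setT x); first exact: h.
  under eq_eseriesr do rewrite distrC.
  by rewrite metric_sym; exact: h.
have Mx := ball_mass_gt0 x; have My := ball_mass_gt0 y.
pose D := mcball (x : X) w `\` mcball (y : X) w.
have mD : measurable (D : set (borel X)) by apply: measurableD; exact: measurable_mcball.
have Dx : D = mcball (x : X) w `&` D by apply/seteqP; split => z; [move=> h; split => //;
  case: h|case].
have finD (C : set (borel X)) : measurable C -> (fine (mu (D `&` C)))%:E = mu (D `&` C).
  move=> mC; rewrite Dx -setIA; apply: ball_massE; exact: measurableI.
pose r n := fine (mu (D `&` cell w n)) / ball_mass w setT x.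
have r0 n : 0 <= r n by rewrite divr_ge0 ?fine_ge0// ltW.
have sr : (\sum_(0 <= n <oo) (r n)%:E <= (Psi * mdist (x : X) y / w)%:E)%E.
  under eq_eseriesr => n _ do rewrite /r mulrC EFinM (finD _ (measurable_cell w n)).
  rewrite nneseriesZl ?sum_ball_mass//; apply: le_trans (mu_diff x y w_gt0).
  rewrite -/D muleC; apply: lee_wpmul2l => //.
  by rewrite -[X in (_ <= X^-1)%E](_ : (ball_mass w setT x)%:E = _) ?inver
    ?gt_eqF// ball_massE// setIT.
have key n : `|ball_kernel n x - ball_kernel n y| + ball_kernel n x <= ball_kernel n y + 2 * r n.
  have h : ball_kernel n x - ball_kernel n y <= r n.
    apply: (@le_trans _ _ ((ball_mass w (cell w n) x - ball_mass w (cell w n) y) / ball_mass w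
      setT x)).
      rewrite mulrBl; apply: lerB => //; apply: ler_wpM2l; first exact: ball_mass_ge0.
      by rewrite lef_pV2.
    rewrite ler_pM2r ?invr_gt0// lerBlDr -lee_fin EFinD.
    rewrite (finD _ (measurable_cell w n)) (ball_massE x (measurable_cell w n)) (ball_massE y
      (measurable_cell w n)).
    apply: le_trans (measureU2 _ _ _); [|by apply: measurableI => //;
      exact: measurable_cell|by apply: measurableI;
      [exact: measurable_mcball|exact: measurable_cell]].
    apply: le_measure; rewrite ?inE.
    - by apply: measurableI; [exact: measurable_mcball|exact: measurable_cell].
    - apply: measurableU; first by apply: measurableI => //; exact: measurable_cell.
      by apply: measurableI; [exact: measurable_mcball|exact: measurable_cell].
    - by move=> z [zx zc]; have [zy|zy] := pselect (mcball (y : X) w z); [right|left].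
  by have := r0 n; case: (lerP (ball_kernel n x) (ball_kernel n y)) => hh; lra.
have : (\sum_(0 <= n <oo) (`|ball_kernel n x - ball_kernel n y| + ball_kernel n x)%:E <=
  \sum_(0 <= n <oo) (ball_kernel n y + 2 * r n)%:E)%E.
  apply: lee_nneseries => [n _ _|n _]; rewrite lee_fin; first by rewrite addr_ge0// ball_kernel_ge0.
  exact: key.
under eq_eseriesr do rewrite EFinD.
rewrite nneseriesD; [|by move=> *; rewrite lee_fin ?ball_kernel_ge0..].
under [X in (_ <= X)%E -> _]eq_eseriesr do rewrite EFinD [X in (_ + X)%E]EFinM.
rewrite nneseriesD; [|by move=> *; rewrite ?mule_ge0 ?lee_fin ?ball_kernel_ge0 ?r0..].
rewrite !ball_kernel_sum nneseriesZl; last by move=> n _; rewrite lee_fin.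
rewrite addeC leeD2lE// => h; apply: le_trans h _.
rewrite -!mulrA EFinM; apply: lee_wpmul2l; first by rewrite lee_fin.
by rewrite mulrA.
Qed.

End radius.
End ball_kernel.

(** * Numerical constants *)

Section exponential.
Context (R : realType).

(* The bounds [1 + x <= expR x <= (1 - x)^-1] at [x = 5 / 3 / 2 ^ 12] are squared twelve times,
   rounding outwards to nine decimals. *)
Let dec (a b c d : nat) : R := a%:R + (b%:R + (c%:R + d%:R / 1000) / 1000) / 1000.

Lemma expR53_bounds : 528 / 100 <= expR (5 / 3 : R) <= 5297 / 1000.
Proof.
have dbl (l u x l2 u2 : R) : 0 <= l -> l2 <= l * l -> u * u <= u2 -> l <= expR (x / 2) <= u ->
  l2 <= expR x <= u2.
  move=> l0 hl hu /andP[h1 h2]; rewrite [x in expR x](splitr x) expRD; apply/andP; split.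
    by apply: le_trans hl _; apply: ler_pM.
  by apply: le_trans hu; apply: ler_pM => //; exact: expR_ge0.
pose x12 : R := 5 / 3.
pose x11 := x12 / 2.
pose x10 := x11 / 2.
pose x9 := x10 / 2.
pose x8 := x9 / 2.
pose x7 := x8 / 2.
pose x6 := x7 / 2.
pose x5 := x6 / 2.
pose x4 := x5 / 2.
pose x3 := x4 / 2.
pose x2 := x3 / 2.
pose x1 := x2 / 2.
pose x0 := x1 / 2.
have h0 : dec 1 0 406 901 <= expR x0 <= dec 1 0 407 67.
  apply/andP; split; first by apply: le_trans (expR_ge1Dx _); rewrite /dec /x0 /x1 /x2 /x3 /x4 /x5
    /x6 /x7 /x8 /x9 /x10 /x11 /x12; lra.
  rewrite -[leRHS]invrK -[leLHS]invrK -expRN lef_pV2 ?posrE ?invr_gt0 ?expR_gt0//;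
    last by rewrite /dec; lra.
  apply: le_trans (expR_ge1Dx _); rewrite -[leLHS]mul1r ler_pdivrMr; rewrite /dec /x0 /x1 /x2 /x3
    /x4 /x5 /x6 /x7 /x8 /x9 /x10 /x11 /x12; lra.
have {h0} h1 : dec 1 0 813 967 <= expR x1 <= dec 1 0 814 300.
  by apply: (dbl (dec 1 0 406 901) (dec 1 0 407 67)) h0; rewrite /dec; lra.
have {h1} h2 : dec 1 1 628 596 <= expR x2 <= dec 1 1 629 264.
  by apply: (dbl (dec 1 0 813 967) (dec 1 0 814 300)) h1; rewrite /dec; lra.
have {h2} h3 : dec 1 3 259 844 <= expR x3 <= dec 1 3 261 183.
  by apply: (dbl (dec 1 1 628 596) (dec 1 1 629 264)) h2; rewrite /dec; lra.
have {h3} h4 : dec 1 6 530 314 <= expR x4 <= dec 1 6 533 2.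
  by apply: (dbl (dec 1 3 259 844) (dec 1 3 261 183)) h3; rewrite /dec; lra.
have {h4} h5 : dec 1 13 103 273 <= expR x5 <= dec 1 13 108 685.
  by apply: (dbl (dec 1 6 530 314) (dec 1 6 533 2)) h4; rewrite /dec; lra.
have {h5} h6 : dec 1 26 378 241 <= expR x6 <= dec 1 26 389 208.
  by apply: (dbl (dec 1 13 103 273) (dec 1 13 108 685)) h5; rewrite /dec; lra.
have {h6} h7 : dec 1 53 452 293 <= expR x7 <= dec 1 53 474 807.
  by apply: (dbl (dec 1 26 378 241) (dec 1 26 389 208)) h6; rewrite /dec; lra.
have {h7} h8 : dec 1 109 761 733 <= expR x8 <= dec 1 109 809 169.
  by apply: (dbl (dec 1 53 452 293) (dec 1 53 474 807)) h7; rewrite /dec; lra.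
have {h8} h9 : dec 1 231 571 104 <= expR x9 <= dec 1 231 676 392.
  by apply: (dbl (dec 1 109 761 733) (dec 1 109 809 169)) h8; rewrite /dec; lra.
have {h9} h10 : dec 1 516 767 384 <= expR x10 <= dec 1 517 26 735.
  by apply: (dbl (dec 1 231 571 104) (dec 1 231 676 392)) h9; rewrite /dec; lra.
have {h10} h11 : dec 2 300 583 297 <= expR x11 <= dec 2 301 370 115.
  by apply: (dbl (dec 1 516 767 384) (dec 1 517 26 735)) h10; rewrite /dec; lra.
have {h11} h12 : dec 5 292 683 506 <= expR x12 <= dec 5 296 304 407.
  by apply: (dbl (dec 2 300 583 297) (dec 2 301 370 115)) h11; rewrite /dec; lra.
move: h12; rewrite /x12 => /andP[a b]; apply/andP; split; [apply: le_trans a|apply: le_trans b _];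
  rewrite /dec; lra.
Qed.
End exponential.

(** * From the unit interval to couplings *)

Section line.
Context (R : realType).
Local Notation lambda := (@completed_lebesgue_measure R).

(** The identity from the Lebesgue measurable sets to the Borel sets: couplings live on the former,
    the construction above on the latter. *)
Definition line_id (x : lebesgue_line R) : measurableTypeR R := x.

Lemma measurable_line_id : measurable_fun setT line_id.
Proof. by move=> _ A mA; rewrite setTI; exact: sub_caratheodory. Qed.

Lemma measurable_I01 : measurable (I01 R).
Proof.
rewrite (_ : I01 R = line_id @^-1` `[0, 1]%classic)//.
by rewrite -[X in measurable X]setTI; apply: measurable_line_id.
Qed.

(** The intervals [[0, 1]] and [[0, 1[] differ by a null set. *)
Lemma line_unif (A : set (measurableTypeR R)) : measurable A -> lambda (I01 R `&` line_id @^-1` A) =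
  unif01 A.
Proof.
move=> mA; rewrite -[LHS]/(lebesgue_measure (`[0:R, 1]%classic `&` A)) /unif01 /mrestr.
have m1 : measurable ([set 1 : R] : set (measurableTypeR R)) by exact: measurable_set1.
apply/eqP; rewrite eq_le; apply/andP; split.
  apply: (@le_measure_null _ _ _ lebesgue_measure _ _ [set 1]) => //.
  - by apply: measurableI.
  - by apply: measurableI.
  - exact: lebesgue_measure_set1.
  - move=> x [] /=; rewrite !in_itv/= => /andP[x0 x1] Ax.
    by move: x1; rewrite le_eqVlt => /predU1P[->|x1]; [right|left; rewrite x0].
apply: le_measure; rewrite ?inE; try exact: measurableI.
by move=> x [Ax] /=; rewrite !in_itv/= => /andP[-> /ltW->].
Qed.

Definition line01 : set (lebesgue_line R) -> \bar R := mrestr lambda measurable_I01.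
HB.instance Definition _ := Measure.on line01.
Let line01_setT : line01 setT = 1%E.
Proof.
rewrite /line01 /mrestr setTI.
have := line_unif measurableT; rewrite preimage_setT setIT => ->; exact: probability_setT.
Qed.
HB.instance Definition _ := Measure_isProbability.Build _ _ _ line01 line01_setT.

Lemma line_integral (f : measurableTypeR R -> \bar R) : measurable_fun setT f ->
  (forall x, 0 <= f x)%E ->
  (\int[lambda]_(x in I01 R) f (line_id x) = \int[@unif01 R]_x f x)%E.
Proof.
move=> mf f0; rewrite -(ge0_integral_mrestr lambda measurable_I01)//;
  last by move: (measurableT_comp mf measurable_line_id).
transitivity (\int[push line01 measurable_line_id]_x f x)%E.
  by rewrite ge0_integral_pushforward//; exact: measurable_line_id.
by apply: eq_measure_integral => A mA _; have := line_unif mA; rewrite setIC.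
Qed.

Section variables.
Context d (T : measurableType d) (pt : T).

Lemma has_law_line (g : measurableTypeR R -> T) (Q : probability T R) : measurable_fun setT g ->
  (forall A, measurable A -> unif01 (g @^-1` A) = Q A) -> has_law (g \o line_id) Q.
Proof.
move=> mg gQ; split.
  have mX : measurable_fun setT (g \o line_id) := measurableT_comp mg measurable_line_id.
  have sX : I01 R `<=` setT by [].
  exact: (measurable_funS measurableT sX mX).
move=> A mA; have mgA : measurable (g @^-1` A) by rewrite -[X in measurable X]setTI; exact: mg.
by rewrite -(gQ A mA) -(line_unif mgA).
Qed.

(** A competing variable is only known to be measurable on [I01]. Making it constant elsewhere gives
    a variable on a probability space, with the same law and cost. *)
Definition on_unit (X : lebesgue_line R -> T) (x : lebesgue_line R) : T :=
  if x \in I01 R then X x else pt.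

Lemma measurable_on_unit (X : lebesgue_line R -> T) : measurable_fun (I01 R) X ->
  measurable_fun setT (on_unit X).
Proof.
move=> mX; rewrite -(setUv (I01 R)); apply/measurable_funU;
  [exact: measurable_I01|exact: measurableC measurable_I01|split].
  by apply: (eq_measurable_fun X) => // x xI; rewrite /on_unit xI.
by apply: (eq_measurable_fun (cst pt)) => // x; rewrite in_setC /on_unit => /negbTE ->.
Qed.

Lemma on_unit_law (X : lebesgue_line R -> T) (Q : probability T R) : has_law X Q -> forall A,
  measurable A ->
  line01 (on_unit X @^-1` A) = Q A.
Proof.
move=> [_ XQ] A mA; rewrite -XQ// /line01 /mrestr; congr (lambda _).
by apply/seteqP; split => x /= [h1 h2]; split => //; move: h1 h2; rewrite /on_unit => h1 h2;
  [move: h1|]; rewrite mem_set.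
Qed.

Lemma on_unit_cost (c : T -> T -> R) (X Y : lebesgue_line R -> T) : measurable_fun setT (fun z =>
  c z.1 z.2) ->
  (forall x y, 0 <= c x y) -> measurable_fun (I01 R) X -> measurable_fun (I01 R) Y ->
  (\int[line01]_x (c (on_unit X x) (on_unit Y x))%:E)%E = expected_cost c X Y.
Proof.
move=> mc c0 mX mY; rewrite (ge0_integral_mrestr lambda measurable_I01).
- by apply: eq_integral => x xI; rewrite /on_unit xI.
- apply/measurable_EFinP.
  have h : measurable_fun setT (fun x => (on_unit X x, on_unit Y x)).
    by apply: measurable_fun_pair; exact: measurable_on_unit.
  by move: (measurableT_comp mc h).
- by move=> x; rewrite lee_fin.
Qed.

End variables.
End line.

(** * The constants of the final bound *)

Section constants.
Context (R : realType).

(** Since [q < 1], the ratio of the scales exceeds [e^(5/3) >= 5.28], and [t / (t - 1)]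
    decreases. *)
Lemma exp_ratio (q : R) : 0 < q -> q < 1 -> expR (5 / 3 / q) / (expR (5 / 3 / q) - 1) <= 528 / 428.
Proof.
move=> q0 q1; set th := expR _.
have th0 : 528 / 100 <= th.
  case/andP: (@expR53_bounds R) => h _; apply: le_trans h _; rewrite ler_expR ler_pdivlMr//; lra.
rewrite ler_pdivrMr; lra.
Qed.

Lemma expR53_div_gt2 (q : R) : 0 < q -> q < 1 -> 2 < expR (5 / 3 / q).
Proof.
move=> q0 q1; case/andP: (@expR53_bounds R) => h _.
have : expR (5 / 3) <= expR (5 / 3 / q) by rewrite ler_expR ler_pdivlMr//; lra.
lra.
Qed.

(** [Psi * theta / (theta - 1)] is the sum of the geometric series [Psi * (1 + theta^-1 + ...)]. *)
Lemma kappa_fixpoint (Psi theta : R) : 1 < theta -> Psi * theta / (theta - 1) / theta + Psi = Psi *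
  theta / (theta - 1).
Proof.
move=> h; have h1 : 0 < theta - 1 by rewrite subr_gt0.
by field; rewrite !gt_eqF// (lt_trans ltr01).
Qed.

Lemma cell_scale_gt0 : (0 : R) < 1 / 1000.
Proof. by lra. Qed.

Lemma constant_collect (q m A e rho : R) : 0 < q -> q < 1 -> 0 <= m -> 0 <= A ->
  m `^ q * 2 * (1 + e) * (rho * A `^ q / (q * (1 - q))) / (5 / 3 / q) = rho * (6 / 5) * (1 + e) *
    ((m * A) `^ q / (1 - q)).
Proof.
move=> q0 q1 m0 A0; have q10 : 0 < 1 - q by rewrite subr_gt0.
rewrite powRM//; move: (m `^ q) (A `^ q) => u v.
by field; rewrite !gt_eqF.
Qed.

(** Two numerical facts: [2.002 * 528 / 428 <= 2.47], and [6/5 * (1 + 5.297) = 7.5564], which stays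
    below 7.56 after multiplication by [1.0004], the bound on [rho]. *)
Lemma constant_lt (q Psi rho : R) : 0 < q -> q < 1 -> 0 < Psi -> 0 < rho ->
  rho <= 1 + 1 / 50 / 50 ->
  forall theta A, theta = expR (5 / 3 / q) -> A = Psi * theta / (theta - 1) ->
  (2 * (1 + 1 / 1000)) `^ q * 2 * (1 + theta `^ q) * (rho * A `^ q / (q * (1 - q))) / (5 / 3 / q) <
  756 / 100 * ((247 / 100 * Psi) `^ q / (1 - q)).
Proof.
move=> q0 q1 P0 r0 r1 theta A thE AE.
have q10 : 0 < 1 - q by rewrite subr_gt0.
have /andP[E1 E2] := @expR53_bounds R.
have tq : theta `^ q = expR (5 / 3) by rewrite thE -expRM divfK// gt_eqF.
have k1 := exp_ratio q0 q1; rewrite -thE in k1.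
have th1 : 1 < theta by rewrite thE expR_gt1 !divr_gt0.
have A0 : 0 <= A by rewrite AE !mulr_ge0 ?(ltW P0) ?(ltW (lt_trans ltr01 th1))// invr_ge0
  subr_ge0 ltW.
have AP : 2 * (1 + 1 / 1000) * A <= 247 / 100 * Psi.
  have -> : A = Psi * (theta / (theta - 1)) by rewrite AE mulrA.
  move: (theta / (theta - 1)) k1 => k k1.
  have : Psi * k <= Psi * (528 / 428) by rewrite ler_pM2l.
  by clear -P0; lra.
have : (0 : R) <= 2 * (1 + 1 / 1000) by clear; lra.
move: AP; move: (2 * (1 + 1 / 1000)) => m AP m0.
rewrite constant_collect// tq.
have K0 : (0 : R) < 247 / 100 by clear; lra.
move: (247 / 100) AP K0 => K AP K0; have hm : 0 <= m * A by rewrite mulr_ge0.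
have hP : (m * A) `^ q <= (K * Psi) `^ q.
  by apply: ge0_ler_powR => //; rewrite ?nnegrE ?(ltW q0)//; exact: le_trans AP.
have : 0 < (K * Psi) `^ q.
  by rewrite powR_gt0// mulr_gt0.
move: ((K * Psi) `^ q) hP => u hP u0.
apply: (@le_lt_trans _ _ (rho * (6 / 5) * (1 + expR (5 / 3)) * (u / (1 - q)))).
  apply: ler_wpM2l; last by rewrite ler_pM2r// invr_gt0.
  by rewrite !mulr_ge0 ?(ltW r0)// ?addr_ge0 ?expR_ge0.
rewrite ltr_pM2r ?divr_gt0// -mulrA; move: (expR _) E1 E2 => e E1 E2.
have : rho * (6 / 5 * (1 + e)) <= (1 + 1 / 50 / 50) * (6 / 5 * (1 + e)).
  apply: ler_wpM2r => //; clear -E1; lra.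
clear -E1 E2; lra.
Qed.

Lemma expR_le_inv (h : R) : h < 1 -> expR h <= (1 - h)^-1.
Proof.
move=> h1; rewrite -[leLHS]invrK -expRN lef_pV2 ?posrE ?invr_gt0 ?expR_gt0 ?subr_gt0//.
exact: expR_ge1Dx.
Qed.

Lemma expR_small_le (h : R) : h <= 1 / 50 / 100 -> expR h <= 1 + 1 / 50 / 50.
Proof.
move=> h1; have h2 : h < 1 by lra.
apply: le_trans (expR_le_inv h2) _.
have h3 : 0 < 1 - h by lra.
by rewrite -[leLHS]mul1r ler_pdivrMr//; lra.
Qed.

(** [coupling_ratio] is an infimum over [r >= 1], so the announced bound must exceed 1. Here
    [2.47 / 3 >= 0.8], and [7.56 * 0.8] is ample. *)
Lemma one_lt_target (q Psi : R) : 0 < q -> q < 1 -> 1 <= 3 * Psi ->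
  1 < 756 / 100 * ((247 / 100 * Psi) `^ q / (1 - q)).
Proof.
move=> q0 q1 P3; have q10 : 0 < 1 - q by rewrite subr_gt0.
have : 8 / 10 <= 247 / 100 * Psi by clear -P3; lra.
move: (247 / 100 * Psi) => y hy.
have h1 : 8 / 10 <= (8 / 10) `^ q :> R.
  by apply: ger1_powR; [apply/andP; split; lra|exact: ltW].
have h2 : (8 / 10 : R) `^ q <= y `^ q.
  by apply: ge0_ler_powR; rewrite ?nnegrE ?(ltW q0)//; lra.
have h3 : y `^ q <= y `^ q / (1 - q).
  by rewrite ler_pdivlMr// ler_piMr ?powR_ge0//; lra.
lra.
Qed.

End constants.

Section setup.
Context (R : realType) (X : completeMetricType R).

Lemma dense_sequence : separable X -> exists a : nat -> X, forall (x : X) (e : R), 0 < e ->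
  exists n, mdist x (a n) < e.
Proof.
move=> [D /countable_injP[f fI] dD].
exists (fun n => xget point [set d | D d /\ f d = n]) => x e e0.
have [y [xy Dy]] := dD (thick [set x] e) (ex_intro _ x (sub_thick e0 (erefl x))) (open_thick _ _).
exists (f y); case: xgetP => [z zE [Dz fz]|/(_ y)]; last by move=> h; case: h.
have -> : z = y by apply: fI; rewrite ?inE.
by move/thickP: xy => [_ ->].
Qed.

(** Joint measurability of the distance for the product sigma-algebra is inherited from the cost, of
    which it is the power [1 / q]. *)
Lemma measurable_mdist_of_powR (q : R) (c : X -> X -> R) : 0 < q -> (forall x y,
  c x y = mdist x y `^ q) ->
  measurable_fun setT (fun z : borel X * borel X => c z.1 z.2) ->
  measurable_fun setT (fun z : borel X * borel X => mdist (z.1 : X) z.2).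
Proof.
move=> q0 cE mc; have := measurableT_comp (@measurable_powR R q^-1) mc.
congr (measurable_fun _ _); apply/funext => z /=.
by rewrite cE -powRrM mulfV ?gt_eqF// powRr1 ?mdist_ge0.
Qed.

(** Enough progressions bring the loss [rho] of the comparison with the integral under the allowance
    of [constant_lt]. *)
Lemma fine_scale (s : R) : 0 < s -> exists N : nat, (0 < N)%N /\ expR (s / N%:R) <= 1 + 1 / 50 / 50.
Proof.
move=> s0; pose n := Num.truncn (s * 50 * 100).
exists n.+1; split => //.
have hn : s * 50 * 100 < n.+1%:R by exact: truncnS_gt.
apply: expR_small_le; rewrite ler_pdivrMr ?ltr0n//.
move: (n.+1%:R) hn => m hn; lra.
Qed.

End setup.

(** * The simultaneous coupling on the unit interval *)

Section near_optimal.
Context (R : realType) (X : completeMetricType R) (sepX : separable X) (q : R) (q_gt0 : 0 < q)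
  (q_lt1 : q < 1).
Context (mmd : measurable_fun setT (fun z : borel X * borel X => mdist (z.1 : X) z.2)).
Context (mu : {sigma_finite_measure set (borel X) -> \bar R}) (Psi : R) (Psi_gt0 : 0 < Psi).
Context (mu_ball : forall (x : X) (w : R), 0 < w -> (0 < mu (mcball x w) < +oo)%E).
Context (mu_diff : forall (x y : X) (w : R), 0 < w ->
     (mu (mcball x w `\` mcball y w) / mu (mcball x w) <= (Psi * mdist x y / w)%:E)%E).

Let target : R := 756 / 100 * ((247 / 100 * Psi) `^ q / (1 - q)).

Lemma unit_interval_family : exists K : R, [/\ 0 < K, K < target &
  exists g : probability (borel X) R -> measurableTypeR R -> borel X,
  [/\ forall Q, measurable_fun setT (g Q),
      forall (Q : probability (borel X) R) D, measurable D -> unif01 (g Q @^-1` D) = Q D &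
  forall (Q Q' : probability (borel X) R) d' (Om' : measurableType d') (P' : probability Om' R)
    (U V : Om' -> borel X),
    measurable_fun setT U -> measurable_fun setT V ->
    (forall S, measurable S -> P' (U @^-1` S) = Q S) -> (forall S, measurable S ->
      P' (V @^-1` S) = Q' S) ->
    (\int[@unif01 R]_x (mdist (g Q x : X) (g Q' x) `^ q)%:E <= K%:E * \int[P']_x (mdist (U x : X)
      (V x) `^ q)%:E)%E]].
Proof.
have [a a_dense] := dense_sequence sepX.
have s0 : 0 < 5 / 3 / q by rewrite !divr_gt0.
have [N [N0 rho_le]] := fine_scale s0.
have N0R : 0 < N%:R :> R by rewrite ltr0n.
(* [h] is the logarithm of the fine ratio [rho]; every [N]-th level forms a progression of ratio
   [theta]. *)
pose h := 5 / 3 / q / N%:R; pose rho := expR h; pose theta := expR (5 / 3 / q).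
have h0 : 0 < h by rewrite divr_gt0.
have rhoN : rho ^+ N = theta by rewrite /rho -expRM_natr /h divfK// gt_eqF.
have rho1 : 1 < rho by rewrite expR_gt1.
have th2 : 2 < theta := expR53_div_gt2 q_gt0 q_lt1.
have th1 : 0 < theta - 1 by rewrite subr_gt0 (lt_trans _ th2)// ltr1n.
pose A := Psi * theta / (theta - 1).
have A0 : 0 <= A by rewrite !mulr_ge0 ?expR_ge0 ?(ltW Psi_gt0)// invr_ge0 ltW.
have AB : A / rho ^+ N + Psi = A.
  by rewrite rhoN kappa_fixpoint// (lt_trans _ th2)// ltr1n.
pose v (j : int) : R := expR (h * j%:~R).
have v0 j : 0 < v j by exact: expR_gt0.
have vS j : v (j + 1) = rho * v j.
  by rewrite /v /rho -expRD intrD mulrDr mulr1 addrC.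
have [eps e0 epsE] : exists2 e : R, 0 < e & e = 1 / 1000 by exists (1 / 1000);
  [exact: cell_scale_gt0|].
pose K := (2 * (1 + eps)) `^ q * 2 * (1 + theta `^ q) * (rho * A `^ q / (q * (1 - q))) /
  (5 / 3 / q).
exists K; split.
- have q1 : 0 < 1 - q by rewrite subr_gt0.
  have r0 : 0 < rho by exact: expR_gt0.
  have Ap : 0 < A by rewrite !mulr_gt0 ?expR_gt0 ?invr_gt0.
  have m0 : 0 < 2 * (1 + eps) :> R by rewrite mulr_gt0// addr_gt0.
  rewrite /K.
  rewrite divr_gt0// mulr_gt0//; last by rewrite divr_gt0 ?mulr_gt0 ?powR_gt0.
  by rewrite mulr_gt0 ?addr_gt0 ?powR_gt0 ?expR_gt0// mulr_gt0 ?powR_gt0.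
- rewrite /K epsE; apply: (@constant_lt R q Psi rho q_gt0 q_lt1 Psi_gt0 _ rho_le theta A erefl
  erefl); exact: expR_gt0.
have U0 x : 0 <= @clamp01 R x by case/andP: (@clamp01_bnd R x).
have U1 x : @clamp01 R x <= 1 by case/andP: (@clamp01_bnd R x).
have lnr : ln rho = h by rewrite /rho expRK.
(* A single uniform number supplies all the randomness: its binary digits are split into copies, and
   each copy runs a race. *)
have := averaged (@measurable_split1 R) (@measurable_split2 R) (@split_law R)
  (measurable_sampler (@measurable_split1 R) (@measurable_split2 R) (@measurable_clamp01 R) U0)
  (sampler_law (@measurable_split1 R) (@measurable_split2 R) (@split_law R) (@measurable_clamp01 R)
    U0 U1 (@unif01_clamp_cdf R) (@unif01_clamp_int R))
  (sampler_dist (@measurable_split1 R) (@measurable_split2 R) (@split_law R) (@measurable_clamp01 R)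
    U0 U1 (@unif01_clamp_cdf R) (@unif01_clamp_int R))
  q_gt0 q_lt1 v0 vS rho1 (N := N) (rad := 1 + eps) (A := A) (B := Psi) (a := a)
  (ker := fun i n => ball_kernel mu a eps (v i) n).
rewrite rhoN lnr.
have -> : N%:R * h = 5 / 3 / q by rewrite /h mulrC divfK// gt_eqF.
apply => //.
- exact: addr_gt0.
- by rewrite -rhoN.
- by move=> i n; exact: measurable_ball_kernel.
- by move=> i n x; exact: ball_kernel_ge0.
- by move=> i x; exact: (ball_kernel_sum mmd mu_ball a_dense e0 (v0 i)).
- by move=> i n x; exact: ball_kernel_near.
- by move=> i x y; exact: (ball_kernel_diff mmd mu_ball mu_diff a_dense e0 (v0 i)).
Qed.

End near_optimal.

(** At [w = mdist x y / 3] the two balls are disjoint, so the quotient in [mu_diff] equals 1. *)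
Lemma doubling_constant_ge (R : realType) (X : completeMetricType R) (mu : {measure set (borel X) ->
  \bar R}) (Psi : R)
  (mu_ball : forall (x : X) (w : R), 0 < w -> (0 < mu (mcball x w) < +oo)%E)
  (mu_diff : forall (x y : X) (w : R), 0 < w ->
     (mu (mcball x w `\` mcball y w) / mu (mcball x w) <= (Psi * mdist x y / w)%:E)%E) (x y : X) :
  0 < mdist x y -> 1 <= 3 * Psi.
Proof.
move=> d0; have w0 : 0 < mdist x y / 3 by rewrite divr_gt0.
have dis : mcball x (mdist x y / 3) `\` mcball y (mdist x y / 3) = mcball x (mdist x y / 3).
  apply/seteqP; split => z; first by case.
  move=> xz; split => // yz; have := metric_triangle x z y; rewrite (metric_sym z y).
  by move: xz yz d0; rewrite /mcball /=; lra.
have := mu_diff x y _ w0; rewrite dis.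
have /andP[m0 m1] := mu_ball x _ w0.
rewrite -(@fineK _ (mu _)); last by rewrite ge0_fin_numE// ltW.
have f0 : 0 < fine (mu (mcball x (mdist x y / 3))) by rewrite fine_gt0// m0.
rewrite inver gt_eqF// -EFinM divff ?gt_eqF// lee_fin.
have -> : Psi * mdist x y / (mdist x y / 3) = 3 * Psi by field; rewrite gt_eqF.
by [].
Qed.

Theorem theorem4 (R : realType) (X : completeMetricType R)
  (sepX : separable X)
  (q : R) (q_gt0 : 0 < q) (q_lt1 : q < 1)
  (c : X -> X -> R)
  (c_cost : symmetric_cost (T := borel X) c)
  (cE : forall x y : X, c x y = mdist x y `^ q)
  (mu : {sigma_finite_measure set (borel X) -> \bar R})
  (Psi : R) (Psi_gt0 : 0 < Psi)
  (mu_ball : forall (x : X) (w : R), 0 < w ->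
     (0 < mu (mcball x w) < +oo)%E)
  (mu_diff : forall (x y : X) (w : R), 0 < w ->
     (mu (mcball x w `\` mcball y w) / mu (mcball x w)
        <= (Psi * mdist x y / w)%:E)%E)
  (mu_ratio :
     (limf_esup (fun w : R =>
        ereal_sup [set mu (mcball z.1 w) / mu (mcball z.2 w) |
          z in [set z : X * X | (mdist z.1 z.2 <= w)%R]])
        (pinfty_nbhs R) < +oo)%E) :
  (optimal_ratio (T := borel X) c (fun P : probability (borel X) R => P)
     < (756 / 100 * ((247 / 100 * Psi) `^ q / (1 - q)))%:E)%E.
Proof.
have [mc c0 _ _ [x0 [y0 cxy]]] := c_cost.
have mmd := measurable_mdist_of_powR q_gt0 cE mc.
(* The cost is not identically zero, which provides two distinct points; they force [1 <= 3 * Psi],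
   and then the bound exceeds 1. *)
have d0 : 0 < mdist x0 y0.
  rewrite lt_neqAle mdist_ge0 andbT eq_sym; apply: contraNneq cxy => e.
  by rewrite cE e powR0// gt_eqF.
have t1 := one_lt_target q_gt0 q_lt1 (doubling_constant_ge mu_ball mu_diff d0).
have [K [K0 Kt [g [mg gl gc]]]] := unit_interval_family sepX q_gt0 q_lt1 mmd Psi_gt0
  mu_ball mu_diff.
move: (756 / 100 * _) t1 Kt => t t1 Kt.
pose X_ (Q : probability (borel X) R) : lebesgue_line R -> borel X := g Q \o @line_id R.
have Xlaw Q : has_law (X_ Q) Q by apply: has_law_line; [exact: mg|exact: gl].
apply: (@le_lt_trans _ _ (coupling_ratio (T := borel X) c (fun P : probability (borel X) R
  => P) X_)).
  by apply: ereal_inf_lbound; exists X_.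
(* The witness has to be at least 1 in [coupling_ratio], while [K] might be smaller. *)
apply: (@le_lt_trans _ _ (Num.max 1 K)%:E); last by rewrite lte_fin gt_max t1.
apply: ereal_inf_lbound; exists (Num.max 1 K) => //; split; first by rewrite le_max lexx.
move=> Q Q'.
have cost0 (U V : lebesgue_line R -> borel X) : (0 <= expected_cost (T := borel X) c U V)%E.
  by apply: integral_ge0 => x _; rewrite lee_fin.
(* Any competing coupling, made constant outside [I01], plays the part of [U] and [V] in
   [unit_interval_family]; the infimum over all of them is taken at the end. *)
have lower (e : \bar R) : (exists U V, [/\ has_law U Q, has_law V Q' & e = expected_cost (T :=
  borel X) c U V]) ->
    (expected_cost (T := borel X) c (X_ Q) (X_ Q') <= K%:E * e)%E.
  move=> [U [V [UQ VQ ->]]].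
  rewrite -(on_unit_cost (point : borel X) mc c0 (proj1 UQ) (proj1 VQ)).
  under [X in (_ <= _ * X)%E]eq_integral do rewrite cE.
  apply: le_trans (gc Q Q' _ _ (@line01 R) (on_unit point U) (on_unit point V) _ _ _ _).
  - rewrite -(line_integral (f := fun x => (mdist (g Q x : X) (g Q' x) `^ q)%:E)).
    + by rewrite /expected_cost; apply: le_of_eq; apply: eq_integral => x _; rewrite cE.
    + apply/measurable_EFinP; have mp := @measurable_powR R q.
      by move: (measurableT_comp mp (measurable_mdist mmd (mg Q) (mg Q'))).
    + by move=> x; rewrite lee_fin powR_ge0.
  - by apply: measurable_on_unit; exact: (proj1 UQ).
  - by apply: measurable_on_unit; exact: (proj1 VQ).
  - exact: on_unit_law.
  - exact: on_unit_law.
have opt0 : (0 <= optimal_cost (T := borel X) c Q Q')%E.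
  by apply: le_ereal_inf_tmp => e [U [V [_ _ ->]]].
apply: (@le_trans _ _ (K%:E * optimal_cost (T := borel X) c Q Q')%E); last first.
  by apply: lee_wpmul2r => //; rewrite lee_fin le_max lexx orbT.
rewrite -lee_pdivrMl//; apply: le_ereal_inf_tmp => e He.
by rewrite lee_pdivrMl//; exact: lower.
Qed.
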